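(* Let $n\geqslant1$. For any strict partition $\lambda\in\mathcal{D}_{n-1}$ of length $\ell=\ell(\lambda)$, let $k=n-\ell$ if $n\equiv\ell\pmod2$ and $k=n-\ell-1$ if $n\not\equiv\ell\pmod2$. The type $D$ double Schubert polynomial $\mathfrak{D}_\lambda(X,Y)=\mathfrak{D}_{w_\lambda}(X,Y)$ is equal to $$(-1)^{f(\lambda)+|\lambda'|}\sum_{\alpha}\widetilde P_\alpha(X)\sum_{\beta}(-1)^{f(\alpha,\beta)+|\beta|}\,\widetilde P_{(\alpha\cup\beta)'}(Y)\,\det\bigl(e_{\beta_i-\lambda'_j}(Y_{n-1-\lambda'_j})\bigr)_{1\leqslant i,j\leqslant k},$$ where the first sum is over all $\alpha\in\mathcal{D}_{n-1}$ and the second over $\beta\in\mathcal{D}^+_{n-1}$ with $\beta\supset\lambda'$, $\ell(\beta)=k$ and $\alpha\cap\beta=\emptyset$.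
   Context: Partitions. $|\lambda|$ is the sum of the parts of a partition, $\ell(\lambda)$ the number of nonzero parts, $\lambda_r=0$ for $r>\ell(\lambda)$. $\cup,\cap,\smallsetminus$ are taken on sets of parts. $\rho_m=(m,m-1,\ldots,1)$; $\mathcal{D}_m$ is the set of strict partitions (distinct nonzero parts, possibly none) with all parts at most $m$. Here, for $\lambda\in\mathcal{D}_{n-1}$, the dual partition is $\lambda'=\rho_{n-1}\smallsetminus\lambda$ (complement of the parts of $\lambda$ in $\{1,\ldots,n-1\}$). $\mathcal{D}^+_{n-1}$ is the set of strictly decreasing sequences $\beta$ of elements of $\{0,1,\ldots,n-1\}$, with length $\ell(\beta)$ equal to the number of terms (a final term $0$ counts); they are thought of as elements of $\mathcal{D}_{n-1}$ possibly with an extra zero part (which is ignored in forming $(\alpha\cup\beta)'=\rho_{n-1}\smallsetminus(\alpha\cup\beta)$ and $\alpha\cap\beta$). $\beta\supset\lambda'$ means $\beta_i\geqslant\lambda'_i$ for all $i$. For $\alpha\in\mathcal{D}_{n-1}$, $\beta\in\mathcal{D}^+_{n-1}$: $n_i(\alpha,\beta)=\#\{j\mid\alpha_i>\beta_j\geqslant\alpha_{i+1}\}$ ($j$ running over the terms of $\beta$) and $f(\alpha,\beta)=\sum_{i=1}^{\ell(\alpha)}i\,n_i(\alpha,\beta)$. With $e(\lambda)=|\lambda|-\ell(\lambda)(\ell(\lambda)+1)/2$, put $f(\lambda)=e(\lambda)+\ell(\lambda)$ if $n\equiv\ell(\lambda)\pmod2$, and $f(\lambda)=e(\lambda)$ otherwise.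 Variables and polynomials. $X_m=(x_1,\ldots,x_m)$, $Y_m=(y_1,\ldots,y_m)$, $X=X_n$, $Y=Y_n$; $e_i$ is the elementary symmetric polynomial ($e_0=1$, $e_i=0$ for $i<0$). $\widetilde Q_i(X)=e_i(X)$, $\widetilde Q_{i,j}=\widetilde Q_i\widetilde Q_j+2\sum_{p=1}^j(-1)^p\widetilde Q_{i+p}\widetilde Q_{j-p}$, for $\lambda=(\lambda_1\geqslant\cdots\geqslant\lambda_r\geqslant0)$ with $r$ even (put $\lambda_r=0$ if necessary) $\widetilde Q_\lambda=\mathrm{Pfaffian}[\widetilde Q_{\lambda_i,\lambda_j}]_{1\leqslant i<j\leqslant r}$, and $\widetilde P_\lambda=2^{-\ell(\lambda)}\widetilde Q_\lambda$. $\widetilde P_{n-1}(X,Y)=\sum_{\lambda\in\mathcal{D}_{n-1}}\widetilde P_\lambda(X)\widetilde P_{\rho_{n-1}\smallsetminus\lambda}(Y)$ (in all $n$ variables $X$ and $Y$); $\Delta(X,Y)=\prod_{i+j\leqslant n}(x_i-y_j)$. Weyl group of type $D_n$. $\widetilde W_n$ is the group of signed permutations of $\{1,\ldots,n\}$ (a bar denotes a negative entry) with an even number of bars, generated by simple transpositions $s_i$ ($1\leqslant i\leqslant n-1$; right multiplication interchanges the entries in positions $i,i+1$) and $s_\Box$, with $(u_1,u_2,\ldots,u_n)s_\Box=(\overline{u}_2,\overline{u}_1,u_3,\ldots,u_n)$. Its longest element is $\widetilde w_0=(\overline1,\ldots,\overline n)$ if $n$ is even, $\widetilde w_0=(1,\overline2,\ldots,\overline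 n)$ if $n$ is odd. For $\lambda\in\mathcal{D}_{n-1}$ of length $\ell$, the maximal Grassmannian element is $w_\lambda=(\overline{\lambda_1+1},\ldots,\overline{\lambda_\ell+1},\widehat1,\mu_{n-\ell-1},\ldots,\mu_1)$, where $\mu=\rho_n\smallsetminus(\lambda_1+1,\ldots,\lambda_\ell+1,1)$ and $\widehat1$ is $1$ if $\ell$ is even and $\overline1$ if $\ell$ is odd. Divided differences. $\widetilde W_n$ acts on $\mathbb{Z}[1/2][Y][X]$: $s_i$ interchanges $x_i,x_{i+1}$; $s_\Box$ sends $(x_1,x_2)$ to $(-x_2,-x_1)$ and fixes the other variables. $\partial_i(f)=(f-s_if)/(x_i-x_{i+1})$, $\partial_\Box(f)=(f-s_\Box f)/(x_1+x_2)$; $\partial'_i=-\partial_i$ ($1\leqslant i\leqslant n-1$), $\partial'_\Box=\partial_\Box$; $\partial'_w$ is the composite $\partial'_{a_1}\circ\cdots\circ\partial'_{a_r}$ for a reduced word $w=s_{a_1}\cdots s_{a_r}$. The type $D$ double Schubert polynomials are $$\mathfrak{D}_w(X,Y)=(-1)^{n(n-1)/2}\,\partial'_{w^{-1}\widetilde w_0}\bigl(\Delta(X,Y)\widetilde P_{n-1}(X,Y)\bigr),\qquad w\in\widetilde W_n.$$ *)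

(* Defs.v *)
From HB Require Import structures.
From mathcomp Require Import all_boot all_order all_algebra all_fingroup.
From mathcomp.multinomials Require Import mpoly.
From mathcomp Require Import zify ring lra.
From Stdlib Require Import ClassicalEpsilon.

Set Implicit Arguments.
Unset Strict Implicit.
Unset Printing Implicit Defensive.

Import Order.TTheory GRing.Theory Num.Theory.

Local Open Scope ring_scope.

(** * The ring Z[1/2] *)

Definition is_dyadic : {pred rat} := fun r => 2%N.-nat `|denq r|%N.

Lemma is_dyadicP r :
  reflect (exists k, r * 2 ^+ k \is a Num.int) (r \in is_dyadic).
Proof.
have d0 : (denq r)%:~R != 0 :> rat by rewrite intr_eq0 denq_neq0.
apply: (iffP idP) => [|[k /intrP[z Dz]]].
  case/p_natP=> k Dk; exists k; apply/intrP; exists (numq r).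
  rewrite -{1}[r]divq_num_den.
  have <- : (denq r)%:~R = 2 ^+ k :> rat.
    by rewrite -[denq r]gez0_abs ?denq_ge0 // Dk -pmulrn natrX.
  by rewrite divfK.
have E : numq r * 2 ^+ k = z * denq r.
  apply: (@intr_inj rat); rewrite !rmorphM /= rmorphXn /= -Dz.
  by rewrite -{2}[r]divq_num_den mulrAC divfK.
have : (denq r %| 2 ^+ k)%Z.
  rewrite -(@Gauss_dvdzr _ (numq r)) ?E ?dvdz_mull //.
  by rewrite coprimez_sym; exact: coprime_num_den.
rewrite dvdzE abszX /= => /pnat_dvd; apply.
by rewrite pnatX.
Qed.

Fact is_dyadic_subring : subring_closed is_dyadic.
Proof.
split=> [|r s /is_dyadicP[k rk] /is_dyadicP[l sl]
         |r s /is_dyadicP[k rk] /is_dyadicP[l sl]].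
- by apply/is_dyadicP; exists 0; rewrite mulr1 rpred1.
- apply/is_dyadicP; exists (k + l)%N.
  have -> : (r - s) * 2 ^+ (k + l) =
            r * 2 ^+ k * 2 ^+ l - s * 2 ^+ l * 2 ^+ k by rewrite exprD; ring.
  by apply: rpredB; apply: rpredM => //; apply: rpredX; apply: rpred_nat.
- apply/is_dyadicP; exists (k + l)%N.
  by rewrite exprD mulrACA rpredM.
Qed.

HB.instance Definition _ :=
  GRing.isSubringClosed.Build rat is_dyadic is_dyadic_subring.

Record dyadic := Dyadic { dval :> rat; _ : dval \in is_dyadic }.

HB.instance Definition _ := [isSub for dval].
HB.instance Definition _ := [Choice of dyadic by <:].
HB.instance Definition _ := [SubChoice_isSubComNzRing of dyadic by <:].

Definition dyadic_unit : {pred dyadic} :=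
  fun x => (dval x != 0) && ((dval x)^-1 \in is_dyadic).
Definition dyadic_inv (x : dyadic) : dyadic :=
  if x \in dyadic_unit then insubd x (dval x)^-1 else x.

Fact dyadic_mulVr : {in dyadic_unit, left_inverse 1 dyadic_inv *%R}.
Proof.
move=> x ux; apply: val_inj; rewrite /dyadic_inv ux /=.
case/andP: ux => x0 dx.
by rewrite -[LHS]/(val (insubd x (dval x)^-1) * dval x) insubdK // mulVf.
Qed.
Fact dyadic_unitPl (x y : dyadic) : y * x = 1 -> x \in dyadic_unit.
Proof.
move=> /(congr1 val) /= yx1.
have x0 : dval x != 0 by apply: contra_eq_neq yx1 => ->; rewrite mulr0 eq_sym oner_eq0.
rewrite unfold_in x0 /=; suff -> : (dval x)^-1 = dval y by case: (y).
by rewrite -[LHS]mul1r -yx1 mulfK.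
Qed.
Fact dyadic_inv_out : {in [predC dyadic_unit], dyadic_inv =1 id}.
Proof. by move=> x; rewrite inE /dyadic_inv => /negbTE ->. Qed.

HB.instance Definition _ := GRing.ComNzRing_hasMulInverse.Build dyadic
  dyadic_mulVr dyadic_unitPl dyadic_inv_out.

Fact dyadic_idomain : GRing.integral_domain_axiom dyadic.
Proof.
move=> x y /(congr1 val) /= /eqP; rewrite mulf_eq0.
by case/orP=> /eqP h; apply/orP; [left|right]; apply/eqP/val_inj.
Qed.
HB.instance Definition _ :=
  GRing.ComUnitRing_isIntegral.Build dyadic dyadic_idomain.

Lemma dyadic_unit2 : (2 : dyadic) \is a GRing.unit.
Proof.
have h : (2 : rat)^-1 \in is_dyadic.
  by apply/is_dyadicP; exists 1; rewrite mulVf ?rpred1.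
by rewrite unfold_in /=.
Qed.

(** * Strict partitions

  A strict partition with parts at most [n - 1] is the set of its parts, taken
  in ['I_n]: the sets in [strict n] (no zero part) stand for D_{n-1}, and
  arbitrary sets (a zero part allowed) for D^+_{n-1}. *)

Section Partitions.
Variable n : nat.
Implicit Types A B : {set 'I_n}.

Definition strict : {set {set 'I_n}} :=
  [set A : {set 'I_n} | [forall i in A, (0 < i)%N]].

(* the parts in decreasing order, indexed from 0 by [part] *)
Definition parts A : seq nat := rev [seq val i | i <- enum A].
Definition part A (i : nat) : nat := nth 0%N (parts A) i.
Definition weight A : nat := (\sum_(i in A) i)%N.
Definition dualp A : {set 'I_n} := [set i : 'I_n | (0 < i)%N & i \notin A].

(* A_i >= B_i for all i, missing parts being zero *)
Definition contains A B : bool := [forall i : 'I_n, (part B i <= part A i)%N].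

Definition npart A B (i : nat) : nat :=
  #|[set b : 'I_n in B | (part A i.+1 <= b < part A i)%N]|.
Definition fpair A B : nat := (\sum_(i < #|A|) i.+1 * npart A B i)%N.

(* the truncated subtraction is exact, since the parts of A are distinct and
   positive *)
Definition epart A : nat := (weight A - (#|A| * #|A|.+1)./2)%N.
Definition fpart A : nat :=
  if odd n == odd #|A| then (epart A + #|A|)%N else epart A.

End Partitions.

(** * The polynomials Q~ and P~ *)

(* In this section v is the list of variables. *)
Section Polynomials.
Variable R : comUnitRingType.
Implicit Types (v : seq R) (l : seq nat).

Definition elsym v (i : int) : R :=
  if i is Posz k then (mesym (size v) R k).@[fun j => v`_j] else 0.

Definition Qtilde2 v (i j : nat) : R :=
  elsym v i * elsym v j
  + 2 * \sum_(1 <= p < j.+1) (-1) ^+ p * elsym v (i + p)%N * elsym v (j - p)%N.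

Fact double_ltn m (i : 'I_m) : (i.*2 < m.*2)%N.
Proof. by rewrite ltn_double. Qed.
Fact doubleS_ltn m (i : 'I_m) : (i.*2.+1 < m.*2)%N.
Proof. by rewrite ltn_Sdouble. Qed.

(* the Pfaffian of the triangular array [a i j], i < j: the signed sum over
   perfect matchings {s_0 < s_1}, {s_2 < s_3}, ... with s_0 < s_2 < ... *)
Definition pfaffian m (a : 'I_m.*2 -> 'I_m.*2 -> R) : R :=
  let fst (i : 'I_m) := Ordinal (double_ltn i) in
  let snd (i : 'I_m) := Ordinal (doubleS_ltn i) in
  \sum_(s : 'S_m.*2 | [forall i, s (fst i) < s (snd i)]%N &&
                      [forall i : 'I_m, forall j : 'I_m,
                         (i < j)%N ==> (s (fst i) < s (fst j))%N])
    (-1) ^+ s * \prod_(i < m) a (s (fst i)) (s (snd i)).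

(* the default value of [nth] supplies the zero part when [size l] is odd *)
Definition Qtilde v l : R :=
  @pfaffian (uphalf (size l)) (fun i j => Qtilde2 v (nth 0%N l i) (nth 0%N l j)).

Definition Ptilde v l : R := 2 ^- count (leq 1) l * Qtilde v l.

End Polynomials.

(** * Signed permutations

  [(i, false)] is the number i+1 and [(i, true)] is the same number with a bar;
  a signed permutation is a permutation of these symbols that commutes with the
  bar. Permutations compose left to right in the library, so the product
  u v = u \o v of signed permutations is [(v * u)%g]. *)

Section WeylGroup.
Variable n : nat.

Definition symb : finType := ('I_n * bool)%type.
Implicit Types (w : {perm symb}) (u : seq int).

Definition bar (p : symb) : symb := (p.1, ~~ p.2).
Definition symb_val (p : symb) : int := (-1) ^+ p.2 * p.1.+1%:Z.
Definition oneline w : seq int := [seq symb_val (w (i, false)) | i <- enum 'I_n].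

Definition weylD : {set {perm symb}} :=
  [set w : {perm symb} | [forall p, w (bar p) == bar (w p)]
         & ~~ odd #|[set i : 'I_n | (w (i, false)).2]|].

Definition of_oneline u : {perm symb} :=
  odflt 1%g [pick w in weylD | oneline w == u].

(* [Tr i] is the simple transposition of the positions i+1 and i+2 *)
Inductive gen := Tr i of (i.+1 < n)%N | Box of (1 < n)%N.

Definition lo i (h : (i.+1 < n)%N) : 'I_n := Ordinal (ltnW h).
Definition hi i (h : (i.+1 < n)%N) : 'I_n := Ordinal h.

Definition srefl (g : gen) : {perm symb} :=
  match g with
  | Tr i h => tperm (lo h, false) (hi h, false) * tperm (lo h, true) (hi h, true)
  | Box h => tperm (lo h, false) (hi h, true) * tperm (lo h, true) (hi h, false)
  end%g.

(* s_{a_1} ... s_{a_r} *)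
Definition prodw (a : seq gen) : {perm symb} :=
  foldr (fun g w => w * srefl g)%g 1%g a.

Definition reduced_word (a : seq gen) w : Prop :=
  prodw a = w /\ forall b, prodw b = w -> (size a <= size b)%N.

(* an arbitrary choice; [redwordP] below gives existence *)
Definition redword w : seq gen :=
  epsilon (inhabits [::]) (fun a => reduced_word a w).

Definition longest : {perm symb} :=
  of_oneline [seq if (i == 1%N) && odd n then 1 else - i%:Z | i <- iota 1 n].

(* one-line notation of the maximal Grassmannian element w_lam; the last block
   is mu in increasing order *)
Definition wmax_seq (lam : {set 'I_n}) : seq int :=
  [seq - p.+1%:Z | p <- parts lam]
  ++ (-1) ^+ #|lam|
  :: [seq p%:Z | p <- iota 1 n & p \notin 1%N :: [seq q.+1 | q <- parts lam]].
Definition wmax (lam : {set 'I_n}) : {perm symb} := of_oneline (wmax_seq lam).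

(** Every admissible sequence is the one-line notation of an element of
  [weylD]. *)

Lemma size_oneline w : size (oneline w) = n.
Proof. by rewrite size_map size_enum_ord. Qed.

Lemma nth_oneline w (i : 'I_n) : (oneline w)`_i = symb_val (w (i, false)).
Proof. by rewrite (nth_map i) ?size_enum_ord // nth_ord_enum. Qed.

Lemma abs_symb_val p : `|symb_val p|%N = p.1.+1.
Proof. by rewrite abszMsign. Qed.

Lemma symb_val_lt0 p : (symb_val p < 0) = p.2.
Proof. by case: p => i []; rewrite /symb_val ?expr0 ?expr1 /=; lia. Qed.

Lemma symb_val_inj : injective symb_val.
Proof.
move=> p q e; have := abs_symb_val p; have := symb_val_lt0 p; rewrite e.
rewrite abs_symb_val symb_val_lt0; case: p q {e} => i b [j c] /= -> [e].
by congr (_, _); apply: val_inj.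
Qed.

Lemma symb_val_bar p : symb_val (bar p) = - symb_val p.
Proof. by case: p => i []; rewrite /symb_val /= ?expr0 ?expr1; ring. Qed.

Lemma of_onelineP u :
    perm_eq [seq `|x|%N | x <- u] (iota 1 n) ->
    ~~ odd (count (fun x => x < 0) u) ->
  of_oneline u \in weylD /\ oneline (of_oneline u) = u.
Proof.
move=> pu ev; have szu : size u = n by rewrite -(size_map absz) (perm_size pu) size_iota.
have absE (i : 'I_n) : nth 0%N [seq `|x|%N | x <- u] i = absz u`_i.
  by rewrite (nth_map 0) ?szu.
have absP (i : 'I_n) : (0 < absz (u`_i)%R <= n)%N.
  have : nth 0%N [seq `|x|%N | x <- u] i \in iota 1 n.
    by rewrite -(perm_mem pu) mem_nth // size_map szu.
  by rewrite absE mem_iota; lia.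
pose F (p : symb) : symb := (insubd p.1 (absz u`_p.1).-1, p.2 (+) (u`_p.1 < 0)).
have Fv p : (F p).1 = (absz u`_p.1).-1 :> nat.
  by rewrite val_insubd; case: ifP => // /negP[]; have := absP p.1; lia.
have injF : injective F.
  move=> [i b] [j c] e.
  have eij : i = j.
    have eij : (F (i, b)).1 = (F (j, c)).1 :> nat by rewrite e.
    rewrite !Fv /= in eij.
    apply/val_inj/eqP; rewrite -(nth_uniq 0%N (s := [seq `|x|%N | x <- u]));
      rewrite ?size_map ?szu ?ltn_ord ?(perm_uniq pu) ?iota_uniq //.
    rewrite !absE -(prednK (proj1 (andP (absP i)))) -(prednK (proj1 (andP (absP j)))).
    by rewrite eqSS; apply/eqP.
  by have := congr1 (@snd _ _) e; rewrite /= eij => /addIb ->.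
have su (i : 'I_n) : symb_val (F (i, false)) = u`_i.
  have := absP i; rewrite /symb_val /= val_insubd; move: (nth _ u i) => x ax.
  case: ifP => [_|/negP[]]; last by lia.
  by case: (ltP x 0) => h; rewrite ?expr0 ?expr1; lia.
have ow : oneline (perm injF) = u.
  apply: (@eq_from_nth _ 0); rewrite size_oneline ?szu // => i hi.
  by rewrite (nth_oneline _ (Ordinal hi)) permE su.
have ww : perm injF \in weylD.
  rewrite inE; apply/andP; split.
    by apply/forallP=> [[i b]]; rewrite !permE /F /bar /= addNb.
  rewrite (_ : #|_| = count (fun x => x < 0) u) //.
  rewrite -sum1_card -sum1_count (big_nth 0) szu big_mkord.
  by apply: eq_bigl => i; rewrite inE permE.
rewrite /of_oneline; case: pickP => [w /andP[-> /eqP] //|/(_ (perm injF))].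
by rewrite ww ow eqxx.
Qed.

Lemma mem_parts (A : {set 'I_n}) (i : 'I_n) : (val i \in parts A) = (i \in A).
Proof. by rewrite mem_rev (mem_map val_inj) mem_enum. Qed.

Lemma parts_ltn (A : {set 'I_n}) p : p \in parts A -> (p < n)%N.
Proof. by rewrite mem_rev => /mapP[i _ ->]; apply: ltn_ord. Qed.

Lemma parts_uniq (A : {set 'I_n}) : uniq (parts A).
Proof. by rewrite rev_uniq (map_inj_uniq val_inj) enum_uniq. Qed.

Lemma size_parts (A : {set 'I_n}) : size (parts A) = #|A|.
Proof. by rewrite size_rev size_map cardE. Qed.

Lemma wmaxP (lam : {set 'I_n}) : (0 < n)%N -> lam \in strict n ->
  wmax lam \in weylD /\ oneline (wmax lam) = wmax_seq lam.
Proof.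
move=> n0; rewrite inE => /forall_inP lam0.
have partsP p : p \in parts lam -> (0 < p < n)%N.
  move=> hp; have pn := parts_ltn hp; rewrite pn andbT.
  by apply: (lam0 (Ordinal pn)); rewrite -mem_parts.
apply: of_onelineP.
  rewrite /wmax_seq map_cat /= -!map_comp abszX exp1n.
  rewrite (eq_map (_ : _ =1 succn)); last by move=> p /=; lia.
  rewrite [X in _ ++ _ :: X](eq_map (_ : _ =1 id)); last by move=> p /=; lia.
  rewrite map_id -cat1s perm_catCA catA cat1s.
  rewrite perm_sym -(perm_filterC (mem (1%N :: map succn (parts lam)))) perm_sym.
  rewrite perm_cat2r.
  apply: uniq_perm => [||p]; last 1 first.
  - rewrite mem_filter mem_iota /= andb_idr // inE.
    by case/orP=> [/eqP->|/mapP[q /partsP]]; lia.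
  - rewrite /= map_inj_uniq ?parts_uniq ?andbT; last exact: succn_inj.
    by apply/mapP => -[p /partsP]; lia.
  - by rewrite filter_uniq ?iota_uniq.
rewrite /wmax_seq count_cat /= !count_map.
rewrite (eq_count (_ : _ =1 predT)); last by move=> p /=; lia.
rewrite count_predT size_parts [X in (_ + (_ + X))%N](_ : _ = 0%N); last first.
  by apply/eqP; rewrite -leqn0 leqNgt -has_count; apply/hasPn => p _ /=; lia.
rewrite addn0 oddD -signr_odd; case: (odd _); rewrite ?expr0 ?expr1 //=.
Qed.

Lemma longestP : longest \in weylD /\
  oneline longest =
    [seq if (i == 1%N) && odd n then 1 else - i%:Z | i <- iota 1 n].
Proof.
apply: of_onelineP.
  rewrite -map_comp (_ : map _ _ = iota 1 n) // -[RHS]map_id.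
  by apply/eq_in_map => i; rewrite mem_iota /=; case: ifP => //; lia.
rewrite count_map; case: n => // m.
rewrite [iota 1 _]/= -cat1s count_cat (_ : count _ (iota _ _) = m); last first.
  rewrite -[RHS](size_iota 2 m) -count_predT; apply: eq_in_count => i.
  by rewrite mem_iota /=; case: ifP; lia.
by rewrite /= addn0 oddD; case: (odd m).
Qed.

(** The simple reflections generate [weylD], so reduced words exist. *)

Definition glo g := match g with Tr i h => lo h | Box h => lo h end.
Definition ghi g := match g with Tr i h => hi h | Box h => hi h end.
Definition geps g := if g is Box _ then true else false.

Lemma simpleE g : srefl g = (tperm (glo g, false) (ghi g, geps g)
                            * tperm (glo g, true) (ghi g, ~~ geps g))%g.
Proof. by case: g. Qed.

Lemma ghi_val g : ghi g = (glo g).+1 :> nat. Proof. by case: g. Qed.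
Lemma glo_ghi g : (glo g == ghi g) = false.
Proof. by apply/negbTE; rewrite -val_eqE /= ghi_val; lia. Qed.
Lemma ghi_glo g : (ghi g == glo g) = false.
Proof. by rewrite eq_sym glo_ghi. Qed.

Lemma simple_lo g b : srefl g (glo g, b) = (ghi g, b (+) geps g).
Proof.
rewrite simpleE permM; case: b.
  by rewrite [tperm (_, false) _ _]tpermD ?tpermL // xpair_eqE ?ghi_glo ?andbF.
by rewrite tpermL tpermD // xpair_eqE ?glo_ghi //; case: geps; rewrite ?andbF.
Qed.

Lemma simple_hi g b : srefl g (ghi g, b) = (glo g, b (+) geps g).
Proof.
rewrite simpleE permM; case: (eqVneq b (geps g)) => [->|h].
  by rewrite tpermR tpermD ?addbb // xpair_eqE ?ghi_glo ?andbF.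
have -> : b = ~~ geps g by case: (b) (geps g) h => [] [].
rewrite [tperm (_, false) _ _]tpermD ?tpermR ?xpair_eqE ?glo_ghi ?eqxx //.
  by case: geps.
by case: geps.
Qed.

Lemma simple_out g i b : i != glo g -> i != ghi g -> srefl g (i, b) = (i, b).
Proof.
move=> h1 h2; rewrite simpleE permM !tpermD ?xpair_eqE //;
by rewrite negb_and 1?[glo g == _]eq_sym 1?[ghi g == _]eq_sym ?h1 ?h2.
Qed.

Lemma simpleK g : (srefl g * srefl g = 1)%g.
Proof.
apply/permP => -[i b]; rewrite permM perm1.
case: (eqVneq i (glo g)) => [->|h1]; first by rewrite simple_lo simple_hi addbK.
case: (eqVneq i (ghi g)) => [->|h2]; first by rewrite simple_hi simple_lo addbK.
by rewrite !simple_out.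
Qed.

Lemma simple_bar g p : srefl g (bar p) = bar (srefl g p).
Proof.
case: p => i b; rewrite /bar /=.
case: (eqVneq i (glo g)) => [->|h1]; first by rewrite !simple_lo /= addNb.
case: (eqVneq i (ghi g)) => [->|h2]; first by rewrite !simple_hi /= addNb.
by rewrite !simple_out.
Qed.

Lemma sum_simple (V : nmodType) (H : 'I_n -> symb -> V) g :
  \sum_i H i (srefl g (i, false)) =
    H (glo g) (ghi g, geps g) + (H (ghi g) (glo g, geps g)
    + \sum_(i | (i != glo g) && (i != ghi g)) H i (i, false)).
Proof.
rewrite (bigD1 (glo g)) //= simple_lo (bigD1 (ghi g)) ?ghi_glo //= simple_hi.
congr (_ + (_ + _)); apply: eq_bigr => i /andP[h1 h2].
by rewrite simple_out.
Qed.

Lemma sum_id (V : nmodType) (H : 'I_n -> symb -> V) g :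
  \sum_i H i (i, false) =
    H (glo g) (glo g, false) + (H (ghi g) (ghi g, false)
    + \sum_(i | (i != glo g) && (i != ghi g)) H i (i, false)).
Proof. by rewrite (bigD1 (glo g)) //= (bigD1 (ghi g)) ?ghi_glo. Qed.

Lemma weylDP w : reflect ((forall p, w (bar p) = bar (w p)) /\
    ~~ odd (\sum_i (w (i, false)).2)%N) (w \in weylD).
Proof.
have -> : (\sum_i (w (i, false)).2 = #|[set i : 'I_n | (w (i, false)).2]|)%N.
  rewrite -sum1_card [RHS]big_mkcond; apply: eq_bigr => i _.
  by rewrite inE; case: (_.2).
rewrite inE; apply: (iffP andP) => -[h ->]; split=> //.
  by move=> p; apply/eqP; move/forallP: h; apply.
by apply/forallP => p; apply/eqP.
Qed.

Lemma simple_weylD g w : w \in weylD -> (srefl g * w)%g \in weylD.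
Proof.
move=> /weylDP[wb ev]; apply/weylDP; split=> [p|].
  by rewrite !permM simple_bar wb.
under eq_bigr do rewrite permM.
pose H p := nat_of_bool (w p).2.
have E1 := sum_simple (fun _ => H) g; have E2 := sum_id (fun _ => H) g.
move: E1 E2; set S := (X in _ = _ + (_ + X)) => E1 E2.
have {}E1 : (\sum_i H (srefl g (i, false)) =
  H (ghi g, geps g) + (H (glo g, geps g) + S))%N by [].
have {}E2 : (\sum_i H (i, false) =
  H (glo g, false) + (H (ghi g, false) + S))%N by [].
rewrite E1; move: ev; rewrite E2 !oddD /H.
have wbt i : (w (i, true)).2 = ~~ (w (i, false)).2 by rewrite (wb (i, false)).
by case: (geps g); rewrite ?wbt; case: (w (glo g, false)).2;
  case: (w (ghi g, false)).2; case: (odd S).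
Qed.

Definition moment w : int := \sum_(i < n) i.+1%:Z * symb_val (w (i, false)).

Lemma moment_simple g w : w \in weylD ->
  moment (srefl g * w) = moment w +
    if geps g then (2 * (glo g)%:Z + 3) *
      - (symb_val (w (glo g, false)) + symb_val (w (ghi g, false)))
    else symb_val (w (glo g, false)) - symb_val (w (ghi g, false)).
Proof.
move=> /weylDP[wb _]; rewrite /moment.
under eq_bigr do rewrite permM.
rewrite (sum_simple (fun i p => i.+1%:Z * symb_val (w p))).
rewrite (sum_id (fun i p => i.+1%:Z * symb_val (w p)) g) /= ghi_val.
have wbt i : symb_val (w (i, true)) = - symb_val (w (i, false)).
  by rewrite -symb_val_bar -wb.
set S := \sum_(_ | _) _; rewrite -[(glo g).+2]addn2 -[(glo g).+1]addn1 !PoszD.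
by case: geps; rewrite ?wbt; ring.
Qed.

Lemma prodw_rcons a g : prodw (rcons a g) = (srefl g * prodw a)%g.
Proof. by elim: a => [|h a IH] /=; rewrite ?mulg1 ?mul1g // IH mulgA. Qed.

Lemma moment_le w : moment w <= (n * (n * n))%:Z.
Proof.
apply: (@le_trans _ _ (\sum_(i < n) (n * n)%:Z)); last first.
  by rewrite sumr_const card_ord; lia.
apply: ler_sum => i _; have := abs_symb_val (w (i, false)).
have := ltn_ord (w (i, false)).1; move: (symb_val _) (_.1) => x j hj xj.
have xn : x <= n%:Z by lia.
apply: (@le_trans _ _ (i.+1%:Z * n%:Z)); first by rewrite ler_wpM2l.
by rewrite -PoszM lez_nat leq_mul2r ltn_ord orbT.
Qed.

Lemma top_weylD w : w \in weylD ->
  (forall g, moment (srefl g * w) <= moment w) -> w = 1%g.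
Proof.
move=> wD wmx; have /weylDP[wb ev] := wD.
pose v i := (oneline w)`_i.
have vE (i : 'I_n) : v i = symb_val (w (i, false)) by rewrite /v nth_oneline.
have v_abs i : (i < n)%N -> (0 < absz (v i) <= n)%N.
  by move=> hi; rewrite (vE (Ordinal hi)) abs_symb_val /=.
have v_inj i j : (i < n)%N -> (j < n)%N -> `|v i| = `|v j| -> i = j.
  move=> hi hj; rewrite (vE (Ordinal hi)) (vE (Ordinal hj)) => e.
  have {}e : (w (Ordinal hi, false)).1 = (w (Ordinal hj, false)).1.
    apply: val_inj => /=; apply: succn_inj; rewrite -!abs_symb_val; lia.
  have : w (Ordinal hi, false) = w (Ordinal hj, false)
      \/ w (Ordinal hi, false) = w (Ordinal hj, true).
    rewrite (wb (Ordinal hj, false)) /bar.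
    move: (w (Ordinal hi, false)) (w (Ordinal hj, false)) e.
    by move=> [a b] [c d] /= ->; case: b d => [] []; [left|right|right|left].
  by case=> /perm_inj[].
have v_lt i : (i.+1 < n)%N -> v i < v i.+1.
  move=> h; have := wmx (Tr h); rewrite moment_simple //= -!vE /=.
  have := @v_inj i i.+1 (ltnW h) h.
  case: (v i =P v i.+1) => [->|]; last by lia.
  by move=> /(_ erefl); lia.
have v01 : (1 < n)%N -> 0 < v 0%N + v 1%N.
  move=> h; have := wmx (Box h); rewrite moment_simple //= -!vE /=.
  have := @v_inj 0%N 1%N (ltnW h) h.
  case: (v 0%N =P - v 1%N) => [->|]; last by lia.
  by rewrite normrN => /(_ erefl).
have v_pos1 i : (i.+1 < n)%N -> 0 < v i.+1.
  elim: i => [|i IH] h; first by have := v_lt 0%N h; have := v01 h; lia.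
  by have := v_lt _ h; have := IH (ltnW h); lia.
have v_pos i : (i < n)%N -> 0 < v i.
  case: i => [n0|i]; last exact: v_pos1.
  move: ev; rewrite (bigD1 (Ordinal n0)) //= big1 ?addn0; last first.
    move=> [[|i] hi] // _; rewrite -symb_val_lt0 -vE /=.
    by have := v_pos1 i hi; case: ltP => //; lia.
  rewrite -symb_val_lt0 -vE /=; have := v_abs _ n0.
  by case: (ltP (v 0%N) 0) => //; lia.
have v_ge i : (i < n)%N -> i.+1%:Z <= v i.
  elim: i => [|i IH] h; first by have := v_pos _ h; lia.
  by have := v_lt _ h; have := IH (ltnW h); lia.
have v_le j : (j < n)%N -> v (n - j.+1)%N <= (n - j)%N%:Z.
  elim: j => [|j IH] h.
    by have := v_abs (n - 1)%N; have := v_pos (n - 1)%N; lia.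
  have := IH (ltnW h); have := @v_lt (n - j.+2)%N.
  by rewrite (_ : (n - j.+2).+1 = n - j.+1)%N; lia.
have vid (i : 'I_n) : w (i, false) = (i, false).
  apply: symb_val_inj; rewrite -vE /symb_val expr0 mul1r /=.
  have := v_ge i (ltn_ord i); have := @v_le (n - i.+1)%N.
  have hi := ltn_ord i.
  by rewrite (_ : n - (n - i.+1).+1 = i)%N; lia.
apply/permP => -[i []]; rewrite perm1 ?vid //.
by rewrite (wb (i, false)) vid.
Qed.

Lemma weylD_word w : w \in weylD -> exists a, prodw a = w.
Proof.
have [N] := ubnP (absz ((n * (n * n))%:Z - moment w)).
elim: N w => // N IH w hN wD.
case: (classic (forall g, moment (srefl g * w) <= moment w)) => [/(top_weylD wD)->|].
  by exists [::].
move=> /not_all_ex_not[g /negP]; rewrite -ltNge => lt_g.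
have gD := simple_weylD g wD; have gB := moment_le (srefl g * w).
have [|//|a ea] := IH (srefl g * w)%g; first by have := moment_le w; lia.
by exists (rcons a g); rewrite prodw_rcons ea mulgA simpleK mul1g.
Qed.

Lemma prodw_cat a b : prodw (a ++ b) = (prodw b * prodw a)%g.
Proof. by elim: a => [|g a IH] /=; rewrite ?mulg1 // IH mulgA. Qed.

Lemma prodw_rev a : prodw (rev a) = (prodw a)^-1%g.
Proof.
elim: a => [|g a IH] /=; first by rewrite invg1.
rewrite rev_cons prodw_rcons IH invMg; congr (_ * _)%g.
by apply: (mulIg (srefl g)); rewrite simpleK mulVg.
Qed.

Lemma redwordP w : w \in weylD ->
  reduced_word (redword (longest * w^-1)) (longest * w^-1)%g.
Proof.
case/weylD_word=> a <-; case/weylD_word: (proj1 longestP) => b <-.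
rewrite -prodw_rev -prodw_cat; set v := prodw _.
apply: (epsilon_spec (inhabits [::]) (fun a => reduced_word a v)).
have [N] := ubnP (size (rev a ++ b)).
have : prodw (rev a ++ b) = v by [].
move: (rev a ++ b) => c; elim: N c => // N IH c ec hN.
have [//|] := classic (exists d, prodw d = v /\ (size d < size c)%N).
  by case=> d [ed hd]; apply: (IH d ed); lia.
move=> no; exists c; split=> // d ed; rewrite leqNgt; apply/negP => hd.
by apply: no; exists d.
Qed.

End WeylGroup.

(** * Divided differences *)

Section DividedDifferences.
Variables (S : idomainType) (n : nat).
Implicit Types (f : {mpoly S[n]}) (g : gen n) (w : {perm symb n}).

(* w sends x_i to x_j or -x_j according to the i-th entry of its one-line
   notation *)
Definition wact w f : {mpoly S[n]} :=
  f \mPo [tuple (-1) ^+ (w (i, false)).2 *: 'X_((w (i, false)).1) | i < n].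

Definition sroot g : {mpoly S[n]} :=
  match g with
  | Tr i h => 'X_(lo h) - 'X_(hi h)
  | Box h => 'X_(lo h) + 'X_(hi h)
  end.

Lemma ddiff_subproof g f : exists q, sroot g * q == f - wact (srefl g) f.
Proof.
pose D f := exists q, sroot g * q == f - wact (srefl g) f.
have D1 : D 1 by exists 0; rewrite mulr0 /wact rmorph1 subrr.
have DM f1 f2 : D f1 -> D f2 -> D (f1 * f2).
  move=> [q1 /eqP e1] [q2 /eqP e2].
  exists (q1 * f2 + wact (srefl g) f1 * q2); rewrite mulrDr mulrA e1 mulrCA e2.
  by rewrite /wact rmorphM /= -/(wact _ _); apply/eqP; ring.
have DX i : D 'X_i.
  rewrite /D /wact comp_mpolyXU -tnth_nth tnth_mktuple.
  case: (eqVneq i (glo g)) => [->|h1].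
    exists 1; rewrite simple_lo mulr1 addFb.
    by case: (g) => [k h|h]; rewrite /= ?expr0 ?expr1 ?scale1r ?scaleN1r ?opprK.
  case: (eqVneq i (ghi g)) => [->|h2].
    exists ((-1) ^+ ~~ geps g); rewrite simple_hi addFb.
    case: (g) => [k h|h]; rewrite /= ?expr0 ?expr1 ?scale1r ?scaleN1r.
      by apply/eqP; ring.
    by apply/eqP; ring.
  by exists 0; rewrite simple_out // expr0 scale1r mulr0 subrr.
have DXm m : D 'X_[m].
  rewrite mpolyXE_id; elim/big_ind: _ => // i _.
  by elim: (m i) => [|k IH]; rewrite ?expr0 // exprS; apply: DM.
elim/mpolyind: f => [|c m f _ _ [q /eqP e]].
  by exists 0; rewrite mulr0 /wact rmorph0 subrr.
have [p /eqP ep] := DXm m.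
exists (c *: p + q); rewrite mulrDr -scalerAr ep e /wact rmorphD /= comp_mpolyZ.
by apply/eqP; rewrite scalerBr opprD addrACA.
Qed.

(* the quotient (f - s f) / root, which exists by the lemma above *)
Definition ddiff g f : {mpoly S[n]} := xchoose (ddiff_subproof g f).

Lemma ddiffP g f : sroot g * ddiff g f = f - wact (srefl g) f.
Proof. exact/eqP/(xchooseP (ddiff_subproof g f)). Qed.

Lemma sroot_neq0 g : sroot g != 0.
Proof.
have c : (sroot g)@_(U_(glo g)) = 1.
  have e : (U_(ghi g) == U_(glo g))%MM = false by rewrite eq_mnm1 ghi_glo.
  by case: g e => [k h|h] /= e; rewrite ?mcoeffB ?mcoeffD !mcoeffX eqxx e ?subr0 ?addr0.
by apply: contra_eq_neq c => ->; rewrite mcoeff0 eq_sym oner_neq0.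
Qed.

Lemma ddiff_unique g f q : sroot g * q = f - wact (srefl g) f -> q = ddiff g f.
Proof. by rewrite -ddiffP; apply: mulfI (sroot_neq0 g) _ _. Qed.

(* the operators with the sign change for the transpositions *)
Definition ddiff' g f : {mpoly S[n]} :=
  if g is Box _ then ddiff g f else - ddiff g f.

Definition ddiffw (a : seq (gen n)) f : {mpoly S[n]} := foldr ddiff' f a.

End DividedDifferences.

(** * Double Schubert polynomials of type D *)

Section Schubert.
Variable n : nat.

Local Notation ZYX := {mpoly {mpoly dyadic[n]}[n]}.

Definition x_ (i : 'I_n) : ZYX := 'X_i.
Definition y_ (i : 'I_n) : ZYX := ('X_i)%:MP.
Definition X : seq ZYX := [seq x_ i | i <- enum 'I_n].
Definition Y : seq ZYX := [seq y_ i | i <- enum 'I_n].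

Definition Ptop : ZYX :=
  \sum_(lam in strict n) Ptilde X (parts lam) * Ptilde Y (parts (dualp lam)).

(* i + j <= n for the 1-based indices *)
Definition Delta : ZYX :=
  \prod_(i < n) \prod_(j < n | (i.+1 + j.+1 <= n)%N) (x_ i - y_ j).

(* [(longest n * w^-1)%g] is the product w^{-1} w_0, see above *)
Definition schubertD (w : {perm symb n}) : ZYX :=
  (-1) ^+ (n * n.-1)./2 * ddiffw (redword (longest n * w^-1)%g) (Delta * Ptop).

Lemma ZYX_unit2 : (2 : ZYX) \is a GRing.unit.
Proof.
have -> : (2 : ZYX) = ((2 : dyadic)%:MP : {mpoly dyadic[n]})%:MP.
  by rewrite !rmorph_nat.
by do 2![apply: rmorph_unit]; apply: dyadic_unit2.
Qed.

End Schubert.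

(* Main.v *)
From HB Require Import structures.
Require Import Defs.
From mathcomp Require Import all_boot all_order all_algebra all_fingroup.
From mathcomp.multinomials Require Import mpoly.
From mathcomp Require Import zify ring.

Set Implicit Arguments.
Unset Strict Implicit.
Unset Printing Implicit Defensive.

Import GRing.Theory.

Local Open Scope ring_scope.

(** Write s for the change of sign of the first variable.  Conjugation by s
exchanges s_1 and s_Box, so that the group of type D sits in the group of all
signed permutations with s available.  The product w_lam^-1 w_0 then factors
into steps indexed by the exponents q = n-1, ..., 0, of one of two kinds: a run
s_q ... s_1, or the full run s_(n-1) ... s_1 times s.  The second kind occurs
when a = n-1-q is a part of lam', or when a = 0 and n and l(lam) have the same
parity; these a form a set Z of even size k, so that the factors s cancel.

Let Delta_q be the product of the x_i - y_j over i + j <= q.  Both kinds of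
steps lower the staircase Delta_(q+1) to Delta_q.  If the other factor is
symmetric, a step of the first kind does nothing else but contribute a sign
([drop_step]).  A step of the second kind, applied to Delta_(q+1) P_gamma(X),
gives Delta_q times the alternating sum over the parts b of gamma of a
coefficient times P_(gamma minus b)(X) ([flip_step], [flip_step_PtildeX]).

The reason is the behaviour of Q-tilde under s.  The array of Qtilde2 changes
by an array of rank two, so the Pfaffian changes, up to its sign, by a single
contraction against the elementary symmetric polynomials of the other variables
([Qtilde_flip]).  Those are dual, under the run of divided differences, to the
powers of the first variable ([ddiffw_run_elsym]): contraction by e_b turns
into contraction by a coefficient of the polynomial in x_1 in front.

Iterating over Z composes k contractions.  Contractions anticommute, so the
composite is a sum over the k-subsets beta of the parts of gamma and 0, with a
k by k minor as coefficient ([contractions_det]).  The polynomials in front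
are the products (x - y_1)...(x - y_d), hence the entries of the minor are, up to
sign, the e_(beta_i - lam'_j) of the first n-1-lam'_j variables y.  Putting
alpha = gamma minus beta in the sum defining the top polynomial gives the
formula ([schubert_expand], [schubert_wmax]).

The definition uses an arbitrary reduced word of w_lam^-1 w_0.  That the word
of the steps may be used instead rests on two facts: divided differences along
reduced words depend only on the product, and those along other words vanish
([ddiffw_reduced], [ddiffw_nonreduced]).  The word of the steps is reduced
because its operator does not vanish: with powers of x in place of the products
above, each step of the second kind removes one prescribed part and nothing
cancels ([ddiffw_redword]). *)

(** * Contractions and the Pfaffian *)

Section Contraction.
Variables (T : Type) (R : comNzRingType).
Implicit Types (u v w : T -> R) (f g : seq T -> R) (s : seq T).

(** The interior product by [w]: the function [f] on words is read as an
  alternating form, and the j-th letter is taken out with the sign (-1)^j, see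
  [contr_sum]. *)
Fixpoint contr w f s : R :=
  if s is x :: s' then w x * f s' - contr w (fun t => f (x :: t)) s' else 0.

Lemma eq_contr w w' f f' s :
    w =1 w' -> (forall t, (size t < size s)%N -> f t = f' t) ->
  contr w f s = contr w' f' s.
Proof.
move=> ew; elim: s f f' => //= x s IH f f' ef.
by rewrite ew ef // (IH _ (fun t => f' (x :: t))) // => t ht; apply: ef.
Qed.

Lemma contrD w f g s : contr w (fun t => f t + g t) s = contr w f s + contr w g s.
Proof.
elim: s f g => /= [|x s IH] f g; first by rewrite addr0.
by rewrite IH; ring.
Qed.

Lemma contrZ w a f s : contr w (fun t => a * f t) s = a * contr w f s.
Proof.
elim: s f => /= [|x s IH] f; first by rewrite mulr0.
by rewrite IH; ring.
Qed.

Lemma contrZl a w f s : contr (fun x => a * w x) f s = a * contr w f s.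
Proof.
elim: s f => /= [|x s IH] f; first by rewrite mulr0.
by rewrite IH; ring.
Qed.

Lemma contrDl u v a f s :
  contr (fun x => u x + a * v x) f s = contr u f s + a * contr v f s.
Proof.
elim: s f => /= [|x s IH] f; first by rewrite mulr0 addr0.
by rewrite IH; ring.
Qed.

Lemma contr_lin w a f g s :
  contr w (fun t => a * f t - g t) s = a * contr w f s - contr w g s.
Proof.
elim: s f g => /= [|x s IH] f g; first by rewrite mulr0 subr0.
by rewrite IH; ring.
Qed.

Lemma contr0 w s : contr w (fun=> 0) s = 0.
Proof. by elim: s => //= x s ->; rewrite mulr0 subrr. Qed.

(** This is why the Pfaffian may be expanded along any row, and why
  contractions compose to determinants. *)
Lemma contr_antisym u v f s : contr u (contr v f) s = - contr v (contr u f) s.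
Proof.
elim: s f => /= [|x s IH] f; first by rewrite oppr0.
rewrite (contr_lin u (v x)) (contr_lin v (u x)) IH; ring.
Qed.

Lemma contr_sqr w f s : contr w (contr w f) s = 0.
Proof.
elim: s f => //= x s IH f.
by rewrite (contr_lin w (w x)) IH; ring.
Qed.

(** Compares expansion from the left with expansion from the right; it is the
  bridge to [pf_rcons]. *)
Lemma contr_rcons w f s z :
  contr w f (rcons s z) =
  contr w (fun t => f (rcons t z)) s + (-1) ^+ size s * w z * f s.
Proof.
elim: s f => /= [|x s IH] f; first by rewrite expr0; ring.
by rewrite IH exprS; ring.
Qed.

Lemma contr_parity w f (b : bool) s :
    (forall t, odd (size t) = b -> f t = 0) ->
  odd (size s) = ~~ b -> contr w f s = 0.
Proof.
elim: s b f => //= x s IH b f f0 os.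
rewrite (f0 s) ?(IH (~~ b)) ?mulr0 ?subrr //.
- by move=> t ht; apply: f0; rewrite /= ht negbK.
- by rewrite -os negbK.
- by move: os; case: (odd _) b {f0} => [] [].
Qed.

End Contraction.

Section RecursivePfaffian.
Variables (T : Type) (R : comNzRingType) (A : T -> T -> R).

(** Each expansion step removes the first letter and some other one, so the
  recursion is on a bound for the length. *)
Fixpoint pf_fuel m (s : seq T) : R :=
  if s is x :: s' then if m is m'.+1 then contr (A x) (pf_fuel m') s' else 0
  else 1.
Definition pf s := pf_fuel (size s) s.

Lemma pf_fuelE m s : (size s <= m)%N -> pf_fuel m s = pf s.
Proof.
rewrite /pf; have [N] := ubnP (size s); elim: N s m => // N IH [|x s] [|m] //=.
rewrite !ltnS => hN hm; apply: eq_contr => // t ht.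
by rewrite !IH //; lia.
Qed.

Lemma pf_cons x s : pf (x :: s) = contr (A x) pf s.
Proof.
by rewrite /pf /=; apply: eq_contr => // t ht; rewrite pf_fuelE //; lia.
Qed.

Lemma pf_odd s : odd (size s) -> pf s = 0.
Proof.
have [N] := ubnP (size s); elim: N s => // N IH [|x s] //= hN os.
rewrite pf_cons -(contr0 (A x) s).
have {}IH t : (size t < N)%N -> odd (size t) -> pf t = 0 by apply: IH.
rewrite contr0 -(@contr_parity _ _ (A x) (fun t => if (size t < N)%N then pf t else 0) true s).
- by apply: eq_contr => // t ht; rewrite (_ : (size t < N)%N) //; lia.
- by move=> t ot; case: ifP => // /IH; apply.
- by rewrite (negbTE os).
Qed.

(** When the last letter [z] has the column [e], the expansion along that
  column is the contraction by [e].  It is reached from the first row by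
  anticommuting the two contractions. *)
Lemma pf_rcons (e : T -> R) z s :
    (forall x, A x z = e x) -> odd (size s) ->
  pf (rcons s z) = contr e pf s.
Proof.
move=> ez; have [N] := ubnP (size s); elim: N s => // N IH [|x s] //= hN os.
rewrite pf_cons contr_rcons ez -signr_odd (negbTE os) expr0 mul1r.
rewrite (@eq_contr _ _ (A x) (A x) _ (contr e pf)) //; last first.
  move=> t ht; case ot: (odd (size t)); first by rewrite IH //; lia.
  rewrite pf_odd ?size_rcons /= ?ot // (@contr_parity _ _ e pf true) ?ot //.
  by move=> r; apply: pf_odd.
rewrite contr_antisym addrC; congr (_ - _).
by apply: eq_contr => // t _; rewrite pf_cons.
Qed.

End RecursivePfaffian.

(** The correction is the 2-form [e] wedge [g] up to a scalar.  Its square is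
  zero since contraction by [e] squares to zero, so that in the exponential
  series which a Pfaffian amounts to only the first order term survives. *)
Lemma pf_rank2 T (R : comNzRingType) (A B : T -> T -> R) (e g : T -> R) s :
    (forall x y, B x y = A x y - 2 * (e x * g y - e y * g x)) ->
  pf B s = pf A s + 2 * contr g (contr e (pf A)) s.
Proof.
move=> hB; have [N] := ubnP (size s); elim: N s => [//|N IH] [|x s] hN.
  by rewrite /= mulr0 addr0.
pose P := pf A; pose G := contr g (contr e P).
have E1 : pf B (x :: s) =
    contr (fun y => A x y - 2 * e x * g y + 2 * g x * e y) (fun t => P t + 2 * G t) s.
  rewrite pf_cons; apply: eq_contr => [y|t ht]; first by rewrite hB; ring.
  by rewrite IH //; move: hN => /=; lia.
rewrite E1 pf_cons (eq_contr (w' := fun y => (A x y + - (2 * e x) * g y) + 2 * g x * e y)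
  (f' := fun t => P t + 2 * G t)) //; last by move=> y; ring.
rewrite !contrDl !contrD !contrZ.
have -> : contr g G s = 0 by rewrite contr_sqr.
have -> : contr e G s = 0.
  rewrite /G contr_antisym; rewrite (eq_contr (w' := g) (f' := fun=> 0)) // ?contr0 ?oppr0 //.
  by move=> t _; rewrite contr_sqr.
have -> : contr (A x) G s = contr g (contr e (fun t => contr (A x) P t)) s.
  rewrite /G contr_antisym -mulN1r -contrZ; apply: eq_contr => // t _.
  by rewrite mulN1r contr_antisym opprK.
have -> : contr g (contr e (pf A)) (x :: s) = g x * contr e P s
    - (e x * contr g P s - contr g (contr e (contr (A x) P)) s).
  rewrite /= -/P -(contr_lin g (e x)); congr (_ - _); apply: eq_contr => // t _.
  by congr (_ - _); apply: eq_contr => // r _; exact: pf_cons.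
rewrite -/P; ring.
Qed.

(** * Expansion of the Pfaffian along its first row *)

(** The closed form, which matches the expansion of the sum over perfect
  matchings. *)
Lemma contr_sum (T : Type) (R : comNzRingType) (w : T -> R) f s x0 :
  contr w f s =
  \sum_(j < size s) (-1) ^+ j * w (nth x0 s j) * f (take j s ++ drop j.+1 s).
Proof.
elim: s f => /= [|x s IH] f; first by rewrite big_ord0.
rewrite big_ord_recl /= drop0 expr0 mul1r IH -sumrN; congr (_ + _).
by apply: eq_bigr => j _; rewrite /= exprS; ring.
Qed.

Lemma lift_perm_ex n (s : 'S_n.+1) i : exists t, s = lift_perm i (s i) t.
Proof.
pose f k := odflt k (unlift (s i) (s (lift i k))).
have fE k : lift (s i) (f k) = s (lift i k).
  rewrite /f; have := neq_lift i k.
  by rewrite -(can_eq (permK s)) => /unlift_some[] ? ? ->.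
have f_inj : injective f.
  by move=> k l /(congr1 (lift (s i))); rewrite !fE => /perm_inj/lift_inj.
exists (perm f_inj); apply/permP => k.
case: (unliftP i k) => [k'|] ->; last by rewrite lift_perm_id.
by rewrite lift_perm_lift permE fE.
Qed.

Lemma ltn_lift n (h : 'I_n.+1) (i j : 'I_n) : (lift h i < lift h j)%N = (i < j)%N.
Proof. by rewrite !ltnNge leq_bump2. Qed.

Section PfaffianExpansion.
Variable R : comUnitRingType.

(** A perfect matching in normal form matches the point 0 with some j + 1;
  the rest is a matching of the remaining points, moved by two lifts, and the
  sign of a lifted permutation is (-1)^j times the sign of the rest. *)
Lemma pfaffian_row m (a : 'I_m.+1.*2 -> 'I_m.+1.*2 -> R) :
  pfaffian a = \sum_(j < m.*2.+1) (-1) ^+ j * a ord0 (lift ord0 j)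
    * @pfaffian R m (fun i k => a (lift ord0 (lift j i)) (lift ord0 (lift j k))).
Proof.
(* the matching that joins 0 to p.1 + 1 and is p.2 on the other points *)
pose h (p : 'I_m.*2.+1 * 'S_m.*2) : 'S_m.+1.*2 :=
  lift_perm ord0 ord0 (lift_perm ord0 p.1 p.2).
have h0 p : h p ord0 = ord0 by rewrite /h lift_perm_id.
have h1 p : h p (lift ord0 ord0) = lift ord0 p.1.
  by rewrite /h lift_perm_lift lift_perm_id.
have h2 p k : h p (lift ord0 (lift ord0 k)) = lift ord0 (lift p.1 (p.2 k)).
  by rewrite /h !lift_perm_lift.
have h_inj : injective h.
  move=> [j t] [j' t'] e.
  have ej : j = j' by have := h1 (j, t); rewrite e h1 => /lift_inj.
  move: e; rewrite -{}ej => e; congr (_, _); apply/permP => k.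
  by have := h2 (j, t) k; rewrite e h2 => /lift_inj/lift_inj.
have h_ex (s : 'S_m.+1.*2) : s ord0 = ord0 -> exists p, h p == s.
  move=> s0; have [t et] := lift_perm_ex s ord0; have [t' et'] := lift_perm_ex t ord0.
  by exists (t ord0, t'); rewrite /h /= -et' -{2}s0 -et.
rewrite /pfaffian; set C := (X in \sum_(s | X s) _); set F := (X in \sum_(s | _) X s).
rewrite (eq_bigl (fun s : 'S_m.+1.*2 => (s ord0 == ord0 :> 'I_m.+1.*2) && C s)); last first.
  (* the normal form forces s 0 = 0: otherwise the pair that contains 0 would
     have to come first *)
  move=> s; rewrite andb_idl // => /andP[/forallP c1 /forallP c2].
  rewrite -val_eqE /= -leqn0 leqNgt; apply/negP => s0.
  pose k := (s^-1 ord0)%g; have sk : s k = ord0 by rewrite permKV.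
  have hk : (k < m.*2.+2)%N := ltn_ord k.
  have k2 : ((k)./2 < m.+1)%N by have := odd_double_half k; move: hk; lia.
  pose i := Ordinal k2.
  have := c1 i; have /forallP/(_ i) := c2 ord0.
  have -> : Ordinal (double_ltn ord0) = ord0 :> 'I_m.+1.*2 by apply: val_inj.
  have dk := odd_double_half k.
  case ok: (odd k).
    have -> : Ordinal (doubleS_ltn i) = k.
      by apply: val_inj; rewrite /= -[RHS]dk ok.
    by rewrite sk ltn0.
  have -> : Ordinal (double_ltn i) = k.
    by apply: val_inj; rewrite /= -[RHS]dk ok.
  rewrite sk ltn0 implybF; case: posnP => // i0.
  have e : k = ord0 by apply: val_inj; rewrite /= -[LHS]dk ok [_./2]i0.
  by rewrite -e sk in s0.
rewrite (reindex h); last first.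
  exists (fun s => odflt (ord0, 1%g) [pick p | h p == s]).
    move=> p _; case: pickP => [q /eqP/h_inj //|/(_ p)]; by rewrite eqxx.
  move=> s /andP[/eqP s0 _]; case: pickP => [q /eqP //|nq].
  by case: (h_ex s s0) => p; rewrite nq.
under [RHS]eq_bigr do rewrite big_distrr /=.
rewrite pair_big_dep /=; apply: eq_big => [[j t]|[j t] _] /=.
  rewrite h0 eqxx /= /C.
  have e0 : Ordinal (double_ltn ord0) = ord0 :> 'I_m.+1.*2 by apply: val_inj.
  have e1 : Ordinal (doubleS_ltn ord0) = lift ord0 ord0 :> 'I_m.+1.*2 by apply: val_inj.
  have e2 (i : 'I_m) : Ordinal (double_ltn (lift ord0 i)) =
      lift ord0 (lift ord0 (Ordinal (double_ltn i))) :> 'I_m.+1.*2 by apply: val_inj.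
  have e3 (i : 'I_m) : Ordinal (doubleS_ltn (lift ord0 i)) =
      lift ord0 (lift ord0 (Ordinal (doubleS_ltn i))) :> 'I_m.+1.*2 by apply: val_inj.
  congr (_ && _).
    apply/forallP/forallP => /= c i; first by have := c (lift ord0 i); rewrite e2 e3 !h2 !ltn_lift.
    case: (unliftP ord0 i) => [i'|] ->; last by rewrite e0 e1 h0 h1.
    by rewrite e2 e3 !h2 !ltn_lift.
  apply/forallP/forallP => /= c i; apply/forallP => i'.
    have /forallP/(_ (lift ord0 i')) := c (lift ord0 i).
    by rewrite ltn_lift !e2 !h2 !ltn_lift.
  case: (unliftP ord0 i) => [k|] ->; last first.
    by case: (unliftP ord0 i') => [k'|] -> //; rewrite e0 e2 h0 h2.
  case: (unliftP ord0 i') => [k'|] ->; last by rewrite ltn0.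
  by have /forallP/(_ k') := c k; rewrite ltn_lift !e2 !h2 !ltn_lift.
rewrite /F big_ord_recl /h !odd_lift_perm /= signr_addb signr_odd.
rewrite -/(h (j, t)).
have -> : Ordinal (double_ltn ord0) = ord0 :> 'I_m.+1.*2 by apply: val_inj.
have -> : Ordinal (doubleS_ltn ord0) = lift ord0 ord0 :> 'I_m.+1.*2 by apply: val_inj.
rewrite h0 h1 /= -!mulrA; congr (_ * _); rewrite mulrCA; congr (_ * (_ * _)).
apply: eq_bigr => i _.
have -> : Ordinal (double_ltn (lift ord0 i)) =
    lift ord0 (lift ord0 (Ordinal (double_ltn i))) :> 'I_m.+1.*2 by apply: val_inj.
have -> : Ordinal (doubleS_ltn (lift ord0 i)) =
    lift ord0 (lift ord0 (Ordinal (doubleS_ltn i))) :> 'I_m.+1.*2 by apply: val_inj.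
by rewrite !h2.
Qed.

Lemma eq_pfaffian m (a b : 'I_m.*2 -> 'I_m.*2 -> R) :
  (forall i j, a i j = b i j) -> pfaffian a = pfaffian b.
Proof.
move=> e; apply: eq_bigr => s _; congr (_ * _); exact: eq_bigr.
Qed.

Lemma pfaffian0 (a : 'I_0.*2 -> 'I_0.*2 -> R) : pfaffian a = 1.
Proof.
rewrite /pfaffian (big_pred1 1%g) ?odd_perm1 ?big_ord0 ?mul1r //.
move=> s; have -> : s = 1%g by apply/permP => -[].
rewrite /= eqxx; apply/andP; split; apply/forallP; by case.
Qed.

Lemma pfaffianE T (A : T -> T -> R) m x0 s : size s = m.*2 ->
  @pfaffian R m (fun i j => A (nth x0 s i) (nth x0 s j)) = pf A s.
Proof.
elim: m s => [|m IH] [|x s] //= => [_|[sz]]; first exact: pfaffian0.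
rewrite pfaffian_row pf_cons (contr_sum _ _ _ x0) sz /=.
apply: eq_bigr => j _; congr (_ * _).
have szt : size (take j s ++ drop j.+1 s) = m.*2.
  by have := ltn_ord j; rewrite size_cat size_take size_drop sz; case: ifP; lia.
rewrite -(IH _ szt); apply: eq_pfaffian => i k.
have E (l : 'I_m.*2) : nth x0 (x :: s) (lift ord0 (lift j l)) =
    nth x0 (take j s ++ drop j.+1 s) l.
  rewrite nth_cat size_take sz ltn_ord lift0 /= /bump.
  case: (leqP j l) => h; last by rewrite nth_take.
  by rewrite nth_drop; congr nth; lia.
by rewrite -!E.
Qed.

End PfaffianExpansion.

(** * A sign change in Q-tilde polynomials *)

Section Elsym.
Variable R : comUnitRingType.
Implicit Types (v r : seq R) (x : R) (l : seq nat).

(** The generating function makes the recursion on the list of variables a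
  one-line computation. *)
Lemma elsymE v (k : nat) : elsym v k = (\prod_(x <- v) (1 + x *: 'X))`_k.
Proof.
rewrite /elsym /mesym raddf_sum /= (big_nth 0) big_mkord.
have -> : \prod_(i < size v) (1 + v`_i *: 'X) = \prod_(i < size v) (v`_i *: 'X + 1).
  by apply: eq_bigr => i _; rewrite addrC.
rewrite bigA_distr coef_sum big_mkcond /=.
apply: eq_bigr => J _; rewrite -big_mkcond /= scaler_prod prodr_const coefZ coefXn.
rewrite eq_sym; case: eqP => _; last by rewrite mulr0.
by rewrite mulr1 rmorph_prod; apply: eq_bigr => i _; rewrite /= mevalXU.
Qed.

Lemma elsym_perm v w i : perm_eq v w -> elsym v i = elsym w i.
Proof. by case: i => // k e; rewrite !elsymE (perm_big _ e). Qed.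

Lemma elsym_cons x r i : elsym (x :: r) i = elsym r i + x * elsym r (i - 1).
Proof.
case: i => [k|k]; last by rewrite /= mulr0 addr0.
rewrite !elsymE big_cons mulrDl mul1r coefD; congr (_ + _).
rewrite -scalerAl coefZ coefXM; case: k => [|k]; first by rewrite /= !mulr0.
by rewrite -elsymE (_ : k.+1%:Z - 1 = k) //; lia.
Qed.

Local Arguments elsym : simpl never.

Lemma elsym0 v : elsym v 0 = 1.
Proof.
by elim: v => [|x v IH]; rewrite ?elsym_cons ?IH ?mulr0 ?addr0 // elsymE big_nil coef1.
Qed.

Lemma elsym_large v (k : nat) : (size v < k)%N -> elsym v k = 0.
Proof. by move=> h; rewrite /elsym mesym_geqnE // raddf0. Qed.

Lemma Qtilde2_row0 v i : Qtilde2 v i 0 = elsym v i.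
Proof. by rewrite /Qtilde2 big_geq // mulr0 addr0 elsym0 mulr1. Qed.

(** Expand every factor by [elsym_cons]: the change of sign of [x] keeps the
  terms of even degree in [x] and negates the others, and the resulting
  alternating sum telescopes. *)
Lemma Qtilde2_flip x r i j :
  Qtilde2 (- x :: r) i j = Qtilde2 (x :: r) i j -
    2 * (elsym (x :: r) i * elsym r j - elsym (x :: r) j * elsym r i).
Proof.
(* the two products in the coefficient of x; U (p + 1) = T p makes the sum
   telescope *)
pose T (p : nat) : R := elsym r (i%:Z + p%:Z) * elsym r (j%:Z - p%:Z - 1).
pose U (p : nat) : R := elsym r (i%:Z + p%:Z - 1) * elsym r (j%:Z - p%:Z).
have ediff a b : elsym (- x :: r) a * elsym (- x :: r) b
    - elsym (x :: r) a * elsym (x :: r) b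
    = - (2 * x) * (elsym r a * elsym r (b - 1) + elsym r (a - 1) * elsym r b).
  by rewrite !elsym_cons; ring.
have T0 : T 0%N = elsym r i * elsym r (j%:Z - 1).
  by congr (elsym r _ * elsym r _); lia.
have U0 : U 0%N = elsym r (i%:Z - 1) * elsym r j.
  by congr (elsym r _ * elsym r _); lia.
have E : Qtilde2 (- x :: r) i j - Qtilde2 (x :: r) i j = - (2 * x) *
    (T 0%N + U 0%N + 2 * \sum_(1 <= p < j.+1) (-1) ^+ p * (T p + U p)).
  rewrite /Qtilde2 opprD addrACA ediff -mulrBr -sumrB.
  rewrite T0 U0 [in RHS]mulrDr; congr (_ + _).
  rewrite mulrCA; congr (2 * _); rewrite big_distrr /= !big_nat; apply: eq_bigr => p hp.
  rewrite -!mulrA -mulrBr ediff mulrCA PoszD -subzn; last by lia.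
  by [].
have tele : \sum_(1 <= p < j.+1) (-1) ^+ p * (T p + U p) = - T 0%N.
  rewrite (eq_big_nat _ _ (F2 := fun p => (-1) ^+ p * T p - (-1) ^+ p.-1 * T p.-1)).
    rewrite (big_addn 0 _ 1) subSS subn0.
    have -> : \sum_(0 <= p < j) ((-1) ^+ (p + 1) * T (p + 1)%N
        - (-1) ^+ (p + 1).-1 * T (p + 1).-1) =
      \sum_(0 <= p < j) ((-1) ^+ p.+1 * T p.+1 - (-1) ^+ p * T p).
      by apply: eq_bigr => p _; rewrite addn1.
    rewrite (telescope_sumr (fun p => (-1) ^+ p * T p)) // expr0 mul1r.
    rewrite (_ : T j = 0) ?mulr0 ?sub0r // /T (_ : _ - 1 = -1) ?mulr0 //; lia.
  move=> [|p] // _; have -> : U p.+1 = T p.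
    by congr (elsym r _ * elsym r _); lia.
  by rewrite [p.+1.-1]/= exprS; ring.
rewrite -[LHS](subrK (Qtilde2 (x :: r) i j)) E tele addrC; congr (_ + _).
rewrite T0 U0 !elsym_cons; ring.
Qed.

(** For odd length the zero part that completes the array has the column
  e_i, by [Qtilde2_row0]; for even length the contraction vanishes by parity.
  Adding the two cases spares any later distinction of parity. *)
Lemma QtildeE v l : Qtilde v l =
  pf (Qtilde2 v) l + contr (fun k : nat => elsym v k) (pf (Qtilde2 v)) l.
Proof.
rewrite /Qtilde; case ol: (odd (size l)).
  have sz : size (rcons l 0%N) = (uphalf (size l)).*2.
    by rewrite size_rcons -[in LHS](odd_double_half (size l)) uphalf_half ol; lia.
  rewrite pf_odd // add0r -(@pf_rcons _ _ _ _ 0%N) //; last exact: Qtilde2_row0.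
  rewrite -(pfaffianE _ 0%N sz); apply: eq_pfaffian => i j.
  by congr Qtilde2; rewrite nth_rcons; case: ltnP => // h; rewrite nth_default // if_same.
have sz : size l = (uphalf (size l)).*2.
  by rewrite -[in LHS](odd_double_half (size l)) uphalf_half ol; lia.
rewrite (@contr_parity _ _ _ _ true) ?ol // ?addr0; first exact: pfaffianE.
by move=> t; apply: pf_odd.
Qed.

(** Both ingredients of [QtildeE] change in a controlled way: the array by a
  rank two term ([Qtilde2_flip], [pf_rank2]), and the row e_i(x, r) to
  2 e_i(r) - e_i(x, r). *)
Lemma Qtilde_flip x r l :
  Qtilde (- x :: r) l = (-1) ^+ size l * Qtilde (x :: r) l
    + 2 * contr (fun k : nat => elsym r k) (Qtilde (x :: r)) l.
Proof.
pose e k : R := elsym (x :: r) (Posz k); pose g k : R := elsym r (Posz k).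
pose P := pf (Qtilde2 (x :: r)); pose G := contr g (contr e P).
have E2 t : pf (Qtilde2 (- x :: r)) t = P t + 2 * G t.
  exact/pf_rank2/Qtilde2_flip.
have eG : contr e G l = 0.
  rewrite contr_antisym (eq_contr (w' := g) (f' := fun=> 0)) ?contr0 ?oppr0 //.
  by move=> t _; rewrite contr_sqr.
have Qsum t : Qtilde (x :: r) t = P t + contr e P t by exact: QtildeE.
have H1 : contr (fun k : nat => elsym (- x :: r) k) (pf (Qtilde2 (- x :: r))) l
    = contr (fun k => (-1) * e k + 2 * g k) (fun t => P t + 2 * G t) l.
  by apply: eq_contr => [k|t _]; rewrite ?E2 // /e /g !elsym_cons; ring.
have H2 : contr (fun k : nat => elsym r k) (Qtilde (x :: r)) l
    = contr g P l + G l.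
  by rewrite /G -contrD; apply: eq_contr.
rewrite QtildeE E2 H1 H2 contrDl !contrD !contrZ !contrZl eG.
rewrite (_ : contr g G l = 0) ?contr_sqr //.
rewrite Qsum -signr_odd; case ol: (odd (size l)); rewrite ?expr0 ?expr1.
  by rewrite (_ : P l = 0) /P ?pf_odd // /G; ring.
rewrite (@contr_parity _ _ e P true) ?ol // => [|t]; first by rewrite /G; ring.
exact: pf_odd.
Qed.

Lemma Qtilde_perm v w l : perm_eq v w -> Qtilde v l = Qtilde w l.
Proof.
move=> e; apply: eq_pfaffian => i j; rewrite /Qtilde2 !(elsym_perm _ e).
by congr (_ + 2 * _); apply: eq_bigr => p _; rewrite !(elsym_perm _ e).
Qed.

End Elsym.

Section Morphism.
Variables (R R' : comUnitRingType) (phi : {rmorphism R -> R'}).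

Lemma elsym_map v i : phi (elsym v i) = elsym (map phi v) i.
Proof.
case: i => [k|k]; last by rewrite /= rmorph0.
rewrite !elsymE big_map -coef_map rmorph_prod; congr ((_ : {poly R'})`_k).
by apply: eq_bigr => x _; rewrite rmorphD /= map_polyZ map_polyX rmorph1.
Qed.

Lemma Qtilde_map v l : phi (Qtilde v l) = Qtilde (map phi v) l.
Proof.
rewrite /Qtilde /pfaffian rmorph_sum; apply: eq_bigr => s _.
rewrite rmorphM rmorph_sign rmorph_prod; congr (_ * _); apply: eq_bigr => i _.
rewrite /Qtilde2 rmorphD !rmorphM !elsym_map rmorph_nat rmorph_sum; congr (_ + _ * _).
by apply: eq_bigr => p _; rewrite !rmorphM !elsym_map /= rmorphXn rmorphN1.
Qed.

Lemma Ptilde_map v l : (2 : R) \is a GRing.unit ->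
  phi (Ptilde v l) = Ptilde (map phi v) l.
Proof.
move=> u2; rewrite /Ptilde rmorphM Qtilde_map rmorphV ?unitrX // rmorphXn.
by rewrite rmorph_nat.
Qed.
End Morphism.

(** * Calculus of divided differences *)

Section TwistedDerivation.
Variable R : idomainType.

Section One.
Variables (s : {rmorphism R -> R}) (al : R) (D : R -> R).
Hypotheses (sK : involutive s) (al0 : al != 0) (s_al : s al = - al).
Hypothesis DP : forall f, al * D f = f - s f.

Lemma dd_unique f q : al * q = f - s f -> D f = q.
Proof. by rewrite -DP => /(mulfI al0). Qed.

Lemma ddD f h : D (f + h) = D f + D h.
Proof. by apply: dd_unique; rewrite mulrDr !DP rmorphD; ring. Qed.

Lemma ddM f h : D (f * h) = D f * h + s f * D h.
Proof.
by apply: dd_unique; rewrite mulrDr mulrA DP mulrCA DP rmorphM; ring.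
Qed.

Lemma dd_fixed f : s (D f) = D f.
Proof.
apply: (mulfI al0); rewrite DP -[al]opprK -s_al mulNr -rmorphM DP rmorphB sK.
ring.
Qed.

End One.

Variables (s t : {rmorphism R -> R}) (al be : R) (D E : R -> R).
Hypotheses (sK : involutive s) (al0 : al != 0) (s_al : s al = - al).
Hypothesis DP : forall f, al * D f = f - s f.
Hypotheses (tK : involutive t) (be0 : be != 0) (t_be : t be = - be).
Hypothesis EP : forall f, be * E f = f - t f.

Lemma dd_commute f : s be = be -> t al = al -> s (t f) = t (s f) ->
  D (E f) = E (D f).
Proof.
move=> sb ta st; apply: (mulfI al0); apply: (mulfI be0).
have e1 : be * s (E f) = s f - s (t f) by rewrite -{1}sb -rmorphM EP rmorphB.
have e2 : al * t (D f) = t f - t (s f) by rewrite -{1}ta -rmorphM DP rmorphB.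
by rewrite DP mulrBr EP e1 mulrCA EP mulrBr DP e2 st; ring.
Qed.

(** Multiplied by the three positive roots of the rank two system, the
  threefold divided difference is the alternating sum over the dihedral group
  of order six, which is symmetric in the two reflections: this is the source
  of the braid relation [dd_braid]. *)
Lemma dd_braid_expand f : s be = al + be -> t al = al + be ->
  al * (be * ((al + be) * D (E (D f)))) =
    f - s f - t f + t (s f) + s (t f) - s (t (s f)).
Proof.
move=> sb ta; set f1 := D f; set f2 := E f1.
have E1 : al * f1 = f - s f by exact: DP.
have E2 : be * f2 = f1 - t f1 by exact: EP.
have s1 : s f1 = f1 by exact: (dd_fixed sK al0 s_al DP).
have E4 : (al + be) * s f2 = f1 - s (t f1) by rewrite -sb -rmorphM E2 rmorphB s1.
have E5 : (al + be) * t f1 = t f - t (s f) by rewrite -ta -rmorphM E1 rmorphB.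
have E6 : be * s (t f1) = s (t f) - s (t (s f)).
  by rewrite -rmorphB -E5 rmorphM rmorphD s_al sb addKr.
transitivity ((al + be) * (be * f2) - be * ((al + be) * s f2)).
  transitivity (be * (al + be) * (al * D f2)); first by ring.
  by rewrite DP; ring.
rewrite E2 E4 !mulrBr E5 E6 (_ : (al + be) * f1 = f - s f + be * f1); first by ring.
by rewrite -E1; ring.
Qed.

End TwistedDerivation.

Lemma dd_braid (R : idomainType) (s t : {rmorphism R -> R}) (al be : R) (D E : R -> R) f :
    involutive s -> al != 0 -> s al = - al -> (forall f, al * D f = f - s f) ->
    involutive t -> be != 0 -> t be = - be -> (forall f, be * E f = f - t f) ->
    s be = al + be -> t al = al + be -> s (t (s f)) = t (s (t f)) ->
  D (E (D f)) = E (D (E f)).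
Proof.
move=> sK al0 s_al DP tK be0 t_be EP sb ta sts.
have ab0 : al + be != 0.
  by rewrite -sb; apply: contra_neq be0 => e; rewrite -[be]sK e rmorph0.
have K1 := dd_braid_expand sK al0 s_al DP EP f sb ta.
have K2 := dd_braid_expand tK be0 t_be EP DP f (etrans ta (addrC _ _)) (etrans sb (addrC _ _)).
apply: (mulfI al0); apply: (mulfI be0); apply: (mulfI ab0).
transitivity (al * (be * ((al + be) * D (E (D f))))); first by ring.
transitivity (be * (al * ((al + be) * E (D (E f))))); last by ring.
by rewrite K1 [al + be]addrC K2 sts; ring.
Qed.

Section Action.
Variables (S : idomainType) (n : nat).
Implicit Types (f h : {mpoly S[n]}) (u v w : {perm symb n}) (g : gen n).

HB.instance Definition _ w :=
  GRing.RMorphism.copy (@wact S n w)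
    (comp_mpoly [tuple (-1) ^+ (w (i, false)).2 *: 'X_((w (i, false)).1) | i < n]).

Lemma wactX w i : wact w 'X_i = (-1) ^+ (w (i, false)).2 *: 'X_((w (i, false)).1) :> {mpoly S[n]}.
Proof. by rewrite /wact comp_mpolyXU -tnth_nth tnth_mktuple. Qed.

Lemma wactC w c : wact w c%:MP = c%:MP :> {mpoly S[n]}.
Proof. exact: comp_mpolyC. Qed.

Lemma wactZ w (c : S) f : wact w (c *: f) = c *: wact w f.
Proof. exact: comp_mpolyZ. Qed.

Lemma wact_ext (phi psi : {rmorphism {mpoly S[n]} -> {mpoly S[n]}}) :
    (forall c, phi c%:MP = psi c%:MP) -> (forall i, phi 'X_i = psi 'X_i) ->
  phi =1 psi.
Proof.
move=> eC eX; elim/mpolyind => [|c m f _ _ IH]; first by rewrite !rmorph0.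
rewrite !rmorphD IH -mul_mpolyC !rmorphM eC mpolyXE_id !rmorph_prod; congr (_ * _ + _).
by apply: eq_bigr => i _; rewrite !rmorphXn; congr (_ ^+ _).
Qed.

Lemma wact1g f : wact 1%g f = f.
Proof.
apply: (@wact_ext (wact 1%g) idfun) => [c|i]; first exact: wactC.
by rewrite /= wactX perm1 expr0 scale1r.
Qed.

Lemma wact_comp u v f : (forall p, u (bar p) = bar (u p)) ->
  wact u (wact v f) = wact (v * u)%g f.
Proof.
move=> ub; apply: (@wact_ext (wact u \o wact v) (wact (v * u)%g)) => [c|i] /=.
  by rewrite !wactC.
rewrite !wactX permM; case: (v (i, false)) => j b /=.
rewrite wactZ wactX scalerA; have -> : u (j, b) = if b then bar (u (j, false)) else u (j, false).
  by case: b; rewrite // -ub.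
case: b => /=; rewrite ?expr0 ?mul1r // expr1; congr (_ *: _).
by case: (u _).2 => /=; rewrite ?expr0 ?expr1 ?mulr1 ?mulrNN ?mul1r.
Qed.

Lemma prodw_bar a p : prodw a (bar p) = bar (@prodw n a p).
Proof.
by elim: a p => [|g a IH] p /=; rewrite ?perm1 // !permM IH simple_bar.
Qed.

Lemma wact_sK g f : wact (srefl g) (wact (srefl g) f) = f.
Proof. by rewrite wact_comp ?simpleK ?wact1g //; exact: simple_bar. Qed.

(** With the sign built into the operators [ddiff'], the roots are
  x_(i+1) - x_i and x_1 + x_2.  These are simple roots of one and the same
  positive system, so the braid relations hold without signs. *)
Definition root' g : {mpoly S[n]} := 'X_(ghi g) - wact (srefl g) 'X_(ghi g).

Lemma root'E g : root' g = 'X_(ghi g) - (-1) ^+ geps g *: 'X_(glo g).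
Proof. by rewrite /root' wactX simple_hi. Qed.

Lemma ddiff'P g f : root' g * ddiff' g f = f - wact (srefl g) f.
Proof.
rewrite -ddiffP root'E /ddiff'; case: g => [i h|h] /=.
  by rewrite expr0 scale1r mulrN -mulNr opprB.
by rewrite expr1 scaleN1r opprK [_ + 'X_(lo h)]addrC.
Qed.

Lemma root'_neq0 g : root' g != 0.
Proof.
rewrite root'E; have := sroot_neq0 S g; case: g => [i h|h] /=.
  by rewrite expr0 scale1r -oppr_eq0 opprB.
by rewrite expr1 scaleN1r opprK addrC.
Qed.

Lemma ddiff'_unique g f q : root' g * q = f - wact (srefl g) f -> ddiff' g f = q.
Proof. by rewrite -ddiff'P => /(mulfI (root'_neq0 g)). Qed.

Lemma wact_root' g : wact (srefl g) (root' g) = - root' g.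
Proof. by rewrite /root' rmorphB /= wact_sK opprB. Qed.

Lemma ddiff'D g f h : ddiff' g (f + h) = ddiff' g f + ddiff' g h.
Proof. exact: (ddD (root'_neq0 g) (ddiff'P g)). Qed.

Lemma ddiff'M g f h :
  ddiff' g (f * h) = ddiff' g f * h + wact (srefl g) f * ddiff' g h.
Proof. exact: (ddM (root'_neq0 g) (ddiff'P g)). Qed.

Lemma ddiff'_inv g f : wact (srefl g) f = f -> ddiff' g f = 0.
Proof. by move=> e; apply: ddiff'_unique; rewrite e mulr0 subrr. Qed.

Lemma ddiff'Z g c f : wact (srefl g) c = c -> ddiff' g (c * f) = c * ddiff' g f.
Proof. by move=> e; rewrite ddiff'M ddiff'_inv // e mul0r add0r. Qed.

Lemma ddiff'0 g : ddiff' g (0 : {mpoly S[n]}) = 0.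
Proof. by apply: ddiff'_inv; rewrite rmorph0. Qed.

Lemma wact_ddiff' g f : wact (srefl g) (ddiff' g f) = ddiff' g f.
Proof. exact: (dd_fixed (wact_sK g) (root'_neq0 g) (wact_root' g) (ddiff'P g)). Qed.

Lemma ddiff'_sqr g f : ddiff' g (ddiff' g f) = 0.
Proof. exact/ddiff'_inv/wact_ddiff'. Qed.

Lemma ddiff'_commute (g h : gen n) f :
    wact (srefl g) (root' h) = root' h -> wact (srefl h) (root' g) = root' g ->
    (srefl g * srefl h = srefl h * srefl g)%g ->
  ddiff' g (ddiff' h f) = ddiff' h (ddiff' g f).
Proof.
move=> gh hg comm.
apply: (dd_commute (root'_neq0 g) (ddiff'P g) (root'_neq0 h) (ddiff'P h) gh hg).
by rewrite /= !wact_comp ?comm //; exact: simple_bar.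
Qed.

Lemma ddiff'_braid (g h : gen n) f :
    wact (srefl g) (root' h) = root' g + root' h ->
    wact (srefl h) (root' g) = root' g + root' h ->
    (srefl g * srefl h * srefl g = srefl h * srefl g * srefl h)%g ->
  ddiff' g (ddiff' h (ddiff' g f)) = ddiff' h (ddiff' g (ddiff' h f)).
Proof.
move=> gh hg braid.
apply: (dd_braid (wact_sK g) (root'_neq0 g) (wact_root' g) (ddiff'P g)
  (wact_sK h) (root'_neq0 h) (wact_root' h) (ddiff'P h) gh hg).
by rewrite /= !wact_comp ?mulgA ?braid // => p; rewrite ?permM !simple_bar.
Qed.

Lemma ddiffw_cat a b f : ddiffw (a ++ b) f = ddiffw a (ddiffw b f).
Proof. by rewrite /ddiffw foldr_cat. Qed.

Lemma ddiffwD a f h : ddiffw a (f + h) = ddiffw a f + ddiffw a h.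
Proof. by elim: a => //= g a ->; rewrite ddiff'D. Qed.

Lemma ddiffw0 a : ddiffw a (0 : {mpoly S[n]}) = 0.
Proof. by elim: a => //= g a ->; rewrite ddiff'0. Qed.

Lemma ddiffw_sum I (r : seq I) P a (F : I -> {mpoly S[n]}) :
  ddiffw a (\sum_(i <- r | P i) F i) = \sum_(i <- r | P i) ddiffw a (F i).
Proof. by apply: (big_morph _ (ddiffwD a)); rewrite ddiffw0. Qed.

Lemma ddiffwZ a c f : (forall w, wact w c = c) -> ddiffw a (c * f) = c * ddiffw a f.
Proof. by move=> ec; elim: a => //= g a ->; rewrite ddiff'Z. Qed.

Lemma ddiffwN a f : ddiffw a (- f) = - ddiffw a f.
Proof.
by rewrite -mulN1r ddiffwZ ?mulN1r // => w; rewrite rmorphN rmorph1.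
Qed.

End Action.

(** * Inversions and length *)

Section Length.
Import Order.TTheory Num.Theory.
Variable n : nat.
Implicit Types (g h : gen n) (w : {perm symb n}) (p q : symb n).

(** The two values compared are those which [srefl g] exchanges, so that the
  condition says that multiplying [w] by this reflection shortens it. *)
Definition descent w g := symb_val (w (ghi g, false)) < symb_val (w (glo g, geps g)).

(** Inversions of the action on all symbols.  The pairs of a symbol and its
  bar do not correspond to roots of type D and are left out; the other pairs
  come with their negatives, so their number is twice the length. *)
Definition inversions w : {set symb n * symb n} :=
  [set x | [&& symb_val x.1 < symb_val x.2, x.1 != bar x.2
             & symb_val (w x.2) < symb_val (w x.1)]].
Definition inv2 w := #|inversions w|.

Lemma symb_valE (i : 'I_n) b : symb_val (i, b) = if b then - i.+1%:Z else i.+1%:Z.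
Proof. by case: b; rewrite /symb_val /= ?expr0 ?expr1 ?mul1r ?mulN1r. Qed.

Lemma geps0 g : geps g -> glo g = 0%N :> nat. Proof. by case: g. Qed.

(** The only pairs, up to the excluded ones, whose order [srefl g] reverses. *)
Definition simple_pairs g : {set symb n * symb n} :=
  [set ((glo g, geps g), (ghi g, false)); ((ghi g, true), (glo g, ~~ geps g))].

Lemma srefl_mono g p q : symb_val p < symb_val q -> p != bar q ->
  (p, q) \notin simple_pairs g -> symb_val (srefl g p) < symb_val (srefl g q).
Proof.
case: p q => [i x] [j y].
rewrite !inE /bar /= !xpair_eqE -!val_eqE /= !symb_valE.
have h1 := ghi_val g; have h0 := @geps0 g.
move: (ltn_ord i) (ltn_ord j) => hi hj.
case: (eqVneq i (glo g)) => [->|il].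
  rewrite simple_lo; case: (eqVneq j (glo g)) => [->|jl].
    by rewrite simple_lo !symb_valE; case: (geps g) h0 x y => /= h0 [] [] /=; lia.
  case: (eqVneq j (ghi g)) => [->|jh].
    by rewrite simple_hi !symb_valE; case: (geps g) h0 x y => /= h0 [] [] /=; lia.
  rewrite (simple_out _ jl jh) !symb_valE; move: jl jh; rewrite -!val_eqE /=.
  by case: (geps g) h0 x y => /= h0 [] [] /=; lia.
case: (eqVneq i (ghi g)) => [->|ih].
  rewrite simple_hi; case: (eqVneq j (glo g)) => [->|jl].
    by rewrite simple_lo !symb_valE; case: (geps g) h0 x y => /= h0 [] [] /=; lia.
  case: (eqVneq j (ghi g)) => [->|jh].
    by rewrite simple_hi !symb_valE; case: (geps g) h0 x y => /= h0 [] [] /=; lia.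
  rewrite (simple_out _ jl jh) !symb_valE; move: jl jh; rewrite -!val_eqE /=.
  by case: (geps g) h0 x y => /= h0 [] [] /=; lia.
rewrite (simple_out _ il ih) !symb_valE; move: il ih; rewrite -!val_eqE /= => il ih.
case: (eqVneq j (glo g)) => [->|jl].
  by rewrite simple_lo !symb_valE; case: (geps g) h0 x y => /= h0 [] [] /=; lia.
case: (eqVneq j (ghi g)) => [->|jh].
  by rewrite simple_hi !symb_valE; case: (geps g) h0 x y => /= h0 [] [] /=; lia.
by rewrite (simple_out _ jl jh) !symb_valE.
Qed.

Lemma inv2_descent g w : (forall p, w (bar p) = bar (w p)) ->
  descent w g -> inv2 w = (inv2 (srefl g * w) + 2)%N.
Proof.
rewrite /descent => wb dw; pose phi (x : symb n * symb n) := (srefl g x.1, srefl g x.2).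
have sK : involutive (srefl g) by move=> p; rewrite -permM simpleK perm1.
have phiK : involutive phi by move=> [p q]; rewrite /phi /= !sK.
have dw' : symb_val (w (glo g, ~~ geps g)) < symb_val (w (ghi g, true)).
  by rewrite (wb (glo g, geps g)) (wb (ghi g, false)) !symb_val_bar ltrN2.
have SPsub : simple_pairs g \subset inversions w.
  have h1 := ghi_val g; have h0 := @geps0 g.
  apply/subsetP => x; rewrite !inE => /orP[/eqP->|/eqP->]; rewrite /= ?dw ?dw' ?andbT.
    rewrite !symb_valE /bar /= xpair_eqE glo_ghi andbT.
    by case: geps h0 => h0; lia.
  rewrite !symb_valE /bar /= xpair_eqE ghi_glo andbT.
  by case: geps h0 => /= h0; lia.
have nsp x : x \in simple_pairs g -> symb_val (phi x).2 < symb_val (phi x).1.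
  have h1 := ghi_val g; have h0 := @geps0 g.
  rewrite !inE => /orP[/eqP->|/eqP->]; rewrite /= simple_lo simple_hi !symb_valE.
    by rewrite addbb; case: geps h0 => /= h0; lia.
  by case: geps h0 => /= h0; lia.
have nspw x : x \in simple_pairs g -> symb_val (w (phi x).1) < symb_val (w (phi x).2).
  rewrite !inE => /orP[/eqP->|/eqP->]; rewrite /= simple_lo simple_hi ?addbb //.
  by rewrite addTb; case: (geps g) dw'.
have bs a b : (srefl g a != bar (srefl g b)) = (a != bar b).
  by rewrite -simple_bar (inj_eq perm_inj).
(* g itself maps the inversions of w other than [simple_pairs g] to those of
   the product, by [srefl_mono] *)
rewrite /inv2 -(cardsID (simple_pairs g)) (setIidPr SPsub) addnC; congr (_ + _)%N; last first.
  by rewrite cards2 xpair_eqE negb_and xpair_eqE glo_ghi.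
rewrite -(card_preimset _ (inv_inj phiK)); apply: eq_card => -[p q].
rewrite inE [RHS]inE inE [X in _ && X]inE /= !permM bs.
apply/andP/and3P => [[h1 /and3P[h2 h3 h4]]|[h2 h3 h4]].
  by split=> //; rewrite -[p]sK -[q]sK; apply: srefl_mono; rewrite // bs.
have h1 : phi (p, q) \notin simple_pairs g.
  by apply/negP => /nsp; rewrite phiK /= => h5; have := lt_trans h2 h5; rewrite ltxx.
have h5 : (p, q) \notin simple_pairs g.
  by apply/negP => /nspw /= h5; have := lt_trans h4 h5; rewrite ltxx.
by split=> //; rewrite h4 h3 srefl_mono.
Qed.

Lemma inv2_ascent g w : (forall p, w (bar p) = bar (w p)) ->
  ~~ descent w g -> inv2 (srefl g * w) = (inv2 w + 2)%N.
Proof.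
move=> wb nd; rewrite (inv2_descent (g := g) (w := srefl g * w)%g).
- by rewrite mulgA simpleK mul1g.
- by move=> p; rewrite !permM simple_bar wb.
move: nd; rewrite /descent !permM simple_lo simple_hi addbb addFb -leNgt.
rewrite le_eqVlt => /orP[/eqP/symb_val_inj/perm_inj[/eqP]|//].
by rewrite glo_ghi.
Qed.

Lemma inv2_1 : inv2 1 = 0%N.
Proof.
apply/eqP; rewrite cards_eq0; apply/eqP/setP => -[p q].
rewrite !inE !perm1 /=; apply/negP => /and3P[h1 _ h2].
by have := lt_trans h1 h2; rewrite ltxx.
Qed.

Lemma inv2_prodw a : (inv2 (@prodw n a) <= 2 * size a)%N.
Proof.
elim/last_ind: a => [|a g IH]; first by rewrite inv2_1.
rewrite prodw_rcons size_rcons; case d: (descent (prodw a) g).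
  by have := inv2_descent (prodw_bar a) d; lia.
by have := inv2_ascent (prodw_bar a) (negbT d); lia.
Qed.

Lemma weylD_bar w p : w \in weylD n -> w (bar p) = bar (w p).
Proof. by case/weylDP. Qed.

(** As long as some generator is a descent, the number of inversions can be
  lowered by two; without descents the element is the identity, by
  [top_weylD]. *)
Lemma reduced_exists w : w \in weylD n ->
  exists2 a, prodw a = w & inv2 w = (2 * size a)%N.
Proof.
have [N] := ubnP (inv2 w); elim: N w => // N IH w hN wD.
have wb p : w (bar p) = bar (w p) by exact: weylD_bar.
case: (boolP [exists x : 'I_n * bool, [exists y : 'I_n,
  (x.1.+1 == y :> nat) && (x.2 ==> (x.1 == 0%N :> nat)) &&
  (symb_val (w (y, false)) < symb_val (w (x.1, x.2)))]]).
  case/existsP=> -[i b] /existsP[j /= /andP[/andP[/eqP ij ib] d]].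
  have [g [eg1 eg2 eg3]] : exists g : gen n, [/\ glo g = i, ghi g = j & geps g = b].
    have hi : (i.+1 < n)%N by rewrite ij.
    case: b ib {d} => /= ib.
      have i0 : i = 0%N :> nat by apply/eqP.
      have h : (1 < n)%N by rewrite -i0.
      by exists (Box h); split=> //; apply: val_inj; rewrite //= -ij i0.
    by exists (Tr hi); split=> //; apply: val_inj.
  have dg : descent w g by rewrite /descent eg1 eg2 eg3.
  have e := inv2_descent wb dg.
  have [|a ea la] := IH (srefl g * w)%g _ (simple_weylD g wD); first by lia.
  exists (rcons a g); first by rewrite prodw_rcons ea mulgA simpleK mul1g.
  by rewrite size_rcons e la; lia.
move=> nd; have w1 : w = 1%g.
  apply: top_weylD => // g; rewrite moment_simple //.
  have : ~~ descent w g.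
    apply: contra nd => d; apply/existsP; exists (glo g, geps g).
    apply/existsP; exists (ghi g); rewrite /= ghi_val eqxx -/(descent w g) d andbT /=.
    by apply/implyP => /geps0 ->.
  rewrite /descent -leNgt; case: ifP => e; last by lia.
  rewrite (wb (glo g, false)) symb_val_bar; nia.
by exists [::]; rewrite ?w1 // inv2_1.
Qed.

End Length.

(** * Divided differences depend only on the group element *)

Section Matsumoto.
Import Order.TTheory Num.Theory.
Variables (S : idomainType) (n : nat).
Implicit Types (g h : gen n) (w : {perm symb n}) (p q : symb n) (f : {mpoly S[n]}).

Lemma gen_eq g h : glo g = glo h -> geps g = geps h -> g = h.
Proof.
case: g h => [i hi|hi] [j hj|hj] //= /(congr1 val) /= e _.
  by case: _ / e hj => hj; rewrite (bool_irrelevance hi hj).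
by rewrite (bool_irrelevance hi hj).
Qed.

(** The last clause is what the proof of [ddiffw_reduced] needs from a pair
  of descents: the second one remains a descent after the first reflection.
  [braiding] is the analogue for a pair that generates a group of order six. *)
Definition commuting g h := [/\ wact (srefl g) (root' S h) = root' S h,
  wact (srefl h) (root' S g) = root' S g,
  (srefl g * srefl h = srefl h * srefl g)%g &
  forall w, (forall p, w (bar p) = bar (w p)) -> descent w h -> descent (srefl g * w) h].

Definition braiding g h := [/\ wact (srefl g) (root' S h) = root' S g + root' S h,
  wact (srefl h) (root' S g) = root' S g + root' S h,
  (srefl g * srefl h * srefl g = srefl h * srefl g * srefl h)%g &
  forall w, (forall p, w (bar p) = bar (w p)) -> descent w g -> descent w h ->
    descent (srefl g * w) h /\ descent (srefl h * (srefl g * w)) g].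

Lemma bar_lt w (wb : forall p, w (bar p) = bar (w p)) p q :
  (symb_val (w (bar p)) < symb_val (w (bar q))) = (symb_val (w q) < symb_val (w p)).
Proof. by rewrite !wb !symb_val_bar ltrN2. Qed.

Lemma disjoint_commuting g h :
    [&& glo g != glo h, glo g != ghi h, ghi g != glo h & ghi g != ghi h] ->
  commuting g h.
Proof.
case/and4P=> d1 d2 d3 d4; have e1 := d1; have e2 := d2; have e3 := d3; have e4 := d4.
rewrite eq_sym in e1; rewrite eq_sym in e2; rewrite eq_sym in e3; rewrite eq_sym in e4.
have gl b : srefl g (glo h, b) = (glo h, b) by exact: simple_out.
have gh b : srefl g (ghi h, b) = (ghi h, b) by exact: simple_out.
have hl b : srefl h (glo g, b) = (glo g, b) by exact: simple_out.
have hh b : srefl h (ghi g, b) = (ghi g, b) by exact: simple_out.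
split.
- by rewrite !root'E rmorphB /= wactZ !wactX gl gh /= expr0 !scale1r.
- by rewrite !root'E rmorphB /= wactZ !wactX hl hh /= expr0 !scale1r.
- apply/permP => -[i b]; rewrite !permM.
  case: (eqVneq i (glo g)) => [->|il]; first by rewrite simple_lo hh hl simple_lo.
  case: (eqVneq i (ghi g)) => [->|ih]; first by rewrite simple_hi hl hh simple_hi.
  rewrite (simple_out _ il ih).
  case: (eqVneq i (glo h)) => [->|jl]; first by rewrite simple_lo gh.
  case: (eqVneq i (ghi h)) => [->|jh]; first by rewrite simple_hi gl.
  by rewrite !simple_out.
- by move=> w wb; rewrite /descent !permM gl gh.
Qed.

Lemma same_commuting g h : glo g = glo h -> geps g != geps h -> commuting g h.
Proof.
move=> el en; have eh : ghi g = ghi h by apply: val_inj; rewrite /= !ghi_val el.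
have eb : geps h = ~~ geps g by move: en; case: (geps g) (geps h) => [] [].
split.
- rewrite !root'E -el -eh eb rmorphB /= wactZ !wactX simple_hi simple_lo /=.
  by case: (geps g); rewrite /= ?expr0 ?expr1 ?scale1r ?scaleN1r ?opprK addrC.
- rewrite !root'E el eh rmorphB /= wactZ !wactX simple_hi simple_lo eb /=.
  by case: (geps g); rewrite /= ?expr0 ?expr1 ?scale1r ?scaleN1r ?opprK addrC.
- have hl b : srefl h (glo g, b) = (ghi g, b (+) geps h) by rewrite el eh simple_lo.
  have hh b : srefl h (ghi g, b) = (glo g, b (+) geps h) by rewrite el eh simple_hi.
  apply/permP => -[i b]; rewrite !permM.
  case: (eqVneq i (glo g)) => [->|il].
    by rewrite hl simple_lo hh simple_hi addbAC.
  case: (eqVneq i (ghi g)) => [->|ih].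
    by rewrite hh simple_hi hl simple_lo addbAC.
  by rewrite (simple_out _ il ih) !(@simple_out _ h) -?el -?eh // simple_out.
- move=> w wb; rewrite /descent !permM -el -eh simple_lo simple_hi eb addFb addNb addbb.
  by rewrite -(bar_lt wb) /bar /= negbK.
Qed.

(** The generators with the roots x_2 - x_1 and x_1 + x_2 both end at the
  place where s_2 begins, so the two kinds of edges of the diagram are treated at
  once. *)
Lemma adjacent_braiding g h : ghi g = glo h -> braiding g h.
Proof.
move=> e; have eh : geps h = false.
  by apply/negP => /geps0; rewrite -e ghi_val.
have dac : glo g != ghi h by rewrite -val_eqE /= ghi_val -e ghi_val; lia.
have dca : ghi h != glo g by rewrite eq_sym.
have dcb : ghi h != ghi g by rewrite e ghi_glo.
have dab : glo g != glo h by rewrite -e glo_ghi.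
have sgc b : srefl g (ghi h, b) = (ghi h, b) by rewrite simple_out.
have sga b : srefl g (glo g, b) = (ghi g, b (+) geps g) by rewrite simple_lo.
have sgb b : srefl g (ghi g, b) = (glo g, b (+) geps g) by rewrite simple_hi.
have sha b : srefl h (glo g, b) = (glo g, b) by rewrite simple_out.
have shb b : srefl h (ghi g, b) = (ghi h, b) by rewrite e simple_lo eh addbF.
have shc b : srefl h (ghi h, b) = (ghi g, b) by rewrite simple_hi eh addbF e.
split.
- rewrite !root'E rmorphB /= wactZ !wactX eh -e sgc sgb /= expr0 !scale1r.
  by rewrite [RHS]addrC addrA subrK.
- rewrite !root'E rmorphB /= wactZ !wactX eh -e sha shb /= expr0 !scale1r.
  by rewrite [RHS]addrC addrA subrK.
- apply/permP => -[i b]; rewrite !permM.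
  case: (eqVneq i (glo g)) => [->|il]; first by rewrite sha sga shb sgc.
  case: (eqVneq i (ghi g)) => [->|ih]; first by rewrite sgb sha sga shb sgc shc -addbA addbb addbF.
  case: (eqVneq i (ghi h)) => [->|jh]; first by rewrite sgc shc sgb sha.
  have sgo : srefl g (i, b) = (i, b) by exact: simple_out.
  have sho : srefl h (i, b) = (i, b) by apply: simple_out; rewrite -?e.
  by rewrite !(sgo, sho).
- move=> w wb; rewrite /descent !permM eh -e sgc sgb addFb sha shb sgc sga addbb => d1 d2.
  split=> //; exact: lt_trans d2 d1.
Qed.

(** Products of two simple reflections have order 1, 2 or 3 in type D. *)
Lemma gen_pairs g h :
  [\/ g = h, commuting g h, braiding g h | braiding h g].
Proof.
case: (eqVneq (glo g) (glo h)) => [el|nl].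
  case: (eqVneq (geps g) (geps h)) => [/(gen_eq el)|en]; first by constructor 1.
  by constructor 2; apply: same_commuting.
case: (eqVneq (ghi g) (glo h)) => [e|n1].
  by constructor 3; apply: adjacent_braiding.
case: (eqVneq (ghi h) (glo g)) => [e|n2].
  by constructor 4; apply: adjacent_braiding.
constructor 2; apply: disjoint_commuting; rewrite nl n1 [glo g == ghi h]eq_sym n2 /=.
by move: nl; rewrite -!val_eqE /= !ghi_val.
Qed.

Definition reduced (a : seq (gen n)) := inv2 (prodw a) = (2 * size a)%N.

(** Since each letter changes the number of inversions by two, a reduced word
  gains with every letter. *)
Lemma reduced_rcons a g : reduced (rcons a g) -> reduced a /\ descent (prodw (rcons a g)) g.
Proof.
rewrite /reduced size_rcons => ra; have la := inv2_prodw a.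
have d : descent (prodw (rcons a g)) g.
  apply/negPn/negP => /(inv2_ascent (prodw_bar _)).
  by rewrite [in inv2 (_ * _)]prodw_rcons mulgA simpleK mul1g ra; lia.
split=> //; have := inv2_descent (prodw_bar _) d.
by rewrite [in inv2 (_ * _)]prodw_rcons mulgA simpleK mul1g ra; lia.
Qed.

Lemma prodw_weylD a : @prodw n a \in weylD n.
Proof.
elim/last_ind: a => [|a g IH]; last by rewrite prodw_rcons simple_weylD.
by apply/weylDP; split=> [p|]; rewrite ?perm1 // big1 // => i _; rewrite perm1.
Qed.

Lemma ddiffw_rcons a g f : ddiffw (rcons a g) f = ddiffw a (ddiff' g f).
Proof. by rewrite -cats1 ddiffw_cat. Qed.

(** Induction on the length.  The last letters of both words are descents of
  the product, so each word may be replaced by one that ends in the longest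
  word of the dihedral group of the two letters; then the relation between the
  two operators applies. *)
Lemma ddiffw_reduced a b f : reduced a -> reduced b -> prodw a = prodw b ->
  ddiffw a f = ddiffw b f.
Proof.
have [N] := ubnP (size a); elim: N a b f => // N IH a b f hN ra rb eab.
have sab : size a = size b by move: ra rb; rewrite /reduced eab; lia.
case/lastP: a => [|a g] in hN ra eab sab *; first by case: b sab {rb eab}.
case/lastP: b => [|b h] in rb eab sab *; first by rewrite size_rcons in sab.
have [ra' da] := reduced_rcons ra; have [rb' db] := reduced_rcons rb.
rewrite !size_rcons in hN sab; case: sab => sab; rewrite ltnS in hN.
rewrite -eab in db; set w := prodw (rcons a g) in da db eab.
have ea : prodw a = (srefl g * w)%g by rewrite /w prodw_rcons mulgA simpleK mul1g.
have eb : prodw b = (srefl h * w)%g by rewrite eab prodw_rcons mulgA simpleK mul1g.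
have wD : w \in weylD n by exact: prodw_weylD.
have wb p : w (bar p) = bar (w p) by exact: weylD_bar.
have lw : inv2 w = (2 * (size a).+1)%N by rewrite ra size_rcons.
have swb (k : gen n) (u : {perm symb n}) : (forall p, u (bar p) = bar (u p)) ->
    forall p, (srefl k * u)%g (bar p) = bar ((srefl k * u)%g p).
  by move=> ub p; rewrite !permM simple_bar ub.
have sK (k : gen n) (u : {perm symb n}) : (srefl k * (srefl k * u))%g = u by rewrite mulgA simpleK mul1g.
(* k and l generate a group of order six; c is a reduced word of what remains
   after its longest element k l k = l k l has been split off.  Both orders of
   g and h occur in the application. *)
have braid k l a' b' : size a' = size a -> size b' = size a ->
    reduced a' -> reduced b' -> descent w k -> descent w l ->
    prodw a' = (srefl k * w)%g -> prodw b' = (srefl l * w)%g -> braiding k l ->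
    ddiffw a' (ddiff' k f) = ddiffw b' (ddiff' l f).
  move=> sa' sb' rra rrb dk dl pa pb [r1 r2 kl desc].
  have [d1 d2] := desc w wb dk dl.
  have i1 := inv2_descent wb dk.
  have i2 := inv2_descent (swb k w wb) d1.
  have i3 := inv2_descent (swb l _ (swb k w wb)) d2.
  have [c ec rc] := reduced_exists (simple_weylD k (simple_weylD l (simple_weylD k wD))).
  have sc : (size c).+2 = size a by lia.
  have e1 : prodw (rcons (rcons c k) l) = prodw a' by rewrite pa !prodw_rcons ec !sK.
  have e2 : prodw (rcons (rcons c l) k) = prodw b'.
    by rewrite pb !prodw_rcons ec !mulgA -2!mulgA mulgA mulgA kl -!mulgA !sK.
  have red x : prodw x = prodw a' \/ prodw x = prodw b' -> size x = size a -> reduced x.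
    by rewrite /reduced => -[->|->] ->; rewrite ?rra ?rrb ?sa' ?sb'.
  have s2 x y : size (rcons (rcons c x) y) = size a by rewrite !size_rcons.
  rewrite (IH a' (rcons (rcons c k) l)) ?sa' //; last by apply: red; auto.
  rewrite (IH b' (rcons (rcons c l) k)) ?sb' //; last by apply: red; auto.
  by rewrite !ddiffw_rcons; congr (ddiffw c _); exact: ddiff'_braid.
rewrite !ddiffw_rcons; case: (gen_pairs g h) => [egh|[r1 r2 gh desc]|br|br].
- by rewrite -egh; apply: IH => //; rewrite ea eb egh.
- have i1 := inv2_descent wb da.
  have i2 := inv2_descent (swb g w wb) (desc w wb db).
  have [c ec rc] := reduced_exists (simple_weylD h (simple_weylD g wD)).
  have sc : (size c).+1 = size a by lia.
  have e1 : prodw (rcons c h) = prodw a by rewrite ea prodw_rcons ec sK.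
  have e2 : prodw (rcons c g) = prodw b.
    by rewrite eb prodw_rcons ec [(srefl h * (srefl g * _))%g]mulgA -gh -mulgA sK.
  rewrite (IH a (rcons c h)) //; last by rewrite /reduced e1 ra' size_rcons sc.
  rewrite (IH b (rcons c g)) -?sab //; last by rewrite /reduced e2 rb' size_rcons sc sab.
  by rewrite !ddiffw_rcons ddiff'_commute.
- by apply: braid.
- by apply/esym/braid.
Qed.

(** The shortest prefix that is not reduced ends in a letter which the rest of
  the prefix may be assumed to end in as well, and squares of divided
  differences are zero. *)
Lemma ddiffw_nonreduced a f : ~ reduced a -> ddiffw a f = 0.
Proof.
elim/last_ind: a f => [|a g IH] f nr; first by case: nr; rewrite /reduced inv2_1.
rewrite ddiffw_rcons; have [ra|] := eqVneq (inv2 (prodw a)) (2 * size a)%N; last first.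
  by move/eqP/IH.
have d : descent (prodw a) g.
  apply/negPn/negP => /(inv2_ascent (prodw_bar _)) e; apply: nr.
  by rewrite /reduced prodw_rcons e size_rcons ra; lia.
have i1 := inv2_descent (prodw_bar a) d.
have [c ec rc] := reduced_exists (simple_weylD g (prodw_weylD a)).
have e : prodw (rcons c g) = prodw a by rewrite prodw_rcons ec mulgA simpleK mul1g.
rewrite (@ddiffw_reduced a (rcons c g)) //.
  by rewrite ddiffw_rcons ddiff'_sqr ddiffw0.
by rewrite /reduced e size_rcons; lia.
Qed.

(** A single polynomial on which the operator does not vanish certifies that
  the word is reduced, which saves computing lengths. *)
Lemma ddiffw_reduced_word a b w f0 f : ddiffw a f0 != 0 -> prodw a = w ->
  reduced_word b w -> ddiffw b f = ddiffw a f.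
Proof.
move=> nz ea [eb mb]; have ra : reduced a.
  by apply/eqP; apply: contraNT nz => /eqP/(@ddiffw_nonreduced a f0) ->.
apply: ddiffw_reduced => //; last by rewrite ea.
by have := mb a ea; have := inv2_prodw b; move: ra; rewrite /reduced ea eb; lia.
Qed.

End Matsumoto.

(** * Divided differences along a run of transpositions *)

Arguments ddiff' : simpl never.
Arguments srefl : simpl never.

Section Rotation.
Variables (S : idomainType) (m : nat).
Local Notation n := m.+1.
Implicit Types (f h : {mpoly S[n]}) (p r : {poly S}) (ps : nat -> {poly S}).

(** The empty word outside the range, so that runs need no side condition to
  be written down. *)
Definition tr_word i : seq (gen n) :=
  (if (i.+1 < n)%N as b return (i.+1 < n)%N = b -> seq (gen n)
   then fun hi => [:: Tr hi] else fun=> [::]) erefl.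

Lemma tr_wordE i (h : (i.+1 < n)%N) : tr_word i = [:: Tr h].
Proof.
rewrite /tr_word; move: (erefl (i.+1 < n)%N); rewrite {2 3}h => h'.
by rewrite (bool_irrelevance h h').
Qed.

(** The word s_(j+d-1) ... s_j in positions counted from 0; as an operator it
  starts with s_j. *)
Fixpoint run j d : seq (gen n) := if d is d'.+1 then run j.+1 d' ++ tr_word j else [::].

(** Polynomials in one variable, placed at the variable with index [i]; the
  degree in a single variable is then the size of [p]. *)
Definition ev (i : nat) p : {mpoly S[n]} := (map_poly (@mpolyC n S) p).['X_(inord i)].

Lemma evD i p r : ev i (p + r) = ev i p + ev i r.
Proof. by rewrite /ev rmorphD hornerD. Qed.
Lemma evM i p r : ev i (p * r) = ev i p * ev i r.
Proof. by rewrite /ev rmorphM hornerM. Qed.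
Lemma ev0 i : ev i 0 = 0. Proof. by rewrite /ev rmorph0 horner0. Qed.
Lemma ev1 i : ev i 1 = 1. Proof. by rewrite /ev rmorph1 hornerC. Qed.
Lemma evC i c : ev i c%:P = c%:MP. Proof. by rewrite /ev map_polyC hornerC. Qed.
Lemma evXn i k : ev i 'X^k = 'X_(inord i) ^+ k.
Proof. by rewrite /ev map_polyXn hornerXn. Qed.

Lemma evE i p : ev i p = \sum_(k < size p) (p`_k)%:MP * ev i 'X^k.
Proof.
rewrite -{1}[p]coefK poly_def; elim/big_rec2: _ => [|k a b _ <-]; first exact: ev0.
by rewrite evD -mul_polyC evM evC.
Qed.

Lemma wact_ev (w : {perm symb n}) i p :
  wact w (ev i p) = (map_poly (@mpolyC n S) p).[wact w 'X_(inord i)].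
Proof.
rewrite /ev -horner_map -map_poly_comp; congr horner.
by apply: eq_map_poly => c /=; rewrite wactC.
Qed.

Lemma lo_inord i (h : (i.+1 < n)%N) : inord i = lo h.
Proof. by apply: val_inj; rewrite /= inordK // ltnW. Qed.
Lemma hi_inord i (h : (i.+1 < n)%N) : inord i.+1 = hi h.
Proof. by apply: val_inj; rewrite /= inordK. Qed.

Lemma wact_ev_lo i (h : (i.+1 < n)%N) p : wact (srefl (Tr h)) (ev i p) = ev i.+1 p.
Proof.
by rewrite wact_ev wactX (lo_inord h) (@simple_lo _ (Tr h)) expr0 scale1r /ev (hi_inord h).
Qed.
Lemma wact_ev_hi i (h : (i.+1 < n)%N) p : wact (srefl (Tr h)) (ev i.+1 p) = ev i p.
Proof. by rewrite -(wact_ev_lo h) wact_sK. Qed.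
Lemma wact_ev_out i (h : (i.+1 < n)%N) k p : k != i -> k != i.+1 -> (k < n)%N ->
  wact (srefl (Tr h)) (ev k p) = ev k p.
Proof.
move=> k1 k2 kn; rewrite wact_ev wactX simple_out ?expr0 ?scale1r //.
  by rewrite -val_eqE /= inordK.
by rewrite -val_eqE /= inordK.
Qed.

Definition symm j k f :=
  forall i (h : (i.+1 < n)%N), (j <= i < k)%N -> wact (srefl (Tr h)) f = f.

Lemma symmM j k f h : symm j k f -> symm j k h -> symm j k (f * h).
Proof. by move=> sf sh i hi hij; rewrite rmorphM /= sf ?sh. Qed.

Lemma symm_ev j k l p : (l < j)%N || (k < l)%N -> (l < n)%N -> symm j k (ev l p).
Proof. by move=> hl ln i h hi; apply: wact_ev_out => //; lia. Qed.

Lemma symm_prod j k (r : seq nat) (F : nat -> {mpoly S[n]}) (P : pred nat) :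
  (forall l, l \in r -> P l -> symm j k (F l)) -> symm j k (\prod_(l <- r | P l) F l).
Proof.
move=> sF i h hi; rewrite rmorph_prod big_seq_cond [RHS]big_seq_cond.
by apply: eq_bigr => l /andP[lr Pl]; apply: sF.
Qed.

Lemma ddiffw_run j d f (h : (j.+1 < n)%N) :
  ddiffw (run j d.+1) f = ddiffw (run j.+1 d) (ddiff' (Tr h) f).
Proof. by rewrite /= (tr_wordE h) ddiffw_cat. Qed.

Lemma ddiffw_runZ j d c f : (j + d < n)%N -> symm j (j + d) c ->
  ddiffw (run j d) (c * f) = c * ddiffw (run j d) f.
Proof.
elim: d j f => [//|d IH] j f jd sc; have h : (j.+1 < n)%N by lia.
rewrite !(ddiffw_run _ _ h) ddiff'Z; last by apply: sc; lia.
by rewrite IH //; [lia | move=> i hi hij; apply: sc; lia].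
Qed.

(** The divided difference of a monomial in two variables is a sum of
  monomials of total degree one less, with all exponents below the larger of
  the two: this bounds the degree in the second variable, which is the only one
  that later letters of a run touch. *)
Lemma ddiff_pair j (h : (j.+1 < n)%N) d p r : (size p <= d.+1)%N -> (size r <= d.+1)%N ->
  exists2 s : seq ({poly S} * {poly S}), all (fun t : {poly S} * {poly S} => size t.2 <= d)%N s &
    ddiff' (Tr h) (ev j p * ev j.+1 r) = \sum_(t <- s) ev j t.1 * ev j.+1 t.2.
Proof.
pose D G := exists2 s : seq ({poly S} * {poly S}), all (fun t : {poly S} * {poly S} => size t.2 <= d)%N s &
    ddiff' (Tr h) G = \sum_(t <- s) ev j t.1 * ev j.+1 t.2.
have DD F G : D F -> D G -> D (F + G).
  move=> [s hs es] [s' hs' es']; exists (s ++ s'); first by rewrite all_cat hs.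
  by rewrite ddiff'D es es' big_cat.
have DC (c : S) G : D G -> D (c%:MP * G).
  move=> [s hs es]; exists [seq (c%:P * t.1, t.2) | t <- s]; first by rewrite all_map.
  rewrite ddiff'Z ?wactC // es big_distrr big_map; apply: eq_bigr => t _.
  by rewrite /= evM evC mulrA.
have D0 : D 0 by exists [::]; rewrite ?big_nil // ddiff'0.
(* (xy)^a (y^(b-a) - x^(b-a)) divided by y - x; the second statement is the
   negative of the first *)
have key a b : (a <= b <= d)%N ->
    D (ev j 'X^a * ev j.+1 'X^b) /\ D (ev j 'X^b * ev j.+1 'X^a).
  move=> ab; have e : root' S (Tr h) * (\sum_(i < b - a)
      ev j 'X^(a + i) * ev j.+1 'X^(b - a.+1 - i + a)) =
      ev j 'X^a * ev j.+1 'X^b - ev j 'X^b * ev j.+1 'X^a.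
    rewrite root'E /= expr0 scale1r -(lo_inord h) -(hi_inord h).
    transitivity (('X_(inord j) * 'X_(inord j.+1)) ^+ a *
       ('X_(inord j.+1) ^+ (b - a) - 'X_(inord j) ^+ (b - a)) : {mpoly S[n]}); last first.
      rewrite mulrBr exprMn_comm; last exact: mulrC.
      have eb (x : {mpoly S[n]}) : x ^+ b = x ^+ (b - a) * x ^+ a.
        by rewrite -exprD subnK //; lia.
      by rewrite !evXn !eb; ring.
    rewrite subrXX mulrCA; congr (_ * _); rewrite big_distrr /=; apply: eq_bigr => i _.
    rewrite !evXn exprMn_comm; last exact: mulrC.
    by rewrite !exprD (_ : b - a.+1 - i = (b - a).-1 - i)%N; [ring | lia].
  pose s := [seq ('X^(a + i) : {poly S}, 'X^(b - a.+1 - i + a) : {poly S})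
    | i : 'I_(b - a) <- index_enum 'I_(b - a)].
  have hs : all (fun t : {poly S} * {poly S} => size t.2 <= d)%N s.
    by apply/allP => t /mapP[i _ ->] /=; rewrite size_polyXn; have := ltn_ord i; lia.
  split.
    exists s => //; apply: ddiff'_unique; rewrite big_map /= e rmorphM /=.
    by rewrite wact_ev_lo wact_ev_hi [_ * ev j _]mulrC.
  exists [seq (- t.1, t.2) | t <- s]; first by rewrite all_map.
  apply: ddiff'_unique; rewrite !big_map /= rmorphM /= wact_ev_lo wact_ev_hi.
  rewrite [ev j.+1 'X^b * _]mulrC -opprB -e -mulrN -sumrN; congr (_ * _).
  by apply: eq_bigr => i _; rewrite -[- 'X^_]mulN1r -polyCN evM evC rmorphN rmorph1 mulN1r mulNr.
have DS k (F : 'I_k -> {mpoly S[n]}) : (forall i, D (F i)) -> D (\sum_i F i).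
  by move=> DF; elim/big_ind: _ => [|G H|i _]; [exact: D0 | exact: DD | exact: DF].
move=> sp sr; suff : D (ev j p * ev j.+1 r) by [].
rewrite (evE j p) (evE j.+1 r) big_distrl /=; apply: (DS) => a.
rewrite big_distrr /=; apply: (DS) => b.
rewrite mulrACA -mulrA; apply: (DC); apply: (DC).
have := ltn_ord a; have := ltn_ord b => hb ha.
case: (leqP a b) => ab.
  have h1 : (a <= b <= d)%N by rewrite ab -ltnS (leq_trans hb sr).
  exact: (key a b h1).1.
have h1 : (b <= a <= d)%N by rewrite (ltnW ab) -ltnS (leq_trans ha sp).
exact: (key b a h1).2.
Qed.

(** A count of degrees: the l-th variable of the run has degree less than the
  number of variables from the l-th to the last, and for the first variable
  the bound is smaller by one.  By [ddiff_pair] each step hands this deficit on to the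
  next variable, until a degree would be negative. *)
Lemma ddiffw_run_vanish j d h p ps : (j + d < n)%N -> symm j (j + d) h ->
    (size p <= d)%N -> (forall l, (j < l <= j + d)%N -> (size (ps l) <= j + d.+1 - l)%N) ->
  ddiffw (run j d) (h * ev j p * \prod_(j.+1 <= l < (j + d).+1) ev l (ps l)) = 0.
Proof.
elim: d j h p ps => [|d IH] j h p ps jd sh sp sps.
  by move: sp; rewrite leqn0 size_poly_eq0 => /eqP ->; rewrite ev0 mulr0 mul0r.
have hj : (j.+1 < n)%N by lia.
rewrite (ddiffw_run _ _ hj) big_ltn; last by lia.
set M := \prod_(_ <= l < _) _.
have sM : wact (srefl (Tr hj)) M = M.
  apply: (@symm_prod j j.+1) => //; last by lia.
  by move=> l; rewrite mem_index_iota => hl _; apply: symm_ev; lia.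
have sr : (size (ps j.+1) <= d.+1)%N by apply: leq_trans (sps _ _) _; lia.
have [s hs es] := ddiff_pair hj sp sr.
have -> : h * ev j p * (ev j.+1 (ps j.+1) * M) = (h * M) * (ev j p * ev j.+1 (ps j.+1)).
  by rewrite [RHS]mulrACA; congr (_ * _); rewrite mulrC.
rewrite ddiff'Z; last by rewrite rmorphM /= sM sh //; lia.
rewrite es big_distrr /= ddiffw_sum big_seq big1 // => t ts.
have -> : h * M * (ev j t.1 * ev j.+1 t.2) = h * ev j t.1 * ev j.+1 t.2 * M.
  by rewrite mulrACA [M * _]mulrC mulrA.
rewrite /M -addSnnS; apply: IH; first by lia.
- apply: symmM; first by move=> i hi hij; apply: sh; lia.
  by apply: symm_ev; lia.
- exact: (allP hs).
- by move=> l hl; apply: leq_trans (sps _ _) _; lia.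
Qed.

Lemma wact_ddiff'_commuting (g h : gen n) f : commuting S g h ->
  wact (srefl g) f = f -> wact (srefl g) (ddiff' h f) = ddiff' h f.
Proof.
case=> r1 _ st _ sf; apply/esym/ddiff'_unique.
have e : wact (srefl g) (wact (srefl h) f) = wact (srefl h) f.
  rewrite wact_comp -?st; last exact: simple_bar.
  by rewrite -wact_comp ?sf //; exact: simple_bar.
by rewrite -{1}r1 -rmorphM ddiff'P rmorphB /= sf e.
Qed.

(** In the Leibniz rule, the term in which the reflection moves the factor at
  x_(l) to x_(l-1) is the one wanted, and the terms in which the divided
  difference hits this factor vanish by [ddiffw_run_vanish]. *)
Lemma ddiffw_run_shift j d ps f : (j + d < n)%N -> symm j.+1 (j + d) f ->
    (forall l, (j < l <= j + d)%N -> (size (ps l) <= j + d.+1 - l)%N) ->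
  ddiffw (run j d) (\prod_(j.+1 <= l < (j + d).+1) ev l (ps l) * f) =
  \prod_(j.+1 <= l < (j + d).+1) ev l.-1 (ps l) * ddiffw (run j d) f.
Proof.
elim: d j ps f => [|d IH] j ps f jd sf sps; first by rewrite !big_geq ?mul1r //; lia.
have hj : (j.+1 < n)%N by lia.
have hlt : (j.+1 < (j + d.+1).+1)%N by lia.
rewrite !(ddiffw_run d _ hj) (big_ltn (m := j.+1) hlt) [in RHS](big_ltn (m := j.+1) hlt) /=.
set M := \prod_(j.+2 <= l < _) ev l _; set M' := \prod_(j.+2 <= l < _) ev l.-1 _.
have sM : wact (srefl (Tr hj)) M = M.
  apply: (@symm_prod j j.+1) => //; last by lia.
  by move=> l; rewrite mem_index_iota => hl _; apply: symm_ev; lia.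
have sr : (size (ps j.+1) <= d.+1)%N by apply: leq_trans (sps _ _) _; lia.
have s1 : (size (1%R : {poly S}) <= d.+1)%N by rewrite size_poly1.
have [s hs es] := ddiff_pair hj s1 sr; rewrite ev1 mul1r in es.
rewrite ddiff'M [_ * M]mulrC ddiff'Z // rmorphM /= sM wact_ev_hi ddiffwD.
have -> : ddiffw (run j.+1 d) (M * ddiff' (Tr hj) (ev j.+1 (ps j.+1)) * f) = 0.
  rewrite es big_distrr big_distrl /= ddiffw_sum big_seq big1 // => t ts.
  have -> : M * (ev j t.1 * ev j.+1 t.2) * f = f * ev j t.1 * ev j.+1 t.2 * M.
    by rewrite mulrC [M * _]mulrC !mulrA.
  rewrite /M -addSnnS; apply: ddiffw_run_vanish; first by lia.
  - apply: symmM; first by move=> i hi hij; apply: sf; lia.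
    by apply: symm_ev; lia.
  - exact: (allP hs).
  - by move=> l hl; apply: leq_trans (sps _ _) _; lia.
rewrite add0r [M * _]mulrC -!mulrA ddiffw_runZ; [|lia|apply: symm_ev; lia].
congr (_ * _); rewrite /M /M' -addSnnS; apply: IH; first by lia.
  move=> i hi hij; apply: wact_ddiff'_commuting; last by apply: sf; lia.
  by apply: disjoint_commuting; rewrite -!val_eqE /=; lia.
by move=> l hl; apply: leq_trans (sps _ _) _; lia.
Qed.

(** In general the run maps x_j^k, up to sign, to the complete symmetric
  polynomial of degree k - d in the variables of the run. *)
Lemma ddiffw_run_Xn j d k : (j + d < n)%N -> (k <= d)%N ->
  ddiffw (run j d) (ev j 'X^k) = ((-1) ^+ d *+ (k == d))%:MP.
Proof.
move=> jd; rewrite leq_eqVlt => /orP[/eqP->{k}|kd]; last first.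
  have := @ddiffw_run_vanish j d 1 'X^k (fun=> 1) jd.
  rewrite mul1r [\prod_(_ <= _ < _) _]big1 ?mulr1; last by move=> l _; rewrite ev1.
  rewrite (ltn_eqF kd) mulr0n => -> //.
  - by move=> i hi _; rewrite rmorph1.
  - by rewrite size_polyXn.
  - by move=> l hl; rewrite size_poly1; lia.
rewrite eqxx mulr1n; elim: d j jd => [|d IH] j jd; first by rewrite /= ev1 expr0.
have hj : (j.+1 < n)%N by lia.
have e : ddiff' (Tr hj) (ev j 'X^(d.+1)) =
    \sum_(i < d.+1) - (ev j 'X^i * ev j.+1 'X^(d - i)).
  apply: ddiff'_unique; rewrite wact_ev_lo root'E /= expr0 scale1r.
  rewrite -(lo_inord hj) -(hi_inord hj) !evXn -[RHS]opprB subrXX -mulrN; congr (_ * _).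
  by rewrite -sumrN; apply: eq_bigr => i _; rewrite !evXn mulrC.
rewrite (ddiffw_run d _ hj) e ddiffw_sum big_ord_recl /= big1 ?addr0 => [|i _].
  rewrite evXn expr0 mul1r subn0 ddiffwN IH; last by lia.
  by rewrite exprS mulN1r rmorphN.
have := @ddiffw_run_vanish j.+1 d (- ev j 'X^(lift ord0 i)) 'X^(d - lift ord0 i) (fun=> 1).
rewrite [\prod_(_ <= _ < _) _]big1 ?mulr1; last by move=> l _; rewrite ev1.
rewrite mulNr; apply; first by lia.
- move=> k hk hjk; rewrite rmorphN /=; congr (- _).
  by apply: (@symm_ev j.+1 (j.+1 + d)) => //; lia.
- by rewrite size_polyXn lift0; have := ltn_ord i; lia.
- by move=> l hl; rewrite size_poly1; lia.
Qed.

End Rotation.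
Arguments ev {S m} i p.
Arguments run {m} j d.

(** * Parts of a set as a decreasing sequence *)

Lemma gtn_trans : transitive gtn.
Proof. by move=> y x z /= yx zy; apply: ltn_trans zy yx. Qed.

Section Parts.
Variable n : nat.
Implicit Types (A B : {set 'I_n}) (b : 'I_n).

(** The sign of a part in a contraction is (-1) to the number of larger
  parts. *)
Definition above A (b : nat) := #|[set x : 'I_n in A | (b < x)%N]|.

Lemma parts_sorted A : sorted gtn (parts A).
Proof.
rewrite /parts rev_sorted sorted_map.
have -> : enum A = [seq x <- enum 'I_n | x \in A] by rewrite enumT.
apply: sorted_filter; first by move=> x y z; exact: ltn_trans.
by have := iota_ltn_sorted 0 n; rewrite -val_enum_ord sorted_map.
Qed.

Lemma eq_sorted_gtn (s t : seq nat) : sorted gtn s -> sorted gtn t -> s =i t -> s = t.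
Proof.
by apply: irr_sorted_eq => [y x z|x]; [exact: gtn_trans | exact: ltnn].
Qed.

Lemma mem_partsP A p : reflect (exists2 b, b \in A & p = b :> nat) (p \in parts A).
Proof.
apply: (iffP idP) => [pA|[b bA ->]]; last by rewrite mem_parts.
by exists (Ordinal (parts_ltn pA)) => //; rewrite -mem_parts.
Qed.

Lemma parts_rem A b : rem (val b) (parts A) = parts (A :\ b).
Proof.
rewrite rem_filter ?parts_uniq //; apply: eq_sorted_gtn; last 1 first.
- move=> p; rewrite mem_filter /=; apply/andP/mem_partsP.
    case=> pb /mem_partsP[c cA e]; exists c => //.
    by rewrite !inE cA andbT; apply: contraNneq pb => <-; apply/eqP.
  by case=> c /setD1P[cb cA] ->; rewrite mem_parts cA.
- by apply: sorted_filter (parts_sorted A) => y x z; exact: gtn_trans.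
- exact: parts_sorted.
Qed.

Lemma index_sorted (s : seq nat) x : sorted gtn s -> x \in s ->
  index x s = count (fun y => x < y)%N s.
Proof.
elim: s => //= y s IH; rewrite (path_sortedE gtn_trans) => /andP[/allP ys ss].
rewrite inE; case: eqVneq => [->|xy] /=.
  rewrite ltnn; symmetry; apply/eqP; rewrite -leqn0 leqNgt -has_count.
  by apply/hasPn => z /ys /=; rewrite -leqNgt => /ltnW.
by move=> xs; have /= -> := ys _ xs; rewrite IH.
Qed.

Lemma big_parts (R : nmodType) A (F : nat -> R) :
  \sum_(p <- parts A) F p = \sum_(b in A) F b.
Proof.
rewrite /parts (perm_big [seq val i | i <- enum A]) /=; last by rewrite perm_rev.
by rewrite big_map big_enum.
Qed.

Lemma index_parts A b : b \in A -> index (val b) (parts A) = above A b.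
Proof.
move=> bA; rewrite index_sorted ?parts_sorted ?mem_parts //.
rewrite -sum1_count /above -sum1_card big_mkcond (big_parts A (fun p => if (b < p)%N then 1 else 0)%N).
by rewrite -big_mkcondr; apply: eq_bigl => x; rewrite inE.
Qed.

Lemma contr_uniq (R : comNzRingType) (w : nat -> R) f s : uniq s ->
  contr w f s = \sum_(x <- s) (-1) ^+ index x s * w x * f (rem x s).
Proof.
elim: s f => [|x s IH] f /=; first by rewrite big_nil.
case/andP=> xs us; rewrite big_cons eqxx expr0 mul1r IH // -sumrN; congr (_ + _).
rewrite big_seq [RHS]big_seq; apply: eq_bigr => y ys.
have /negbTE -> : x != y by apply: contraNneq xs => ->.
by rewrite exprS; ring.
Qed.

Lemma contr_parts (R : comNzRingType) (w : nat -> R) f A :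
  contr w f (parts A) =
  \sum_(b in A) (-1) ^+ above A b * w b * f (parts (A :\ b)).
Proof.
rewrite contr_uniq ?parts_uniq // big_parts; apply: eq_bigr => b bA.
by rewrite index_parts // parts_rem.
Qed.

Lemma count_parts A : count (leq 1) (parts A) = #|[set b in A | (0 < b)%N]|.
Proof.
rewrite -sum1_count -sum1_card big_mkcond (big_parts A (fun p => if (0 < p)%N then 1 else 0)%N).
by rewrite -big_mkcondr; apply: eq_bigl => x; rewrite inE.
Qed.

End Parts.

(** * Runs and a sign change acting on Q-tilde polynomials *)

Arguments elsym : simpl never.

Section Steps.
Variables (S : idomainType) (m : nat).
Local Notation n := m.+1.
Local Notation MP := {mpoly S[n]}.
Implicit Types (f h : MP) (p : {poly S}) (A : {set 'I_n}).

Definition Xvars : seq MP := [seq 'X_i | i <- enum 'I_n].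
Definition Xtail : seq MP := behead Xvars.

Lemma Xvars_cons : Xvars = 'X_ord0 :: Xtail.
Proof. by rewrite /Xtail /Xvars enum_ordSl. Qed.

(** The change of sign of the first variable, which is not in the group of
  type D. *)
Definition flip : {perm symb n} := tperm (ord0, false) (ord0, true).

Lemma flip0 b : flip (ord0, b) = (ord0, ~~ b).
Proof. by case: b; rewrite /flip (tpermR, tpermL). Qed.
Lemma flip_out i b : i != ord0 -> flip (i, b) = (i, b).
Proof. by move=> i0; rewrite /flip tpermD // xpair_eqE eq_sym (negbTE i0). Qed.
Lemma flip_bar q : flip (bar q) = bar (flip q).
Proof.
case: q => i b; rewrite /bar /=; case: (eqVneq i ord0) => [->|i0].
  by rewrite !flip0.
by rewrite !flip_out.
Qed.
Lemma flipK : (flip * flip = 1)%g.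
Proof. exact: tperm2. Qed.
Lemma map_flip : map (wact flip) Xvars = - 'X_ord0 :: Xtail.
Proof.
rewrite Xvars_cons /= wactX flip0 /= expr1 scaleN1r; congr (_ :: _).
rewrite /Xtail /Xvars enum_ordSl /= -!map_comp; apply: eq_map => i /=.
by rewrite wactX flip_out ?expr0 ?scale1r // eq_sym neq_lift.
Qed.

Lemma perm_Xvars i (ti : (i.+1 < n)%N) : perm_eq (map (wact (srefl (Tr ti))) Xvars) Xvars.
Proof.
pose s := tperm (lo ti) (hi ti).
have -> : map (wact (srefl (Tr ti))) Xvars = [seq 'X_(s i) | i <- enum 'I_n].
  rewrite /Xvars -map_comp; apply: eq_map => j /=; rewrite wactX /s.
  case: tpermP => [->|->|/eqP j1 /eqP j2].
  - by rewrite (@simple_lo _ (Tr ti)) expr0 scale1r.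
  - by rewrite (@simple_hi _ (Tr ti)) expr0 scale1r.
  - by rewrite simple_out // expr0 scale1r.
rewrite (map_comp (fun j => 'X_j) s); apply: perm_map.
apply: uniq_perm; rewrite ?(map_inj_uniq perm_inj) ?enum_uniq // => j.
rewrite mem_enum; apply/mapP; exists (s^-1 j)%g; rewrite ?mem_enum //.
by rewrite permKV.
Qed.

Lemma symm_elsym i k : symm 0 k (elsym Xvars i).
Proof. by move=> j hj _; rewrite elsym_map; exact/elsym_perm/perm_Xvars. Qed.

Lemma symm_Qtilde l k : symm 0 k (Qtilde Xvars l).
Proof. by move=> j hj _; rewrite Qtilde_map; exact/Qtilde_perm/perm_Xvars. Qed.

Lemma flip_Qtilde l : wact flip (Qtilde Xvars l) =
  (-1) ^+ size l * Qtilde Xvars l + 2 * contr (fun k : nat => elsym Xtail k) (Qtilde Xvars) l.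
Proof. by rewrite Qtilde_map map_flip Xvars_cons Qtilde_flip. Qed.

Lemma size_Xtail : size Xtail = m.
Proof. by rewrite size_behead size_map size_enum_ord. Qed.

(** Duality between powers of the first variable and the e_k of the others.
  By e_(k+1)(X) = e_(k+1)(x_2, ...) + x_1 e_k(x_2, ...), where e_(k+1)(X) is
  symmetric and may be pulled out, a power of x_1 is traded for an index of e
  until one of the two is used up. *)
Lemma ddiffw_run_elsym e k : (e <= m)%N ->
  ddiffw (run 0 m) (ev 0 'X^e * elsym Xtail k%:Z) = ((-1) ^+ e *+ (k + e == m)%N)%:MP.
Proof.
have x0 : 'X_(inord 0) = 'X_ord0 :> MP by congr 'X_ _; apply: val_inj; rewrite /= inordK.
have T0 e' : (e' <= m)%N ->
    ddiffw (run 0 m) (ev 0 'X^e') = ((-1) ^+ m *+ (e' == m))%:MP :> MP.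
  by move=> he; apply: ddiffw_run_Xn.
have step e' k' : (e' < m)%N -> ddiffw (run 0 m) (ev 0 'X^(e'.+1) * elsym Xtail k'%:Z) =
    - ddiffw (run 0 m) (ev 0 'X^e' * elsym Xtail k'.+1%:Z).
  move=> he; have E : ev 0 'X^(e'.+1) * elsym Xtail k'%:Z =
      elsym Xvars k'.+1%:Z * ev 0 'X^e' - ev 0 'X^e' * elsym Xtail k'.+1%:Z.
    rewrite Xvars_cons elsym_cons (_ : k'.+1%:Z - 1 = k'); last by lia.
    rewrite !evXn !x0 exprS.
    by move: ('X_ord0 : MP) (_ ^+ e') (elsym _ _) (elsym _ _) => x c a b; ring.
  rewrite E ddiffwD ddiffwN (@ddiffw_runZ _ _ 0 m (elsym Xvars k'.+1)) //; last exact: symm_elsym.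
  by rewrite T0 ?(ltnW he) // (ltn_eqF he) mulr0n mpolyC0 mulr0 add0r.
have down e' : forall k', (e' <= m)%N -> ddiffw (run 0 m) (ev 0 'X^e' * elsym Xtail k'%:Z) =
    (-1) ^+ e' * ddiffw (run 0 m) (elsym Xtail (k' + e')%:Z).
  elim: e' => [|e' IH] k' he; first by rewrite !expr0 ev1 !mul1r addn0.
  by rewrite step // IH ?(ltnW he) // exprS mulN1r mulNr addSnnS.
move=> he; rewrite down //.
have -> : ddiffw (run 0 m) (elsym Xtail (k + e)%:Z) = ((k + e == m)%:R)%:MP :> MP.
  case: (leqP (k + e) m) => h; last first.
    by rewrite elsym_large ?size_Xtail // ddiffw0 (gtn_eqF h) mpolyC0.
  have := down _ 0%N h; rewrite elsym0 mulr1 T0 // add0n.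
  move/(congr1 (fun z => (-1) ^+ (k + e) * z)); rewrite mulrA -expr2 sqrr_sign mul1r => <-.
  case: eqP => [->|_]; last by rewrite !mulr0n mpolyC0 mulr0.
  by rewrite !mulr1n rmorphXn rmorphN rmorph1 -expr2 sqrr_sign.
case: eqP => _; last by rewrite !mulr0n mpolyC0 mulr0.
by rewrite !mulr1n mpolyC1 mulr1 rmorphXn rmorphN rmorph1.
Qed.

(** Coefficients read from degree [m] downwards; the test guards against the
  truncated subtraction. *)
Definition rev_coef p (k : nat) : S := if (k <= m)%N then p`_(m - k) else 0.

Lemma wact_flip_ev0 p : wact flip (ev 0 p) = ev 0 (p \Po (- 'X)).
Proof.
have x0 : inord 0 = ord0 :> 'I_n by apply: val_inj; rewrite /= inordK.
rewrite wact_ev wactX x0 flip0 expr1 scaleN1r /ev map_comp_poly horner_comp x0.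
by rewrite rmorphN /= map_polyX hornerN hornerX.
Qed.

Lemma ddiffw_run_flip p k : (size p <= n)%N ->
  ddiffw (run 0 m) (wact flip (ev 0 p) * elsym Xtail k%:Z) = (rev_coef p k)%:MP.
Proof.
move=> sp; rewrite evE rmorph_sum /= mulr_suml ddiffw_sum.
have x0 : inord 0 = ord0 :> 'I_n by apply: val_inj; rewrite /= inordK.
transitivity (\sum_(e < size p) (p`_e *+ (k + e == m)%N)%:MP : MP).
  apply: eq_bigr => e _.
  have -> : wact flip ((p`_e)%:MP * ev 0 'X^e) * elsym Xtail k%:Z =
      ((-1) ^+ e * p`_e)%:MP * (ev 0 'X^e * elsym Xtail k%:Z).
    rewrite rmorphM /= wactC evXn x0 rmorphXn /= wactX flip0 /= expr1 scaleN1r.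
    by rewrite rmorphM rmorphXn rmorphN rmorph1 exprNn; ring.
  rewrite ddiffwZ; last by move=> w; rewrite wactC.
  rewrite ddiffw_run_elsym; last by rewrite -ltnS (leq_trans (ltn_ord e) sp).
  rewrite -rmorphM; congr _%:MP; case: eqP => _; last by rewrite !mulr0n mulr0.
  by rewrite !mulr1n mulrAC -expr2 sqrr_sign mul1r.
rewrite -rmorph_sum; congr _%:MP; rewrite /rev_coef.
case: (leqP k m) => km; last by rewrite big1 // => e _; rewrite gtn_eqF ?mulr0n //; lia.
case: (ltnP (m - k) (size p)) => h; last first.
  rewrite nth_default // big1 // => e _; rewrite ltn_eqF ?mulr0n //.
  by have := ltn_ord e; lia.
rewrite (bigD1 (Ordinal h)) //= big1 ?addr0 => [|e ne].
  by rewrite subnKC // eqxx mulr1n.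
rewrite (negbTE (_ : k + e != m)%N) ?mulr0n //.
by apply: contra ne => /eqP e1; rewrite -val_eqE /= -e1 addKn.
Qed.

(** The operator passes through the symmetric factors and acts on the
  function that is contracted. *)
Lemma ddiffw_contr (a : seq (gen n)) u (w : nat -> MP) (Q : seq nat -> MP) l :
    (forall t f, ddiffw a (Q t * f) = Q t * ddiffw a f) ->
  ddiffw a (u * contr w Q l) = contr (fun k => ddiffw a (u * w k)) Q l.
Proof.
elim: l Q => [|k l IH] Q hQ /=; first by rewrite mulr0 ddiffw0.
rewrite mulrBr mulrA [u * w k * _]mulrC ddiffwD ddiffwN hQ [_ * Q l]mulrC.
by rewrite IH // => t f; exact: hQ.
Qed.

(** [Qtilde_flip] produces contraction by e_k of the other variables, and
  [ddiffw_run_flip] evaluates the run on these. *)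
Lemma run_flip_Qtilde p l : (size p <= n)%N ->
  ddiffw (run 0 m) (wact flip (ev 0 p * Qtilde Xvars l)) =
  (-1) ^+ size l * (p`_m)%:MP * Qtilde Xvars l
  + 2 * contr (fun k => (rev_coef p k)%:MP) (Qtilde Xvars) l.
Proof.
move=> sp; rewrite rmorphM /= flip_Qtilde mulrDr ddiffwD.
have sQ t f : ddiffw (run 0 m) (Qtilde Xvars t * f) = Qtilde Xvars t * ddiffw (run 0 m) f.
  by apply: ddiffw_runZ => //; exact: symm_Qtilde.
have wC (c : S) (w : {perm symb n}) : wact w c%:MP = c%:MP :> MP by exact: wactC.
congr (_ + _).
  have -> : wact flip (ev 0 p) * ((-1) ^+ size l * Qtilde Xvars l) =
     ((-1) ^+ size l)%:MP * (Qtilde Xvars l * (wact flip (ev 0 p) * elsym Xtail 0)).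
    by rewrite elsym0 rmorphXn rmorphN rmorph1; ring.
  rewrite ddiffwZ // sQ (@ddiffw_run_flip p 0) // /rev_coef subn0 rmorphXn rmorphN rmorph1.
  by ring.
rewrite mulrCA (_ : 2 = 2%:MP :> MP); last by rewrite rmorph_nat.
rewrite ddiffwZ // ddiffw_contr //; congr (_ * _).
by apply: eq_contr => // k; exact: ddiffw_run_flip.
Qed.

End Steps.

(** * Lowering the staircase *)

Section SetSteps.
Variables (S : idomainType) (m : nat).
Local Notation n := m.+1.
Local Notation MP := {mpoly S[n]}.
Local Notation ev := (@ev S m).
Local Notation run := (@run m).
Implicit Types (f h : MP) (p : {poly S}) (A G : {set 'I_n}) (b : 'I_n).

Hypothesis u2 : (2 : MP) \is a GRing.unit.

(** A part 0 may belong to [A] and does not change the polynomial; it is kept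
  in the set because a contraction step may remove it. *)
Definition PtildeX A : MP := Ptilde (Xvars S m) (parts (A :\ ord0)).

Lemma PtildeXE A : PtildeX A = 2 ^- #|A :\ ord0| * Qtilde (Xvars S m) (parts (A :\ ord0)).
Proof.
rewrite /PtildeX /Ptilde count_parts; congr (2 ^- #|pred_of_set _| * _).
by apply/setP => b; rewrite !inE andbC lt0n -val_eqE; case: (_ == _).
Qed.

Lemma wact_pow2 (w : {perm symb n}) k : wact w (2 ^- k) = 2 ^- k :> MP.
Proof. by rewrite rmorphV ?unitrX // rmorphXn /= rmorph_nat. Qed.

Lemma symm_PtildeX A k : symm 0 k (PtildeX A).
Proof.
rewrite PtildeXE; apply: symmM; last exact: symm_Qtilde.
by move=> i hi _; rewrite wact_pow2.
Qed.

(** Passing from Q-tilde to P-tilde, the factor 2 of the contraction is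
  absorbed by the part removed.  The term that removes no part accounts for the
  removal of the part 0; without such a part its coefficient has to vanish. *)
Lemma flip_step_PtildeX p A : (size p <= n)%N -> (ord0 \in A) || (p`_m == 0) ->
  ddiffw (run 0 m) (wact (flip m) (ev 0 p * PtildeX A)) =
  \sum_(b in A) (-1) ^+ above A b * (rev_coef m p b)%:MP * PtildeX (A :\ b).
Proof.
move=> sp h0; set B := A :\ ord0.
have cst (c : S) (w : {perm symb n}) : wact w c%:MP = c%:MP :> MP by exact: wactC.
have -> : wact (flip m) (ev 0 p * PtildeX A) =
    2 ^- #|B| * wact (flip m) (ev 0 p * Qtilde (Xvars S m) (parts B)).
  by rewrite PtildeXE -/B mulrCA rmorphM /= wact_pow2.
rewrite ddiffwZ; last by move=> w; exact: wact_pow2.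
rewrite run_flip_Qtilde // size_parts contr_parts mulrDr.
have E b : b \in A -> b != ord0 -> (-1) ^+ above A b * (rev_coef m p b)%:MP * PtildeX (A :\ b)
    = 2 ^- #|B| * (2 * ((-1) ^+ above B b * (rev_coef m p b)%:MP * Qtilde (Xvars S m) (parts (B :\ b)))).
  move=> bA b0; have bB : b \in B by rewrite !inE b0.
  have -> : above A b = above B b.
    apply: eq_card => x; rewrite !inE; case: (ltnP b x) => bx; rewrite ?andbF ?andbT //.
    by rewrite -val_eqE /= -lt0n (leq_ltn_trans _ bx).
  have eB : A :\ b :\ ord0 = B :\ b by apply/setP => x; rewrite !inE andbCA.
  rewrite PtildeXE eB (cardsD1 b B) bB /= exprS invrM ?unitrX //.
  rewrite [RHS]mulrA -[2 ^- _ * 2^-1 * 2]mulrA mulVr // mulr1; ring.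
have E0 : \sum_(b in B) (-1) ^+ above A b * (rev_coef m p b)%:MP * PtildeX (A :\ b) =
   2 ^- #|B| * (2 * \sum_(b in B) (-1) ^+ above B b * (rev_coef m p b)%:MP
       * Qtilde (Xvars S m) (parts (B :\ b))).
  rewrite !big_distrr /=; apply: eq_bigr => b; rewrite !inE => /andP[b0 bA].
  exact: E.
rewrite -E0; case A0: (ord0 \in A).
  rewrite [RHS](bigD1 ord0) //=; congr (_ + _); last first.
    by apply: eq_bigl => b; rewrite !inE andbC.
  have -> : above A (ord0 : 'I_n) = #|B|.
    by apply: eq_card => x; rewrite !inE andbC -val_eqE /= -lt0n.
  rewrite PtildeXE -/B (_ : B :\ ord0 = B); last first.
    by apply/setP => x; rewrite !inE; case: eqP.
  by rewrite /rev_coef /= subn0; ring.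
move: h0; rewrite A0 /= => /eqP ->; rewrite mpolyC0 mulr0 mul0r mulr0 add0r.
by apply: eq_bigl => b; rewrite !inE; case: eqP => // ->; rewrite A0.
Qed.

Lemma ddiffw_run_ev d p : (d < n)%N -> (size p <= d.+1)%N ->
  ddiffw (run 0 d) (ev 0 p) = ((-1) ^+ d * p`_d)%:MP.
Proof.
move=> dn sp; rewrite evE ddiffw_sum.
transitivity (\sum_(k < size p) (p`_k * ((-1) ^+ d *+ (k == d :> nat)))%:MP : MP).
  apply: eq_bigr => k _; rewrite ddiffwZ => [|w]; last exact: wactC.
  by rewrite ddiffw_run_Xn ?rmorphM //= -ltnS (leq_trans (ltn_ord k)).
rewrite -rmorph_sum; congr _%:MP; case: (ltnP d (size p)) => h; last first.
  rewrite nth_default // mulr0 big1 // => k _.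
  by rewrite ltn_eqF ?mulr0n ?mulr0 // (leq_trans (ltn_ord k)).
rewrite (bigD1 (Ordinal h)) //= eqxx mulr1n big1 ?addr0 1?mulrC // => k.
by rewrite -val_eqE /= => /negbTE ->; rewrite mulr0n mulr0.
Qed.

(** Later these are the products (x - y_1)...(x - y_d), and also the powers of
  x in a proof of nonvanishing. *)
Variable N : nat -> {poly S}.
Hypothesis size_N : forall d, (size (N d) <= d.+1)%N.
Hypothesis lead_N : forall d, (d <= m)%N -> (N d)`_d = 1.

(** The analogue of Delta_q for the family [N]. *)
Definition stair q : MP := \prod_(0 <= l < q) ev l (N (q.-1 - l)).

Lemma stair_rec q : stair q.+1 = ev 0 (N q) * \prod_(1 <= l < q.+1) ev l (N (q - l)).
Proof. by rewrite /stair big_ltn // subn0. Qed.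

Lemma stair_shift q : \prod_(1 <= l < q.+1) ev l.-1 (N (q - l)) = stair q.
Proof.
rewrite big_add1 /=; apply: eq_big_nat => l hl; congr (ev _ (N _)); lia.
Qed.

(** The first factor N_q(x_0) is turned into a sign by the run, the others are
  shifted one variable down. *)
Lemma drop_step q f : (q <= m)%N -> symm 0 m f ->
  ddiffw (run 0 q) (stair q.+1 * f) = (-1) ^+ q * (stair q * f).
Proof.
move=> qm sf; have sf' k : symm k (0 + q) f by move=> i hi hq; apply: sf; lia.
rewrite stair_rec -mulrA mulrCA (@ddiffw_run_shift _ _ 0 q (fun l => N (q - l))).
- rewrite stair_shift [ev 0 _ * _]mulrC (@ddiffw_runZ _ _ 0 q f); [|lia|exact: sf'].
  by rewrite ddiffw_run_ev // lead_N // mulr1 rmorphXn rmorphN rmorph1; ring.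
- lia.
- by apply: symmM => //; apply: symm_ev => //; lia.
- by move=> l hl; apply: leq_trans (size_N _) _; lia.
Qed.

Lemma flip_symm f : symm 0 m f -> symm 1 m (wact (flip m) f).
Proof.
move=> sf i ti hq; rewrite wact_comp; last exact: simple_bar.
have -> : (flip m * srefl (Tr ti) = srefl (Tr ti) * flip m)%g.
  have gl (c : bool) : flip m (lo ti, c) = (lo ti, c).
    by apply: flip_out; rewrite -val_eqE /=; lia.
  have gh (c : bool) : flip m (hi ti, c) = (hi ti, c) by exact: flip_out.
  have s0 (c : bool) : srefl (Tr ti) (ord0, c) = (ord0, c).
    by apply: simple_out; rewrite -val_eqE /=; lia.
  apply/permP => -[j c]; rewrite permM [RHS]permM.
  case: (eqVneq j ord0) => [->|j0]; first by rewrite !(s0, flip0).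
  rewrite (flip_out _ j0).
  case: (eqVneq j (lo ti)) => [->|j1]; first by rewrite (@simple_lo _ (Tr ti)) gh.
  case: (eqVneq j (hi ti)) => [->|j2]; first by rewrite (@simple_hi _ (Tr ti)) gl.
  by rewrite simple_out // flip_out.
by rewrite -wact_comp ?sf //; exact: flip_bar.
Qed.

Lemma flip_ev l p : (0 < l < n)%N -> wact (flip m) (ev l p) = ev l p.
Proof.
move=> hl; rewrite wact_ev wactX flip_out ?expr0 ?scale1r //.
by rewrite -val_eqE /= inordK; lia.
Qed.

(** Same mechanism as [drop_step], with the full run; the factor at the first
  variable stays inside and is available for a contraction. *)
Lemma flip_step q f : (q <= m)%N -> symm 0 m f ->
  ddiffw (run 0 m) (wact (flip m) (stair q.+1 * f)) =
  stair q * ddiffw (run 0 m) (wact (flip m) (ev 0 (N q) * f)).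
Proof.
move=> qm sf.
(* the full run is longer than the staircase, which is padded by 1 *)
pose ps l := if (l <= q)%N then N (q - l) else 1.
have E (j : nat -> nat) : \prod_(1 <= l < (0 + m).+1) ev (j l) (ps l) =
    \prod_(1 <= l < q.+1) ev (j l) (N (q - l)) :> MP.
  rewrite (@big_cat_nat _ _ _ q.+1) //= [X in _ * X]big1_seq ?mulr1.
    by apply: eq_big_nat => l /andP[_ hl]; rewrite /ps -ltnS hl.
  by move=> l; rewrite andTb mem_index_iota /ps => /andP[hl _]; rewrite leqNgt hl ev1.
have -> : wact (flip m) (stair q.+1 * f) =
    \prod_(1 <= l < (0 + m).+1) ev l (ps l) * wact (flip m) (ev 0 (N q) * f).
  rewrite (E id) stair_rec mulrAC [in LHS]mulrC rmorphM rmorph_prod; congr (_ * _).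
  by rewrite !big_nat; apply: eq_bigr => l hl; apply: flip_ev; lia.
rewrite ddiffw_run_shift ?(E predn) ?stair_shift //.
  rewrite rmorphM /=; apply: symmM; last exact: flip_symm.
  by rewrite wact_flip_ev0; apply: symm_ev.
by move=> l hl; rewrite /ps; case: ifP => h; rewrite ?size_poly1 ?(leq_trans (size_N _)) //; lia.
Qed.

(** The parts for which a step of the second kind is taken. *)
Variable Z : {set 'I_n}.

(** The exponent q belongs to the part m - q. *)
Definition rem_exp q := inord (m - q) \in Z.

(** The composite of the steps for the exponents q-1, ..., 0, where q-1 comes
  first. *)
Fixpoint steps q f := if q is q'.+1 then
    steps q' (if rem_exp q' then ddiffw (run 0 m) (wact (flip m) f)
             else ddiffw (run 0 q') f)
  else f.

(** The value of [steps] on a staircase times [PtildeX A], see [steps_stair]. *)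
Fixpoint steps_value q A : MP := if q is q'.+1 then
    (if rem_exp q' then
       \sum_(b in A) (-1) ^+ above A b * (rev_coef m (N q') b)%:MP * steps_value q' (A :\ b)
     else (-1) ^+ q' * steps_value q' A)
  else PtildeX A.

Lemma stepsD q f h : steps q (f + h) = steps q f + steps q h.
Proof.
by elim: q f h => //= q IH f h; case: ifP => _; rewrite ?rmorphD ?ddiffwD IH.
Qed.

Lemma steps0 q : steps q 0 = 0.
Proof. by elim: q => //= q IH; rewrite rmorph0 !ddiffw0 if_same. Qed.

Lemma steps_sum I (r : seq I) P q (F : I -> MP) :
  steps q (\sum_(i <- r | P i) F i) = \sum_(i <- r | P i) steps q (F i).
Proof. by apply: (big_morph _ (stepsD q)); rewrite steps0. Qed.

Lemma stepsZ q c f : (forall w, wact w c = c) -> steps q (c * f) = c * steps q f.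
Proof.
move=> hc; elim: q f => //= q IH f.
by case: ifP => _; rewrite ?rmorphM /= ?hc ddiffwZ // IH.
Qed.

(** The part 0 in [A] is required only for the top exponent: for the others
  the degree of N_q is too small for its coefficient of degree m. *)
Lemma steps_stair q A : (q <= n)%N -> (q < n)%N || (ord0 \in A) ->
  steps q (stair q * PtildeX A) = steps_value q A.
Proof.
elim: q A => [|q IH] A qn h0 /=; first by rewrite /stair big_geq // mul1r.
have IH' B : steps q (stair q * PtildeX B) = steps_value q B by apply: IH; rewrite ?qn //; lia.
have cs k (w : {perm symb n}) : wact w ((-1) ^+ k) = (-1) ^+ k :> MP.
  by rewrite rmorphXn rmorphN rmorph1.
case: ifP => rq; last first.
  rewrite (drop_step (qn : (q <= m)%N)); last exact: symm_PtildeX.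
  by rewrite stepsZ ?IH'.
rewrite (flip_step (qn : (q <= m)%N)); last exact: symm_PtildeX.
rewrite flip_step_PtildeX; last 2 first.
- exact: leq_trans (size_N q) _.
- case/orP: h0 => [h|->] //; apply/orP; right; rewrite nth_default //.
  exact: leq_trans (size_N q) _.
rewrite big_distrr /= steps_sum; apply: eq_bigr => b bA.
by rewrite mulrCA stepsZ ?IH' // => w; rewrite rmorphM /= cs wactC.
Qed.

End SetSteps.

(** * Iterated contractions are minors *)

Section SetContraction.
Variables (R : comNzRingType) (n : nat) (c : nat -> nat -> R) (Phi : {set 'I_n} -> R).
Implicit Types (A B G : {set 'I_n}) (b : 'I_n) (l : seq nat).

(** The part taken out first is weighted by c_(k-1), the last one by c_0. *)
Fixpoint contractions k A : R := if k is k'.+1 then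
  \sum_(b in A) (-1) ^+ above A b * c k' b * contractions k' (A :\ b) else Phi A.

Definition minor k l : R := \det (\matrix_(i < k, j < k) c j (nth 0%N l i)).

Lemma minor_expand k l : uniq l -> size l = k.+1 ->
  minor k.+1 l =
  \sum_(p <- l) (-1) ^+ (index p l + k) * c k p * minor k (rem p l).
Proof.
move=> ul sl; rewrite (big_nth 0%N) big_mkord sl /minor (expand_det_col _ ord_max).
apply: eq_bigr => i _; have il : (i < size l)%N by rewrite sl.
rewrite mxE /cofactor index_uniq // mulrCA mulrA; congr (_ * \det _).
apply/matrixP => x y; rewrite !mxE remE index_uniq // nth_cat !size_take il.
have -> : lift ord_max y = y :> nat by rewrite lift_max.
congr (c y _); rewrite /= /bump; case: (leqP i x) => h.
  by rewrite nth_drop addSn subnKC.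
by rewrite nth_take.
Qed.

Lemma minor_parts k B : #|B| = k.+1 -> minor k.+1 (parts B) =
  \sum_(b in B) (-1) ^+ (above B b + k) * c k b * minor k (parts (B :\ b)).
Proof.
move=> cB; rewrite minor_expand ?parts_uniq ?size_parts // big_parts.
by apply: eq_bigr => b bB; rewrite index_parts // parts_rem.
Qed.

(** Choosing a subset B of size k + 1 and one of its members is the same as
  choosing the member first. *)
Lemma exchange_setD1 (H : 'I_n -> {set 'I_n} -> R) k G :
  \sum_(b in G) \sum_(B : {set 'I_n} | (B \subset G :\ b) && (#|B| == k)) H b B =
  \sum_(B : {set 'I_n} | (B \subset G) && (#|B| == k.+1)) \sum_(b in B) H b (B :\ b).
Proof.
rewrite [RHS](exchange_big_dep (mem G)) /=; last first.
  by move=> B b /andP[/subsetP BG _] /BG.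
apply: eq_bigr => b bG; rewrite (reindex_onto (fun B => B :\ b) (fun B => b |: B)); last first.
  move=> B /andP[/subsetP BG _]; rewrite setU1K //; apply/negP => /BG.
  by rewrite !inE eqxx.
apply: eq_big => [B|B _] //; apply/andP/andP => [[/andP[h1 h2] /eqP h3]|[/andP[h1 h2] bB]].
  have bB : b \in B by rewrite -h3 setU11.
  rewrite (cardsD1 b) bB add1n eqSS h2; split=> //; rewrite andbT.
  apply/subsetP => x xB; case: (eqVneq x b) => [-> //|xb].
  by have /subsetP/(_ x) := h1; rewrite !inE xb xB => /(_ isT).
rewrite setD1K // eqxx; move: h2; rewrite (cardsD1 b) bB add1n eqSS => ->.
by rewrite setSD.
Qed.

Lemma above_setD A B b : B \subset A -> above A b = (above (A :\: B) b + above B b)%N.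
Proof.
move=> BA; rewrite /above -(cardsID B) addnC; congr (_ + _)%N; apply: eq_card => x.
  by rewrite !inE; case: (x \in B); rewrite ?andbF ?andbT.
rewrite !inE; case xB: (x \in B); rewrite ?andbF ?andbT //=.
by rewrite (subsetP BA).
Qed.

(** Contractions anticommute, so the order in which the members of B are taken
  out only matters for the sign, and the sum over the orders is a determinant;
  the proof is by the Laplace expansion.  The sum of the numbers [above] is the
  sign of moving B in front of its complement. *)
Lemma contractions_det k G : contractions k G =
  \sum_(B : {set 'I_n} | (B \subset G) && (#|B| == k))
     (-1) ^+ (\sum_(b in B) above (G :\: B) b + 'C(k, 2)) * minor k (parts B) * Phi (G :\: B).
Proof.
elim: k G => [|k IH] G /=.
  rewrite (big_pred1 set0) => [|B]; last first.
    by rewrite cards_eq0 /=; case: eqP => [->|]; rewrite ?sub0set ?andbF.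
  by rewrite big_set0 setD0 /minor det_mx00 bin0n expr0 !mul1r.
under eq_bigr do rewrite IH big_distrr /=.
rewrite exchange_setD1; apply: eq_bigr => B /andP[BG /eqP cB].
rewrite minor_parts // big_distrr big_distrl /=; apply: eq_bigr => b bB.
have eB : (G :\ b) :\: (B :\ b) = G :\: B.
  by apply/setP => x; rewrite !inE; case: eqP => [->|]; rewrite ?bB ?andbF ?andbT.
rewrite eB; set s := (\sum_(b in B) _)%N; set s' := (\sum_(i in B :\ b) _)%N.
have es : s = (above (G :\: B) b + s')%N.
  rewrite /s (bigD1 b) //=; congr (_ + _)%N; apply: eq_bigl => x.
  by rewrite !inE andbC.
rewrite es (above_setD _ BG) binS bin1 !exprD.
have k2 : (-1) ^+ k * (-1) ^+ k = 1 :> R by rewrite -expr2 sqrr_sign.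
rewrite -[LHS]mul1r -[X in X * _ = _]k2; ring.
Qed.

End SetContraction.

Section CompCops.
Variables (S : idomainType) (m : nat) (N : nat -> {poly S}) (Z : {set 'I_m.+1}).
Local Notation n := m.+1.

Definition rev_coef_row (j b : nat) : {mpoly S[n]} := (rev_coef m (N (m - part Z j)) b)%:MP.

(** The members of Z whose steps have the exponents q-1, ..., 0; their number
  is the number of contractions still to come. *)
Definition topset q := [set a in Z | (m < a + q)%N].

Lemma topset0 : topset 0 = set0.
Proof. by apply/setP => a; rewrite !inE addn0 ltnNge -ltnS ltn_ord andbF. Qed.

Lemma topsetS q : (q <= m)%N ->
  topset q.+1 = if rem_exp Z q then inord (m - q) |: topset q else topset q.
Proof.
move=> qm; have am : val (inord (m - q) : 'I_n) = (m - q)%N by rewrite /= inordK // ltnS leq_subr.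
apply/setP => a; rewrite !inE (fun_if (fun B : {set 'I_n} => a \in B)) !inE.
case: (eqVneq a (inord (m - q))) => [->|na].
  by rewrite am -/(rem_exp Z q); case: ifP => _; lia.
by move: na; rewrite -val_eqE am /= if_same; case: (a \in Z) => //=; have := ltn_ord a; lia.
Qed.

Lemma topset_notin q : (q <= m)%N -> inord (m - q) \notin topset q.
Proof. by move=> qm; rewrite !inE inordK; lia. Qed.

Lemma card_topset q : (q <= m)%N -> #|topset q| = above Z (m - q).
Proof.
by move=> qm; apply: eq_card => a; rewrite !inE; case: (a \in Z) => //=; lia.
Qed.

Lemma topset_n : topset n = Z.
Proof. by apply/setP => a; rewrite inE andb_idr // => _; lia. Qed.

(** The j-th largest member a of Z has the exponent m - a, so that the row of
  its contraction is taken from N_(m-a). *)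
Lemma steps_value_contractions q A : (q <= n)%N ->
  steps_value N Z q A = (-1) ^+ (\sum_(e < q | ~~ rem_exp Z e) e)
     * contractions rev_coef_row (@PtildeX S m) #|topset q| A.
Proof.
elim: q A => [|q IH] A qn /=.
  by rewrite big_ord0 expr0 mul1r topset0 cards0.
have qm : (q <= m)%N by [].
have am : val (inord (m - q) : 'I_n) = (m - q)%N by rewrite /= inordK // ltnS leq_subr.
have eS : (\sum_(e < q.+1 | ~~ rem_exp Z e) e =
    \sum_(e < q | ~~ rem_exp Z e) e + if rem_exp Z q then 0 else q)%N.
  by rewrite big_mkcond big_ord_recr -big_mkcond /=; case: (rem_exp Z q).
rewrite eS topsetS //; case: ifP => rq /=.
  rewrite addn0 cardsU1 topset_notin // add1n /= big_distrr; apply: eq_bigr => b _.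
  have pK : part Z #|topset q| = (m - q)%N.
    by rewrite card_topset // -am -index_parts // /part nth_index ?mem_parts.
  by rewrite IH ?(ltnW qn) // /rev_coef_row pK subKn //=; ring.
by rewrite IH ?(ltnW qn) // exprD; ring.
Qed.
End CompCops.

(** * A word adapted to the two kinds of steps *)

Section Words.
Variable m : nat.
Local Notation n := m.+1.
Implicit Types (g : gen n) (b : bool).

(** The automorphism of the diagram that exchanges s_1 and s_Box. *)
Definition twist g : gen n := match g with
  | Tr i h => (if i is i'.+1 return (i.+1 < n)%N -> gen n
               then fun h => @Tr n i'.+1 h else fun h => @Box n h) h
  | Box h => @Tr n 0 h
  end.

Lemma twist_facts g : [/\ glo (twist g) = glo g, ghi (twist g) = ghi g
  & geps (twist g) = geps g (+) (glo g == ord0)].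
Proof. by case: g => [[|i] h|h]; split=> //; apply: val_inj. Qed.

Lemma flipE i b : flip m (i, b) = (i, b (+) (i == ord0)).
Proof.
by case: (eqVneq i ord0) => [->|i0]; rewrite ?flip0 ?flip_out // (addbT, addbF).
Qed.

(** The automorphism is conjugation by [flip]. *)
Lemma srefl_twist g : srefl (twist g) = (flip m * srefl g * flip m)%g.
Proof.
have [el eh ee] := twist_facts g.
have h0 : (ghi g == ord0) = false by apply/negbTE; rewrite -val_eqE /= ghi_val.
apply/permP => -[i b]; rewrite permM [X in flip m X]permM flipE.
case: (eqVneq i (glo g)) => [->|il].
  by rewrite -{1}el simple_lo eh ee simple_lo flipE h0 addbF addbA addbAC.
case: (eqVneq i (ghi g)) => [->|ih].
  by rewrite -{1}eh simple_hi el ee simple_hi flipE h0 addbF addbA.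
by rewrite !simple_out ?el ?eh // flipE -addbA addbb addbF.
Qed.

(** A power of [flip], indexed by a parity; [twist_if] is the corresponding power
  of the automorphism. *)
Definition flip_if b : {perm symb n} := if b then flip m else 1%g.
Definition twist_if b g := if b then twist g else g.

Lemma flip_ifM b b' : (flip_if b * flip_if b')%g = flip_if (b (+) b').
Proof. by case: b b' => [] []; rewrite /flip_if /= ?flipK ?mulg1 ?mul1g. Qed.

Lemma srefl_twist_if b g : srefl (twist_if b g) = (flip_if b * srefl g * flip_if b)%g.
Proof. by case: b; rewrite /= ?srefl_twist // mulg1 mul1g. Qed.

Lemma prodw_twist_if b a : prodw (map (twist_if b) a) = (flip_if b * prodw a * flip_if b)%g.
Proof.
elim: a => [|g a IH] /=; first by rewrite mulg1 flip_ifM addbb.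
by rewrite IH srefl_twist_if !mulgA -[(_ * flip_if b * flip_if b)%g]mulgA flip_ifM addbb mulg1.
Qed.

Lemma wact_flip_ifK (S : idomainType) b b' (f : {mpoly S[n]}) :
  wact (flip_if b) (wact (flip_if b') f) = wact (flip_if (b (+) b')) f.
Proof.
rewrite wact_comp ?flip_ifM 1?addbC // => p; case: b; rewrite /= ?perm1 //.
exact: flip_bar.
Qed.

Lemma ddiff'_twist_if (S : idomainType) b g (f : {mpoly S[n]}) :
  ddiff' (twist_if b g) f = wact (flip_if b) (ddiff' g (wact (flip_if b) f)).
Proof.
have fb p : flip_if b (bar p) = bar (flip_if b p).
  by case: b; rewrite /= ?perm1 //; exact: flip_bar.
apply: ddiff'_unique; have -> : root' S (twist_if b g) = wact (flip_if b) (root' S g).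
  case: b {fb} => /=; last by rewrite wact1g.
  have [el eh ee] := twist_facts g.
  rewrite !root'E rmorphB /= wactZ !wactX el eh ee !flipE.
  have -> : (ghi g == ord0) = false by apply/negbTE; rewrite -val_eqE /= ghi_val.
  by rewrite /= expr0 scale1r scalerA -signr_addb.
have E := congr1 (wact (flip_if b)) (ddiff'P g (wact (flip_if b) f)).
have {E} -> := etrans (esym (rmorphM (wact (flip_if b)) _ _))
  (etrans E (rmorphB (wact (flip_if b)) _ _)).
rewrite /= wact_flip_ifK addbb wact1g; congr (_ - _).
have e1 : wact (srefl g) (wact (flip_if b) f) = wact (flip_if b * srefl g)%g f.
  by apply: wact_comp; exact: simple_bar.
by rewrite e1 (wact_comp _ _ fb) srefl_twist_if.
Qed.

Lemma ddiffw_twist_if (S : idomainType) b a (f : {mpoly S[n]}) :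
  ddiffw (map (twist_if b) a) f = wact (flip_if b) (ddiffw a (wact (flip_if b) f)).
Proof.
elim: a => [|g a IH]; first by rewrite /= wact_flip_ifK addbb wact1g.
rewrite /= -/(ddiffw _ _) IH ddiff'_twist_if wact_flip_ifK addbb wact1g //.
Qed.

Lemma prodw_tr_word i (h : (i.+1 < n)%N) : prodw (tr_word m i) = srefl (Tr h).
Proof. by rewrite (tr_wordE h) /= mul1g. Qed.

(** The permutation of the positions effected by a run. *)
Definition shift j d i := if i == j then (j + d)%N
  else if (j < i <= j + d)%N then i.-1 else i.

Lemma prodw_run j d (i : 'I_n) b : (j + d < n)%N ->
  prodw (run j d) (i, b) = (inord (shift j d i), b).
Proof.
elim: d j i b => [|d IH] j i b jd.
  rewrite /= perm1 /shift addn0; congr (_, _); apply: val_inj.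
  rewrite /= inordK; first by case: eqP => [->|] //; case: ifP => //; lia.
  by case: eqP => [<-|_] //; case: ifP => // _; apply: leq_ltn_trans (ltn_ord i); lia.
have h : (j.+1 < n)%N by lia.
rewrite [run _ _]/= prodw_cat permM (prodw_tr_word h) /=.
have hin := ltn_ord i.
case: (eqVneq i (lo h)) => [->|il].
  rewrite (@simple_lo _ (Tr h)) addbF IH; last by lia.
  by rewrite /shift /= !eqxx addSnnS.
case: (eqVneq i (hi h)) => [->|ih].
  rewrite (@simple_hi _ (Tr h)) addbF IH; last by lia.
  by rewrite /shift /=; congr (inord _, _); do !case: ifP => //; lia.
rewrite simple_out // IH; last by lia.
move: il ih; rewrite -!val_eqE /= /shift => il ih; congr (inord _, _).
by do !case: ifP => //; lia.
Qed.

Variable Z : {set 'I_n}.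

(** The number of factors [flip] among the steps. *)
Definition nremoved q := (\sum_(e < q) rem_exp Z e)%N.

(** The factors [flip] of the steps are moved to one side, twisting the letters
  that they pass; [b] is the parity of those that wait to be absorbed. *)
Fixpoint word q b : seq (gen n) := if q is q'.+1 then
    if rem_exp Z q' then word q' (~~ b) ++ map (twist_if (~~ b)) (run 0 m)
    else word q' b ++ map (twist_if b) (run 0 q')
  else [::].

(** The product of the steps themselves, with the factors [flip]. *)
Fixpoint word_perm q : {perm symb n} := if q is q'.+1 then
    if rem_exp Z q' then (flip m * prodw (run 0 m) * word_perm q')%g
    else (prodw (run 0 q') * word_perm q')%g
  else 1%g.

Lemma nremovedS q : nremoved q.+1 = (nremoved q + rem_exp Z q)%N.
Proof. by rewrite /nremoved big_ord_recr. Qed.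

Lemma nremoved_le q : (nremoved q <= q)%N.
Proof.
elim: q => [|q IH]; first by rewrite /nremoved big_ord0.
by rewrite nremovedS; case: rem_exp; lia.
Qed.

Lemma prodw_word q b :
  prodw (word q b) = (flip_if b * word_perm q * flip_if (b (+) odd (nremoved q)))%g.
Proof.
elim: q b => [|q IH] b /=; first by rewrite /nremoved big_ord0 mulg1 addbF flip_ifM addbb.
rewrite nremovedS; case: ifP => rq; rewrite prodw_cat IH prodw_twist_if ?addn0 ?addn1 /=.
  rewrite !mulgA -[(_ * flip_if _ * flip_if _)%g]mulgA flip_ifM addbb mulg1.
  have -> : flip_if (~~ b) = (flip_if b * flip m)%g.
    by rewrite -[flip m]/(flip_if true) flip_ifM addbT.
  by rewrite addbN addNb ?mulgA.
by rewrite !mulgA -[(_ * flip_if _ * flip_if _)%g]mulgA flip_ifM addbb mulg1.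
Qed.

Lemma ddiffw_word (S : idomainType) q b (f : {mpoly S[n]}) :
  ddiffw (word q b) f = wact (flip_if (b (+) odd (nremoved q))) (steps Z q (wact (flip_if b) f)).
Proof.
elim: q b f => [|q IH] b f /=.
  by rewrite /nremoved big_ord0 addbF wact_flip_ifK addbb wact1g.
rewrite nremovedS; case: ifP => rq; rewrite ddiffw_cat IH ddiffw_twist_if wact_flip_ifK addbb wact1g.
  rewrite addn1 /= addbN -addNb; congr (wact _ (steps _ _ (ddiffw _ _))).
  by rewrite -[flip m]/(flip_if true) wact_flip_ifK addTb.
by rewrite addn0.
Qed.

(** A step sends the first position to its final place and moves the other
  positions down; so a position i is reached by the step of exponent q-1-i, and
  the later steps only count how many removals are still to come. *)
Lemma word_permE q (i : 'I_n) b : (q <= n)%N -> word_perm q (i, b) =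
  if (i < q)%N then let e := (q.-1 - i)%N in
    if rem_exp Z e then (inord (m - nremoved e), ~~ b) else (inord (e - nremoved e), b)
  else (inord (i - nremoved q), b).
Proof.
elim: q i b => [|q IH] i b qn.
  by rewrite /= perm1 /nremoved big_ord0 subn0 inord_val.
have nq := nremoved_le q; have hin := ltn_ord i.
rewrite [word_perm _]/= nremovedS [LHS](_ : _ =
  if rem_exp Z q then word_perm q (inord (shift 0 m i), b (+) (i == ord0))
  else word_perm q (inord (shift 0 q i), b)); last first.
  by case: ifP => rq; rewrite ?permM ?flipE prodw_run.
have sm : (shift 0 m i < n)%N by rewrite /shift; do !case: ifP => //; lia.
have sq : (shift 0 q i < n)%N by rewrite /shift; do !case: ifP => //; lia.
rewrite !IH ?(ltnW qn) // !inordK //.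
have i0E : (i == ord0) = (i == 0%N :> nat) by [].
rewrite i0E /shift !add0n; case: (posnP i) => [i0|ip].
  rewrite i0 /= subn0 ltnn ltnNge -ltnS qn /=.
  by case: ifP => rq; rewrite ?addbT.
rewrite addbF /=; have -> : (i <= m)%N by [].
case: (ltnP i q.+1) => iq.
  have -> : (i <= q)%N by lia.
  have -> : (i.-1 < q)%N by lia.
  have e : (q.-1 - i.-1 = q - i)%N by lia.
  by rewrite /= e if_same.
have -> : (i <= q)%N = false by lia.
have -> : (i.-1 < q)%N = false by lia.
have -> : (i < q)%N = false by lia.
by case: ifP => rq; congr (inord _, _); lia.
Qed.

End Words.

(** * The maximal Grassmannian element *)

Section Grassmannian.
Variable m : nat.
Local Notation n := m.+1.
Implicit Types (A : {set 'I_n}) (i : 'I_n).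

Lemma card_above i : #|[set a : 'I_n | (i < a)%N]| = (m - i)%N.
Proof.
rewrite -sum1_card (eq_bigl (fun a : 'I_n => (i < a)%N)); last by move=> a; rewrite inE.
rewrite -(big_mkord (fun a => (i < a)%N) (fun=> 1%N)) sum1_count /index_iota subn0.
have hi := ltn_ord i.
have -> : iota 0 n = iota 0 (i.+1 + (m - i)) by congr iota; lia.
rewrite iotaD count_cat.
rewrite (@eq_in_count _ _ pred0) ?count_pred0; last first.
  by move=> a; rewrite mem_iota /=; lia.
rewrite (@eq_in_count _ _ predT) ?count_predT ?size_iota // => a.
by rewrite mem_iota /=; lia.
Qed.

Variable lam : {set 'I_n}.
Hypothesis lam_strict : lam \in strict n.

Lemma lam_pos i : i \in lam -> (0 < i)%N.
Proof. by move: lam_strict; rewrite inE => /forall_inP; apply. Qed.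

Lemma above_dual i : (above lam i + above (dualp lam) i = m - i)%N.
Proof.
rewrite -card_above -(cardsID lam [set a : 'I_n | _]); congr (_ + _)%N; apply: eq_card => a.
  by rewrite !inE andbC.
by rewrite !inE; case: (a \in lam); rewrite ?andbF //=; lia.
Qed.

Lemma card_dual : (#|lam| + #|dualp lam| = m)%N.
Proof.
transitivity (above lam (ord0 : 'I_n) + above (dualp lam) (ord0 : 'I_n))%N.
  2: by rewrite above_dual subn0.
congr (_ + _)%N; apply: eq_card => a; rewrite !inE.
  by case: (boolP (a \in lam)) => //= /lam_pos ->.
by case: (a \in lam); rewrite /= ?andbF // !andbT andbb.
Qed.

Lemma part_above A i : i \in A -> part A (above A i) = i.
Proof. by move=> iA; rewrite -index_parts // /part nth_index ?mem_parts. Qed.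

Lemma above_lt A i : i \in A -> (above A i < #|A|)%N.
Proof. by move=> iA; rewrite -index_parts // -size_parts index_mem mem_parts. Qed.

Lemma wmax_seq_lam i : i \in lam -> (wmax_seq lam)`_(above lam i) = - i.+1%:Z.
Proof.
move=> il; rewrite /wmax_seq nth_cat size_map size_parts above_lt //.
by rewrite (nth_map 0%N) ?size_parts ?above_lt // -/(part _ _) part_above.
Qed.

Lemma wmax_seq_mid : (wmax_seq lam)`_#|lam| = (-1) ^+ #|lam|.
Proof. by rewrite /wmax_seq nth_cat size_map size_parts ltnn subnn. Qed.

(** The last block lists the complement in increasing order, so a member is
  found by counting the larger ones from the end. *)
Lemma wmax_seq_dual i : i \in dualp lam ->
  (wmax_seq lam)`_(m - above (dualp lam) i) = i.+1%:Z.
Proof.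
move=> il; have cd := card_dual; have al := above_lt il.
have E : [seq p <- iota 1 n | p \notin 1%N :: [seq q.+1 | q <- parts lam]] =
    [seq q.+1 | q <- rev (parts (dualp lam))].
  apply: (irr_sorted_eq ltn_trans ltnn).
  - by apply: sorted_filter; [exact: ltn_trans | exact: iota_ltn_sorted].
  - rewrite sorted_map rev_sorted; apply: sub_sorted (parts_sorted _) => x y /=.
    by rewrite ltnS.
  move=> p; rewrite mem_filter mem_iota; apply/andP/mapP => [[pn ph]|[q]].
    have p1 : (p.-1 < n)%N by lia.
    exists p.-1; last by lia.
    rewrite mem_rev -[p.-1]/(val (Ordinal p1)) mem_parts inE /=.
    move: pn; rewrite inE negb_or => /andP[pn1 pn2]; apply/andP; split; first by lia.
    apply: contra pn2 => h; apply/mapP; exists p.-1; last by lia.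
    by rewrite -[p.-1]/(val (Ordinal p1)) mem_parts.
  rewrite mem_rev => /mem_partsP[a]; rewrite inE => /andP[a0 al'] -> ->.
  split; last by have := ltn_ord a; lia.
  rewrite inE negb_or; apply/andP; split; first by lia.
  by apply: contra al' => /mapP[b bl [e]]; rewrite -mem_parts /= e.
rewrite /wmax_seq nth_cat size_map size_parts ifF; last by lia.
have -> : (m - above (dualp lam) i - #|lam| = (#|dualp lam| - (above (dualp lam) i).+1).+1)%N.
  by lia.
have hs : (#|dualp lam| - (above (dualp lam) i).+1 < size (rev (parts (dualp lam))))%N.
  by rewrite size_rev size_parts; lia.
rewrite E -map_comp /= (nth_map 0%N _ _ hs) nth_rev ?size_parts; last by lia.
by rewrite (_ : (_ - _.+1 = above (dualp lam) i)%N) -?/(part _ _) ?part_above //; lia.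
Qed.

(** The parts of the dual partition, and 0 whenever this is needed to make the
  number of removals even. *)
Definition removed : {set 'I_n} :=
  if odd n == odd #|lam| then ord0 |: dualp lam else dualp lam.

Lemma in_removed i : (i \in removed) =
  if i == ord0 then odd n == odd #|lam| else i \in dualp lam.
Proof.
rewrite /removed; case: ifP => h; rewrite ?inE; case: eqP => //= ->; rewrite ?inE //.
Qed.

Lemma above_removed b : above removed b = above (dualp lam) b.
Proof.
apply: eq_card => a; rewrite !inE in_removed; case: eqP => [->|_]; rewrite ?andbF //.
by rewrite inE.
Qed.

Lemma card_removed : #|removed| =
  if odd n == odd #|lam| then (n - #|lam|)%N else (n - #|lam| - 1)%N.
Proof.
have cd := card_dual; rewrite /removed; case: ifP => _; last by lia.
have z : ord0 \notin dualp lam by rewrite inE.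
by rewrite cardsU1 z; lia.
Qed.

(** An even number of factors [flip] cancels, which is why the product of the
  steps lies in the group of type D. *)
Lemma odd_removed : ~~ odd #|removed|.
Proof.
have lm : (#|lam| <= m)%N by have := card_dual; lia.
rewrite card_removed -subnDA addn1 subSS; case: ifP; rewrite oddB ?(leqW lm) ?lm //=.
  by move/eqP <-; rewrite addbb.
by case: (odd m) (odd #|lam|) => [] [].
Qed.

Lemma nremoved_topset q : (q <= n)%N -> nremoved removed q = #|topset removed q|.
Proof.
elim: q => [|q IH] qn; first by rewrite /nremoved big_ord0 topset0 cards0.
rewrite nremovedS IH ?(ltnW qn) // topsetS //; case: ifP => _; last by rewrite addn0.
by rewrite cardsU1 topset_notin // addnC.
Qed.

Lemma nremoved_n : nremoved removed n = #|removed|.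
Proof.
by rewrite nremoved_topset // topset_n.
Qed.

(** Comparison of one-line notations: the parts of lam stay unbarred and reach
  the barred entries of w_lam, those of the dual partition are barred and reach
  the unbarred entries, and the middle entry accounts for the parity. *)
Lemma word_perm_wmax : (word_perm removed n * wmax lam)%g = longest n.
Proof.
have [wD wE] := wmaxP (ltn0Sn m) lam_strict; have [lD lE] := longestP n.
have cd := card_dual.
have pb p : word_perm removed n (bar p) = bar (word_perm removed n p).
  have := prodw_word removed n false; rewrite nremoved_n addFb (negbTE odd_removed).
  by rewrite mulg1 mul1g => <-; exact: prodw_bar.
have wnth j (jn : (j < n)%N) : symb_val (wmax lam (inord j, false)) = (wmax_seq lam)`_j.
  by rewrite -nth_oneline wE inordK.
suff main i : (word_perm removed n * wmax lam)%g (i, false) = longest n (i, false).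
  apply/permP => -[i []]; last exact: main.
  have -> : (i, true) = bar (i, false) by [].
  by rewrite permM pb !(weylD_bar _ wD) !(weylD_bar _ lD) -permM main.
have hin := ltn_ord i.
apply: symb_val_inj; rewrite -[RHS]nth_oneline lE (nth_map 0%N) ?size_iota // nth_iota //.
rewrite permM word_permE // hin /=.
have nm : nremoved removed (m - i) = above (dualp lam) i.
  rewrite nremoved_topset; last by lia.
  by rewrite card_topset ?leq_subr // subKn ?above_removed // -ltnS.
have im : (i <= m)%N by rewrite -ltnS.
rewrite nm /rem_exp (subKn im) inord_val in_removed.
have ad := above_dual i; have i0E : (i == ord0) = (i == 0%N :> nat) by [].
have ad0 : above (dualp lam) (ord0 : 'I_n) = #|dualp lam|.
  by apply: eq_card => a; rewrite !inE; case: (0 < a)%N; rewrite ?andbT ?andbF.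
have negw j : symb_val (wmax lam (j, true)) = - symb_val (wmax lam (j, false)).
  by rewrite -[(j, true)]/(bar (j, false)) (weylD_bar _ wD) symb_val_bar.
case: (eqVneq i ord0) => [ei|ni].
  rewrite ei ad0 subn0; case: ifP => par.
    rewrite negw wnth; last by lia.
    rewrite (_ : m - _ = #|lam|)%N ?wmax_seq_mid; last by lia.
    move/eqP: par; rewrite -signr_odd => <-.
    by rewrite /=; case: (odd m); rewrite ?expr1 ?expr0 ?opprK.
  rewrite wnth; last by lia.
  rewrite (_ : m - _ = #|lam|)%N ?wmax_seq_mid; last by lia.
  move: par; rewrite -signr_odd /=.
  by case: (odd m) (odd #|lam|) => [] []; rewrite ?expr1 ?expr0.
have ip : (0 < i)%N by rewrite lt0n; exact: ni.
have -> : ((1 + i)%N == 1%N) && odd n = false by rewrite add1n eqSS (gtn_eqF ip).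
rewrite add1n.
case: ifP => id.
  by rewrite negw wnth ?wmax_seq_dual //; lia.
have il : i \in lam by move: id; rewrite inE ip /= => /negbFE.
rewrite wnth; last by lia.
by rewrite (_ : m - i - _ = above lam i)%N ?wmax_seq_lam //; lia.
Qed.

End Grassmannian.

(** * Counting lemmas, signs and determinants *)

Lemma nth_sorted_gt (s : seq nat) b i : sorted gtn s ->
  (b < nth 0 s i)%N = (i < count (fun y => b < y) s)%N.
Proof.
elim: s i => [|y s IH] i /=; first by rewrite nth_nil.
rewrite (path_sortedE gtn_trans) => /andP[/allP ys ss].
case: (ltnP b y) => hb; first by case: i => [|i] //=; rewrite IH.
have c0 : count (fun y => b < y)%N s = 0%N.
  apply/eqP; rewrite -leqn0 leqNgt -has_count; apply/hasPn => z /ys /=.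
  by rewrite -leqNgt => h; apply: leq_trans (ltnW h) hb.
by rewrite c0; case: i => [|i] /=; rewrite ?ltnNge ?hb // leqNgt IH // c0.
Qed.

(** The Galois connection between parts and counting functions, which reduces
  inequalities of parts to cardinalities. *)
Lemma part_gt n (A : {set 'I_n}) b i : (b < part A i)%N = (i < above A b)%N.
Proof.
rewrite /part nth_sorted_gt ?parts_sorted // /above -sum1_count -sum1_card; congr (_ < _)%N.
rewrite big_mkcond (big_parts A (fun p => if (b < p)%N then 1 else 0)%N).
by rewrite -big_mkcondr; apply: eq_bigl => x; rewrite inE.
Qed.

(** A term b lies in the i-th interval exactly when i parts of A exceed it:
  the statistic of the formula is the sign exponent of [contractions_det]. *)
Lemma fpairE n (A B : {set 'I_n}) : fpair A B = (\sum_(b in B) above A b)%N.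
Proof.
transitivity (\sum_(i < #|A|) \sum_(b in B | (part A i.+1 <= b < part A i)%N) i.+1)%N.
  have key t (P : pred 'I_n) : (t * #|[set b in B | P b]| = \sum_(b in B | P b) t)%N.
    by rewrite -sum1_card big_distrr; apply: eq_big => [b|b _]; rewrite ?inE /= ?muln1.
  by apply: eq_bigr => i _; exact: key.
rewrite (exchange_big_dep (mem B)) /= => [|i b _ /andP[] //].
apply: eq_bigr => b bB.
rewrite (eq_bigl (fun i : 'I_#|A| => i.+1 == above A b)); last first.
  by move=> i; rewrite bB /= leqNgt !part_gt; lia.
case e : (above A b) => [|t]; first by rewrite big1.
have tA : (t < #|A|)%N by rewrite -e /above subset_leq_card //; apply/subsetP => x; rewrite inE => /andP[].
by rewrite (big_pred1 (Ordinal tA)) // => i; rewrite eqSS.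
Qed.

Lemma size_lt_path (s : seq nat) x : path gtn x s -> all (leq 1) s -> (0 < x)%N ->
  (size s < x)%N.
Proof.
elim: s x => //= y s IH x /andP[yx ps] /andP[y0 as_] x0.
exact: leq_ltn_trans (IH y ps as_ y0) yx.
Qed.

(** The parts of a strict partition dominate the staircase; hence the
  truncated subtraction in [epart] is exact. *)
Lemma bin2_le_sum (s : seq nat) : sorted gtn s -> all (leq 1) s ->
  ('C((size s).+1, 2) <= \sum_(p <- s) p)%N.
Proof.
elim: s => [|x s IH]; first by rewrite big_nil.
move=> /= ps /andP[x0 as_]; rewrite big_cons binS bin1 addnC.
by rewrite leq_add ?size_lt_path // IH // (path_sorted ps).
Qed.

Lemma bin2_add a b : 'C(a + b, 2) = ('C(a, 2) + 'C(b, 2) + a * b)%N.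
Proof.
elim: a => [|a IH]; first by rewrite !addn0.
by rewrite addSn !binS !bin1 IH mulSn; lia.
Qed.

(** A block of zeros with k - i0 rows and i0 + 1 columns meets every
  permutation. *)
Lemma det_low_block (R : comNzRingType) k (M : 'M[R]_k) (i0 : 'I_k) :
  (forall i j : 'I_k, (i0 <= i)%N -> (j <= i0)%N -> M i j = 0) -> \det M = 0.
Proof.
move=> M0; rewrite /determinant big1 // => s _.
suff [i /andP[h1 h2]] : exists i : 'I_k, (i0 <= i)%N && (s i <= i0)%N.
  by rewrite (bigD1 i) //= M0 // mul0r mulr0.
case: (boolP [exists i : 'I_k, (i0 <= i)%N && (s i <= i0)%N]) => [/existsP[i hi]|/existsPn h].
  by exists i.
pose B := [set i : 'I_k | (i0 < i)%N].
have sub : s @: (i0 |: B) \subset B.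
  apply/subsetP => y /imsetP[x xB ->]; have hx : (i0 <= x)%N.
    by move: xB; rewrite !inE => /orP[/eqP ->|/ltnW].
  by have := h x; rewrite hx /= -ltnNge in_set.
have := subset_leq_card sub; rewrite card_imset; last exact: perm_inj.
by rewrite cardsU1 inE ltnn add1n ltnn.
Qed.

Lemma det_sign (R : comNzRingType) k (M : 'M[R]_k) (r c : 'I_k -> nat) :
  \det (\matrix_(i, j) ((-1) ^+ (r i + c j) * M i j)) =
  (-1) ^+ (\sum_i r i + \sum_i c i) * \det M.
Proof.
rewrite /determinant big_distrr /=; apply: eq_bigr => s _.
rewrite mulrCA; congr (_ * _); under eq_bigr do rewrite mxE exprD.
rewrite !big_split /= exprD !expr_sum; congr (_ * _ * _).
by rewrite [RHS](reindex_inj (@perm_inj _ s)).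
Qed.

(** Vieta's formula, with an integer index so that it holds in all degrees. *)
Lemma coef_prod_elsym (R : comUnitRingType) (v : seq R) (t : nat) :
  (\prod_(y <- v) ('X - y%:P))`_t =
  (-1) ^+ (size v + t) * elsym v ((size v)%:Z - t%:Z).
Proof.
elim: v t => [|y v IH] t.
  rewrite big_nil coef1 /= add0n; case: t => [|t] /=; first by rewrite elsym0 mulr1.
  by rewrite mulr0.
rewrite big_cons mulrBl coefB coefXM coefCM elsym_cons /=.
case: t => [|t] /=.
  have e1 : elsym v ((size v).+1%:Z - 0%:Z) = 0.
    by rewrite (_ : _ - _ = (size v).+1%:Z); [exact: elsym_large | lia].
  rewrite IH !addn0 e1 add0r (_ : _ - _ - 1 = (size v)%:Z - 0%:Z); last by lia.
  by rewrite exprS; ring.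
rewrite !IH (_ : (size v).+1%:Z - t.+1%:Z = (size v)%:Z - t%:Z); last by lia.
rewrite (_ : _ - t%:Z - 1 = (size v)%:Z - t.+1%:Z); last by lia.
by rewrite addSn !addnS !exprS; ring.
Qed.

Lemma leq_part n (A : {set 'I_n}) i j : (i <= j)%N -> (part A j <= part A i)%N.
Proof.
move=> ij; rewrite leqNgt part_gt; apply/negP => h.
by have := leq_ltn_trans ij h; rewrite -part_gt ltnn.
Qed.

Lemma eq_above_part n (A B : {set 'I_n}) i : (forall b, above A b = above B b) ->
  part A i = part B i.
Proof.
move=> e; apply/eqP; rewrite eqn_leq.
have h b : (b < part A i)%N = (b < part B i)%N.
  by rewrite (part_gt A b i) (part_gt B b i) (e b).
by rewrite leqNgt (h (part B i)) ltnn leqNgt -(h (part A i)) ltnn.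
Qed.

Lemma mul_bin2 j : (2 * 'C(j, 2) = j * j.-1)%N.
Proof. by rewrite -mul_bin_diag bin1. Qed.
Lemma sum_part n (A : {set 'I_n}) : (\sum_(i < #|A|) part A i = weight A)%N.
Proof. by rewrite /weight -(big_parts A id) (big_nth 0%N) size_parts big_mkord. Qed.

(** * Nonvanishing, and the theorem *)

Section NonVanishing.
Variables (S : idomainType) (m : nat).
Local Notation n := m.+1.
Local Notation MP := {mpoly S[n]}.
Hypothesis u2 : (2 : MP) \is a GRing.unit.

Lemma rev_coef_Xn a b : (a <= m)%N -> rev_coef m ('X^(m - a) : {poly S}) b = (a == b)%:R.
Proof.
move=> am; rewrite /rev_coef; case: (leqP b m) => bm; last by rewrite (ltn_eqF (leq_ltn_trans am bm)).
by rewrite coefXn; congr (_%:R); lia.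
Qed.

(** By induction: the step [flip_step_PtildeX] with the power of x that singles out
  one part b leaves a sign times the polynomial without b, which is nonzero. *)
Lemma PtildeX_neq0 (A : {set 'I_n}) : PtildeX S A != 0.
Proof.
have [N] := ubnP #|A :\ ord0|; elim: N A => // N IH A hN.
case: (set_0Vmem (A :\ ord0)) => [A0|[b bA]].
  rewrite PtildeXE A0 cards0 expr0 invr1 mul1r /parts enum_set0 /= QtildeE /= addr0.
  exact: oner_neq0.
have /setD1P[b0 bA'] := bA; have bm : (b <= m)%N by rewrite -ltnS.
have b0' : (0 < b)%N by rewrite lt0n; exact: b0.
have lt : (#|A :\ b :\ ord0| < N)%N.
  rewrite -ltnS; apply: leq_trans hN; rewrite ltnS [X in (_ < X)%N](cardsD1 b) bA add1n ltnS.
  by apply: subset_leq_card; apply/subsetP => x; rewrite !inE andbCA.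
apply: contra_neq (IH _ lt) => PA0.
have := @flip_step_PtildeX S m u2 'X^(m - b) A.
rewrite size_polyXn ltnS leq_subr coefXn => /(_ isT).
rewrite (_ : (m == m - b)%N = false) ?eqxx ?orbT; last by lia.
move=> /(_ isT); rewrite PA0 mulr0 rmorph0 ddiffw0 (bigD1 b) //= big1 => [|x /andP[_ xb]].
  rewrite addr0 rev_coef_Xn // eqxx mpolyC1 mulr1 => /esym/eqP.
  by rewrite mulf_eq0 signr_eq0 => /eqP.
rewrite rev_coef_Xn // eq_sym (negbTE (xb : (x : nat) != b)) mpolyC0 mulr0 mul0r.
by [].
Qed.

(** With powers of x for the rows, each contraction is forced to remove the
  corresponding member of Z, so nothing but a sign and [PtildeX] remains. *)
Lemma contractions_neq0 (Z G : {set 'I_n}) k : (k <= #|Z|)%N -> Z \subset G ->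
  contractions (rev_coef_row (fun d => 'X^d : {poly S}) Z) (@PtildeX S m) k G != 0.
Proof.
move=> kZ ZG; have {ZG} : forall i, (i < k)%N -> exists2 a, a \in G & part Z i = a :> nat.
  move=> i ik; have : part Z i \in parts Z by rewrite mem_nth // size_parts; lia.
  by case/mem_partsP => a aZ e; exists a => //; apply: (subsetP ZG).
elim: k G kZ => [|k IH] G kZ hG /=; first exact: PtildeX_neq0.
have [a aG ea] := hG k (ltnSn k).
have am : (a <= m)%N by rewrite -ltnS.
rewrite (bigD1 a) //= big1 ?addr0 => [|b /andP[_ ba]]; last first.
  rewrite /rev_coef_row rev_coef_Xn ea // eq_sym (negbTE (ba : (b : nat) != a)) mpolyC0.
  by rewrite mulr0 mul0r.
rewrite /rev_coef_row ea rev_coef_Xn // eqxx mpolyC1 mulr1 mulf_neq0 ?signr_eq0 //.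
apply: IH => [|i ik]; first exact: ltnW.
have [b bG eb] := hG i (ltnW ik); exists b => //; rewrite !inE bG andbT.
apply/eqP => ba; have : part Z i = part Z k by rewrite eb ba ea.
move/eqP; rewrite /part nth_uniq ?parts_uniq ?size_parts ?(ltn_eqF ik) //; lia.
Qed.

End NonVanishing.

Lemma strictE n (A : {set 'I_n.+1}) : (A \in strict n.+1) = (ord0 \notin A).
Proof.
rewrite inE; apply/forall_inP/negP => [h /h //|h i iA].
by rewrite lt0n; apply/negP => /eqP i0; apply: h; rewrite (_ : ord0 = i) //; apply: val_inj.
Qed.

(** The substitution alpha = gamma minus beta.  A subset beta of the parts of
  gamma and 0 may contain 0, while alpha and gamma do not. *)
Lemma exchange_setD (R : nmodType) n k (H : {set 'I_n.+1} -> {set 'I_n.+1} -> R) :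
  \sum_(ga in strict n.+1) \sum_(be : {set 'I_n.+1} | (be \subset ord0 |: ga) && (#|be| == k))
     H (ga :\: be) be =
  \sum_(al in strict n.+1) \sum_(be : {set 'I_n.+1} | (#|be| == k) && (al :&: be == set0)) H al be.
Proof.
rewrite (exchange_big_dep (fun be : {set 'I_n.+1} => #|be| == k)) /=; last first.
  by move=> ga be _ /andP[].
rewrite [RHS](exchange_big_dep (fun be : {set 'I_n.+1} => #|be| == k)) /=; last first.
  by move=> ga be _ /andP[].
apply: eq_bigr => be /eqP cb.
rewrite [RHS](reindex_onto (fun ga => ga :\: be) (fun al => (al :|: be) :\ ord0)); last first.
  move=> al /andP[sal /andP[_ /eqP d]]; apply/setP => x; rewrite !inE.
  have := congr1 (fun A : {set 'I_n.+1} => x \in A) d; rewrite !inE.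
  case: (eqVneq x ord0) => [->|_] /=; last by case: (x \in al); case: (x \in be).
  by move: sal; rewrite strictE => /negbTE ->; rewrite andbF.
apply: eq_bigl => ga; rewrite cb eqxx andbT /= !strictE.
have -> : (ga :\: be) :&: be == set0.
  by rewrite -subset0; apply/subsetP => x; rewrite !inE; case: (x \in be); rewrite ?andbF.
rewrite andbT; apply/andP/andP => [[h1 /subsetP h2]|[h1 /eqP h2]].
  split; first by rewrite inE (negbTE h1) andbF.
  apply/eqP/setP => x; rewrite !inE; case: (eqVneq x ord0) => [->|x0] /=.
    by rewrite (negbTE h1).
  case xb: (x \in be) => //=; rewrite ?orbT ?orbF //.
  by have := h2 x xb; rewrite !inE (negbTE x0).
rewrite -h2 !inE eqxx; split=> //; apply/subsetP => x xb.
by rewrite !inE xb orbT andbT; case: (x == ord0).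
Qed.

Section DoubleSchubert.
Variable m : nat.
Local Notation n := m.+1.
Local Notation S := {mpoly dyadic[n]}.
Local Notation MP := {mpoly S[n]}.

Let u2 : (2 : MP) \is a GRing.unit := ZYX_unit2 n.

Definition Yvars : seq S := [seq 'X_i | i <- enum 'I_n].

(** The factors of Delta at a single variable x, see [Delta_stair]. *)
Definition Yprod d : {poly S} := \prod_(y <- take d Yvars) ('X - y%:P).

Lemma size_Yvars : size Yvars = n. Proof. by rewrite size_map size_enum_ord. Qed.

Lemma size_Yprod d : (size (Yprod d) <= d.+1)%N.
Proof.
by rewrite size_prod_XsubC ltnS size_take; case: ltnP.
Qed.

Lemma lead_Yprod d : (d <= m)%N -> (Yprod d)`_d = 1.
Proof.
move=> dm; rewrite coef_prod_elsym size_take size_Yvars ltnS dm -signr_odd addnn odd_double.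
by rewrite subrr elsym0 mulr1.
Qed.

Lemma Delta_stair : Delta n = stair m Yprod n.
Proof.
rewrite /Delta /stair big_mkord; apply: eq_bigr => i _.
rewrite /Yprod /ev rmorph_prod horner_prod inord_val.
rewrite [RHS](big_nth 0) size_take size_Yvars (_ : (if _ then _ else _) = (m - i)%N); last by case: ltnP; lia.
rewrite big_mkord (big_ord_widen n (fun j =>
  (map_poly (@mpolyC n S) ('X - (nth 0 (take (m - i) Yvars) j)%:P)).['X_i])); last by lia.
apply: eq_big => j; first by lia.
move=> hj; rewrite rmorphB /= map_polyX map_polyC /= hornerXsubC nth_take; last by lia.
by rewrite /Yvars (nth_map ord0) ?size_enum_ord // nth_ord_enum.
Qed.

Lemma wact_PtildeY w l : wact w (Ptilde (Y n) l) = Ptilde (Y n) l.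
Proof.
have e : map (wact w) (Y n) = Y n.
  by rewrite -map_comp; apply: eq_map => i; exact: wactC.
by have := Ptilde_map (wact w) (Y n) l u2; rewrite e.
Qed.

(** The generic list of variables is the one of the Schubert polynomials. *)
Lemma PtildeXn (A : {set 'I_n}) : PtildeX _ A = Ptilde (X n) (parts (A :\ ord0)) :> MP.
Proof. by []. Qed.

(** What [contractions_det] yields for a subset beta, in terms of the disjoint pair
  alpha, beta. *)
Lemma schubert_term (ga be : {set 'I_n}) : ga \in strict n -> be \subset ord0 |: ga ->
  [/\ PtildeX _ ((ord0 |: ga) :\: be) = Ptilde (X n) (parts (ga :\: be)) :> MP,
      dualp ga = dualp (ga :\: be :|: be) &
      \sum_(b in be) above ((ord0 |: ga) :\: be) b = fpair (ga :\: be) be]%N.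
Proof.
rewrite strictE => g0 /subsetP sub.
split.
- rewrite PtildeXn; congr (Ptilde _ (parts _)); apply/setP => a; rewrite !inE.
  by case: eqP => [->|_] //=; rewrite (negbTE g0) andbF.
- apply/setP => a; rewrite !inE; case: posnP => //= a0; congr negb.
  case ab: (a \in be) => /=; rewrite ?orbF ?orbT //.
  by have := sub _ ab; rewrite !inE => /orP[/eqP e|//]; rewrite e in a0.
- rewrite fpairE; apply: eq_bigr => b _; apply: eq_card => a; rewrite !inE.
  by case: (eqVneq a ord0) => [->|] //; rewrite ltn0 !andbF.
Qed.

Variable lam : {set 'I_n}.
Local Notation Z := (removed lam).
Local Notation lam' := (dualp lam).
Local Notation k := #|Z|.

Definition entry (be : {set 'I_n}) (i j : nat) : MP :=
  elsym (take (m - part lam' j) (Y n)) ((part be i)%:Z - (part lam' j)%:Z).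

Lemma part_removed j : part Z j = part lam' j.
Proof. by apply: eq_above_part => b; exact: above_removed. Qed.

Lemma weight_removed : weight Z = weight lam'.
Proof.
rewrite /weight /removed; case: ifP => // _.
have z : ord0 \notin lam' by rewrite inE.
by rewrite big_setU1.
Qed.

Lemma rev_coef_row_elsym j b : (j < #|Z|)%N -> (b <= m)%N ->
  rev_coef_row Yprod Z j b = (-1) ^+ (b + part Z j) *
    elsym (take (m - part Z j) (Y n)) (b%:Z - (part Z j)%:Z).
Proof.
move=> jZ bm; have aP : (part Z j <= m)%N.
  by rewrite -ltnS; apply: (@parts_ltn _ Z); rewrite mem_nth // size_parts.
have eY : Y n = map (@mpolyC n S) Yvars.
  by rewrite /Yvars -[RHS]map_comp.
rewrite /rev_coef_row /rev_coef bm coef_prod_elsym size_take size_Yvars ltnS leq_subr.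
rewrite rmorphM rmorphXn rmorphN rmorph1 elsym_map eY map_take.
congr (_ * elsym _ _); last by lia.
by rewrite -[LHS]signr_odd -[RHS]signr_odd; congr (_ ^+ nat_of_bool _); lia.
Qed.

Lemma minor_entry (be : {set 'I_n}) : #|be| = k ->
  minor (rev_coef_row Yprod Z) k (parts be) =
  (-1) ^+ (weight be + weight lam') * \det (\matrix_(i < k, j < k) entry be i j).
Proof.
move=> cb; rewrite -weight_removed -{1}sum_part cb -(sum_part Z) -det_sign; congr (\det _).
apply/matrixP => i j; rewrite !mxE rev_coef_row_elsym //.
  by rewrite /entry !part_removed.
rewrite -ltnS; apply: (@parts_ltn _ be); rewrite mem_nth // size_parts cb.
exact: ltn_ord.
Qed.

(** If beta does not contain lam', some row index i has beta_i < lam'_i, and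
  the entries below and to the left of (i, i) vanish, having negative index. *)
Lemma det_entry0 (be : {set 'I_n}) : ~~ contains be lam' ->
  \det (\matrix_(i < k, j < k) entry be i j) = 0.
Proof.
rewrite negb_forall => /existsP[i]; rewrite -ltnNge => h.
have ik : (i < k)%N.
  have : (i < above lam' 0)%N by rewrite -part_gt; apply: leq_ltn_trans h.
  rewrite -above_removed => /leq_trans; apply; apply: subset_leq_card.
  by apply/subsetP => x; rewrite inE => /andP[].
apply: (@det_low_block _ _ _ (Ordinal ik)) => x y /= ix yi; rewrite mxE /entry.
have h1 := leq_part be ix; have h2 := leq_part lam' yi.
have := leq_ltn_trans h1 (leq_trans h h2); move: (part be x) (part lam' y) => a b ab.
have : a%:Z - b%:Z < 0 by lia.
by case: (_ - _).
Qed.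

Hypothesis lam_strict : lam \in strict n.

(** The word of the steps has the right product by [word_perm_wmax], and it is
  reduced because its operator does not vanish on the staircase of powers of x
  times the polynomial of the full set. *)
Lemma ddiffw_redword (f : MP) :
  ddiffw (redword (longest n * (wmax lam)^-1)%g) f = steps Z n f.
Proof.
have wZ (F : MP) : ddiffw (word Z n false) F = steps Z n F.
  by rewrite ddiffw_word nremoved_n // (negbTE (odd_removed lam_strict)) !wact1g.
(* setT contains 0, as the top step requires *)
pose f0 : MP := stair m (fun d => 'X^d : {poly S}) n * PtildeX S setT.
have [wD _] := wmaxP (ltn0Sn m) lam_strict.
rewrite -wZ; apply: (@ddiffw_reduced_word _ _ (word Z n false) _ _ f0); last exact: redwordP.
  rewrite wZ /f0 steps_stair // ?inE ?orbT //; first last.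
  - by move=> d _; rewrite coefXn eqxx.
  - by move=> d; rewrite size_polyXn.
  rewrite steps_value_contractions // topset_n mulf_neq0 //; first by rewrite signr_eq0.
  exact: contractions_neq0.
rewrite prodw_word nremoved_n // (negbTE (odd_removed lam_strict)) mulg1 mul1g.
by rewrite -(word_perm_wmax lam_strict) mulgK.
Qed.

(** The three contributions are the global sign of the definition, the signs
  of the steps of the first kind, and the sign of the contractions.  The
  exponents of those steps and the parts of lam add up to the same number m in
  pairs, which brings in |lam|. *)
Lemma odd_sign :
  odd ((n * n.-1)./2 + \sum_(e < n | ~~ rem_exp Z e) e + 'C(k, 2)) = odd (fpart lam).
Proof.
have kn : (k <= n)%N by rewrite -[n in (_ <= n)%N]card_ord max_card.
set s := (\sum_(e < n | _) e)%N; pose l' := (n - k)%N.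
(* both sums run over the a outside Z, with m - a and a *)
have es : (s + weight lam = l' * m)%N.
  have -> : s = (\sum_(a : 'I_n | a \notin Z) (m - a))%N.
    rewrite /s (reindex_inj rev_ord_inj) /=; apply: eq_big => a; last by rewrite subSS.
    by rewrite /rem_exp subSS subKn ?inord_val // -ltnS.
  have -> : weight lam = (\sum_(a : 'I_n | a \notin Z) a)%N.
    rewrite /weight big_mkcond [RHS]big_mkcond; apply: eq_bigr => a _.
    rewrite in_removed // inE; case: (eqVneq a ord0) => [->|a0]; first by rewrite !if_same.
    by rewrite lt0n (a0 : (a : nat) != 0%N) /= negbK.
  rewrite -big_split /= (eq_bigr (fun=> m)) => [|a _]; last by rewrite subnK // -ltnS.
  rewrite sum_nat_const; congr (_ * _)%N; have := cardC Z; rewrite card_ord /l' => cZ.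
  by move: cZ; rewrite (@eq_card _ (fun a => a \notin Z) [predC Z]) //; move: #|[predC Z]| => c; lia.
have en : 'C(n, 2) = ('C(k, 2) + 'C(l', 2) + k * l')%N by rewrite -bin2_add subnKC.
have e2 := mul_bin2 l'.
have em : (l' * m = k * l' + l' * l'.-1)%N.
  have [->|l0] := posnP l'; first by rewrite muln0.
  transitivity (l' * (k + l'.-1))%N; last by rewrite mulnDr mulnC.
  by congr muln; move: l0 kn; rewrite /l'; lia.
have hw : ('C(#|lam|.+1, 2) <= weight lam)%N.
  rewrite /weight -(big_parts lam id) -size_parts; apply: bin2_le_sum; first exact: parts_sorted.
  by apply/allP => p /mem_partsP[b bl ->]; apply: lam_pos bl.
have eb : 'C(#|lam|.+1, 2) = (#|lam| * #|lam|.+1)./2 by rewrite bin2 mulnC.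
rewrite -bin2; have ck := card_removed lam_strict.
have cd := card_dual lam_strict.
rewrite /fpart /epart -eb; case: ifP ck => par ck.
  have el : l' = #|lam| by rewrite /l' ck; lia.
  have := binS #|lam| 1; rewrite bin1 => e3.
  move: es en e2 em hw e3; rewrite el; move: (#|lam| * _)%N (k * _)%N => x y; lia.
have el : l' = #|lam|.+1 by rewrite /l' ck; lia.
move: es en e2 em hw; rewrite el; move: (#|lam|.+1 * _)%N (k * _)%N => x y; lia.
Qed.

Lemma schubert_expand : schubertD (wmax lam) =
  (-1) ^+ (n * n.-1)./2 * \sum_(ga in strict n) Ptilde (Y n) (parts (dualp ga)) *
    steps_value Yprod Z n (ord0 |: ga).
Proof.
rewrite /schubertD ddiffw_redword //; congr (_ * _).
rewrite Delta_stair /Ptop big_distrr steps_sum; apply: eq_bigr => ga sg.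
have g0 : ord0 \notin ga by rewrite -strictE.
have -> : Ptilde (X n) (parts ga) = PtildeX _ (ord0 |: ga) by rewrite PtildeXn setU1K.
rewrite -(steps_stair u2 size_Yprod lead_Yprod) //; last by rewrite setU11 orbT.
have cw (w : {perm symb n}) : wact w (Ptilde (Y n) (parts (dualp ga))) =
    Ptilde (Y n) (parts (dualp ga)) := wact_PtildeY w _.
move: (Ptilde (Y n) _) (stair _ _ _) (PtildeX _ _) cw => c s p cw.
have e : s * (p * c) = c * (s * p) by ring.
by rewrite -[RHS](stepsZ Z n (s * p) cw) -e.
Qed.

(** The formula with the size of [removed lam] for k. *)
Theorem schubert_wmax : schubertD (wmax lam) =
  (-1) ^+ (fpart lam + weight lam')
  * \sum_(al in strict n)
      Ptilde (X n) (parts al)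
      * \sum_(be : {set 'I_n} |
               [&& contains be lam', #|be| == k & al :&: be == set0])
          (-1) ^+ (fpair al be + weight be)
          * Ptilde (Y n) (parts (dualp (al :|: be)))
          * \det (\matrix_(i < k, j < k) entry be i j).
Proof.
pose H (al be : {set 'I_n}) : MP := Ptilde (Y n) (parts (dualp (al :|: be))) *
  ((-1) ^+ (\sum_(e < n | ~~ rem_exp Z e) e) *
   ((-1) ^+ (fpair al be + 'C(k, 2)) * minor (rev_coef_row Yprod Z) k (parts be) *
    Ptilde (X n) (parts al))).
rewrite schubert_expand.
transitivity ((-1) ^+ (n * n.-1)./2 * \sum_(ga in strict n)
    \sum_(be : {set 'I_n} | (be \subset ord0 |: ga) && (#|be| == k)) H (ga :\: be) be).
  congr (_ * _); apply: eq_bigr => ga sg.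
  rewrite steps_value_contractions // topset_n // contractions_det !big_distrr /=.
  apply: eq_bigr => be /andP[sub _]; have [e1 e2 e3] := schubert_term sg sub.
  by rewrite /H e1 e2 e3.
rewrite exchange_setD !big_distrr /=; apply: eq_bigr => al sal.
rewrite !big_distrr /= [RHS]big_mkcond [LHS]big_mkcond /=; apply: eq_bigr => be _.
case: eqP => //= cb; last by rewrite andbF.
case: ifP => _; last by rewrite andbF.
rewrite andbT /H minor_entry //; case: ifPn => [_|cn]; last first.
  by rewrite (det_entry0 cn) !(mulr0, mul0r).
have sgn : (-1) ^+ (fpart lam) = (-1) ^+ (n * n.-1)./2 *
    (-1) ^+ (\sum_(e < n | ~~ rem_exp Z e) e) * (-1) ^+ 'C(k, 2) :> MP.
  by rewrite -!exprD -signr_odd -odd_sign signr_odd.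
rewrite [in RHS]exprD sgn !exprD.
move: (\det _) (Ptilde (Y n) _) (Ptilde (X n) _) ((-1) ^+ (n * n.-1)./2) => d py px s1.
move: ((-1) ^+ _) ((-1) ^+ _) ((-1) ^+ _) ((-1) ^+ _) ((-1) ^+ _) => s2 s3 s4 s5 s6.
ring.
Qed.

End DoubleSchubert.

Theorem theorem7 (n : nat) (n_gt0 : (0 < n)%N)
    (lam : {set 'I_n}) (lam_strict : lam \in strict n) :
  let l := #|lam| in
  let k := if odd n == odd l then (n - l)%N else (n - l - 1)%N in
  let lam' := dualp lam in
  schubertD (wmax lam) =
  (-1) ^+ (fpart lam + weight lam')
  * \sum_(al in strict n)
      Ptilde (X n) (parts al)
      * \sum_(be : {set 'I_n} |
               [&& contains be lam', #|be| == k & al :&: be == set0])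
          (-1) ^+ (fpair al be + weight be)
          * Ptilde (Y n) (parts (dualp (al :|: be)))
          * \det (\matrix_(i < k, j < k)
                    elsym (take (n.-1 - part lam' j) (Y n))
                         ((part be i)%:Z - (part lam' j)%:Z)).
Proof.
case: n n_gt0 lam lam_strict => // m _ lam lam_strict.
by move=> l k lam'; rewrite (schubert_wmax lam_strict) (card_removed lam_strict).
Qed.
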